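(* Let $X, Y \in \mathcal{T}(S_{1,1})$. There exists a linear isomorphism $T_X\mathcal{T}(S_{1,1}) \to T_Y\mathcal{T}(S_{1,1})$ that is an isometry for the Thurston norm $\|\cdot\|_{\mathrm{Th}}$ if and only if $X$ and $Y$ lie in the same orbit of the extended mapping class group of $S_{1,1}$.
   Context: $S_{1,1}$ is the once-punctured torus and $\mathcal{T}(S_{1,1})$ its Teichmüller space; $\ell_\alpha$ denotes the hyperbolic length function of a simple closed curve $\alpha$. The Thurston norm on $T_X\mathcal{T}(S_{1,1})$ is $\|v\|_{\mathrm{Th}} = \sup_\alpha \frac{d_X\ell_\alpha(v)}{\ell_\alpha(X)}$, the supremum over simple closed curves $\alpha$; it is the Finsler norm inducing Thurston's metric $d_{\mathrm{Th}}(X,Y)=\sup_\alpha\log(\ell_\alpha(Y)/\ell_\alpha(X))$. The extended mapping class group is the group of isotopy classes of all (possibly orientation-reversing) homeomorphisms of $S_{1,1}$, acting on $\mathcal{T}(S_{1,1})$ by change of marking. *)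

(* Defs.v *)
From Stdlib Require Import Reals ZArith List.
From Coquelicot Require Import Coquelicot.
Import ListNotations.
Open Scope R_scope.

Record mat2 := M2 { m11 : R; m12 : R; m21 : R; m22 : R }.
Definition mmul (a b : mat2) : mat2 :=
  M2 (m11 a * m11 b + m12 a * m21 b) (m11 a * m12 b + m12 a * m22 b)
     (m21 a * m11 b + m22 a * m21 b) (m21 a * m12 b + m22 a * m22 b).
Definition mid : mat2 := M2 1 0 0 1.
(* inverse of a determinant-one matrix (adjugate) *)
Definition minv1 (a : mat2) : mat2 := M2 (m22 a) (- m12 a) (- m21 a) (m11 a).
Definition mtr (a : mat2) : R := m11 a + m22 a.

(* A point is a triple (x,y,z) = (tr A, tr B, tr AB) of traces of a lift to
   SL(2,R) of the holonomy, with respect to a fixed generating pair (a,b) of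
   pi_1(S_{1,1}) = F_2. *)
Definition point := (R * R * R)%type.

Definition padd (u v : point) : point :=
  let '(u1, u2, u3) := u in let '(v1, v2, v3) := v in (u1 + v1, u2 + v2, u3 + v3).
Definition pscal (h : R) (u : point) : point :=
  let '(u1, u2, u3) := u in (h * u1, h * u2, h * u3).

Definition Teich (X : point) : Prop :=
  let '(x, y, z) := X in 2 < x /\ 2 < y /\ 2 < z /\ x * x + y * y + z * z = x * y * z.

(* tangent space T_X T(S_{1,1}) : kernel of dF, F = x^2+y^2+z^2-xyz *)
Definition Tangent (X v : point) : Prop :=
  let '(x, y, z) := X in let '(v1, v2, v3) := v in
  (2 * x - y * z) * v1 + (2 * y - x * z) * v2 + (2 * z - x * y) * v3 = 0.

(* explicit SL(2,R) matrices with tr A = x, tr B = y, tr AB = z *)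
Definition fricke_t (z : R) : R := (z + sqrt (z * z - 4)) / 2.
Definition frickeA (X : point) : mat2 := let '(x, _, _) := X in M2 x (-1) 1 0.
Definition frickeB (X : point) : mat2 :=
  let '(_, y, z) := X in M2 0 (fricke_t z) (- / fricke_t z) y.

(* Simple closed curves on S_{1,1} <-> coprime (p,q) in Z^2 up to sign
   (their homology classes).  The curve of class (p,q) is represented by the
   Christoffel word with |p| letters a^{sgn p} and |q| letters b^{sgn q}
   (true = b-letter). *)
Definition christoffel (p q : nat) : list bool :=
  map (fun i => Nat.ltb (i * q / (p + q))%nat (((i + 1) * q) / (p + q))%nat)
      (seq 0 (p + q)).

Definition word_matrix (X : point) (p q : Z) : mat2 :=
  let Ap := if (p <? 0)%Z then minv1 (frickeA X) else frickeA X in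
  let Bq := if (q <? 0)%Z then minv1 (frickeB X) else frickeB X in
  fold_left (fun M (bit : bool) => mmul M (if bit then Bq else Ap))
            (christoffel (Z.abs_nat p) (Z.abs_nat q)) mid.

Definition Racosh (u : R) : R := ln (u + sqrt (u * u - 1)).

Definition hlength (X : point) (p q : Z) : R :=
  2 * Racosh (Rabs (mtr (word_matrix X p q)) / 2).

Definition dlength (X : point) (p q : Z) (v : point) : R :=
  Derive (fun h => hlength (padd X (pscal h v)) p q) 0.

Definition ThNorm (X v : point) : Rbar :=
  Lub_Rbar (fun r => exists p q : Z, Z.gcd p q = 1%Z /\
                       r = dlength X p q v / hlength X p q).

Definition ThIsometricIso (X Y : point) (L : point -> point) : Prop :=
  (forall u v a b, Tangent X u -> Tangent X v ->
     L (padd (pscal a u) (pscal b v)) = padd (pscal a (L u)) (pscal b (L v))) /\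
  (forall u, Tangent X u -> Tangent Y (L u)) /\
  (forall u v, Tangent X u -> Tangent X v -> L u = L v -> u = v) /\
  (forall w, Tangent Y w -> exists u, Tangent X u /\ L u = w) /\
  (forall u, Tangent X u -> ThNorm Y (L u) = ThNorm X u).

(* Mod^{+-}(S_{1,1}) = Out(F_2) = GL(2,Z), acting on simple closed curves via
   the action on homology classes.  Change of marking by phi sends X to phi.X
   with l_alpha(phi.X) = l_{phi^{-1} alpha}(X). *)
Definition same_emcg_orbit (X Y : point) : Prop :=
  exists a b c d : Z, (a * d - b * c = 1 \/ a * d - b * c = -1)%Z /\
    forall p q : Z, Z.gcd p q = 1%Z ->
      hlength Y p q = hlength X (a * p + b * q)%Z (c * p + d * q)%Z.

(* Main.v *)
(** Points of Teichmueller space are identified with Markov-type trace functions [f] on primitive classes,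
    tangent vectors with solutions [g] of the linearized trace recursion, and changes of marking with
    precomposition by GL(2,Z); trace functions being determined by three values, points of one orbit have
    isometric tangent spaces.

    Conversely, every simple closed curve [u] attains the norm along a nondegenerate segment (facet) of the
    unit sphere: its ends are the stretch vectors spiralling to [u] on either side, and they lie in the unit
    ball because the holonomy has a model by nonnegative matrices whose entries satisfy g' <= g ln g, an
    inequality stable under sums and products.  Every flat arc of the sphere arises in this way: along the
    Farey path of an irrational lamination the defects [hl - dhl] are almost superadditive, while the area form
    is bounded below, so two independent vectors cannot both be extremal there.  Hence an isometry induces an
    injection of curves.  Beyond the end z of the facet with difference vector d the norm grows like
    1 + 2 Theta t / ln(1/t), in terms of z + t d, and Theta is a decreasing function of the length of [u] alone,
    so the injection does not increase lengths.  The three shortest curves of both points therefore have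
    the same lengths, and they determine the orbit. *)

(* The norm is a supremum over infinitely many curves that is also approached along limits of
   curves, so the unit sphere is not computed; only the facets and the growth just beyond their ends
   are controlled. In the facet of (1, 0) the coordinate is [al], the derivative of ln a, where a
   exp(np) dominates the trace of (n, 1), and the facet is the interval ln a - Theta <= al <= ln a.
   At distance tau beyond the upper end, the curve (n, 1) with asymptotic half length P = np + ln a
   becomes critical when tau is of order P exp(-2P), and the excess of the norm is then about tau /
   P. Since P is about ln(1/tau) / 2, this is the origin of the rate 2 tau / ln(1/tau). Constants
   depending on the rest of the surface only shift the logarithm, so with tau = Theta t just Theta
   survives in the limit. The induced map on curves is never shown to be surjective: injectivity,
   used for the isometry and for its inverse, already gives inequalities in both directions between
   the three smallest traces. *)
Require Import Defs.
From Stdlib Require Import Reals ZArith List Lia Lra Classical.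
From Coquelicot Require Import Coquelicot.
Open Scope R_scope.

(** * Induction over the bases of Z^2 *)

Section BasisInduction.
Open Scope Z_scope.

(** SL(2, Z) is generated by the rotation and the shear that appear as closure hypotheses, with the
    rows (a, b) and (c, d) as basis vectors. Euclid's algorithm on the second coordinates b, d
    drives b to 0. *)
Lemma basis_ind (Q : Z -> Z -> Z -> Z -> Prop) :
  Q 1 0 0 1 ->
  (forall a b c d, a * d - b * c = 1 -> Q a b c d -> Q c d (- a) (- b)) ->
  (forall a b c d, a * d - b * c = 1 -> Q a b c d -> Q a b (c + a) (d + b)) ->
  (forall a b c d, a * d - b * c = 1 -> Q a b c d -> Q a b (c - a) (d - b)) ->
  forall a b c d, a * d - b * c = 1 -> Q a b c d.
Proof.
  intros Q0 QS QT QT'.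
  assert (QTn : forall a b c d n, a * d - b * c = 1 -> Q a b c d ->
                  Q a b (c + n * a) (d + n * b)).
  { intros a b c d n Hdet HQ. revert n. apply (Z.bi_induction (fun n => Q a b (c + n * a) (d + n * b))).
    - intros ? ? ->. reflexivity.
    - now rewrite !Z.add_0_r.
    - intros n. split; intros H.
      + replace (c + Z.succ n * a) with (c + n * a + a) by ring.
        replace (d + Z.succ n * b) with (d + n * b + b) by ring.
        apply QT; [lia|exact H].
      + replace (c + n * a) with (c + Z.succ n * a - a) by ring.
        replace (d + n * b) with (d + Z.succ n * b - b) by ring.
        apply QT'; [lia|exact H]. }
  assert (QN : forall a b c d, a * d - b * c = 1 -> Q a b c d -> Q (-a) (-b) (-c) (-d)).
  { intros a b c d H HQ. apply QS in HQ; [|exact H]. apply QS in HQ; [|lia]. exact HQ. }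
  enough (H : forall n a b c d, (Z.abs b < n) -> 0 <= n -> a * d - b * c = 1 -> Q a b c d).
  { intros a b c d Hd. apply (H (Z.abs b + 1)); lia. }
  intros n0 a b c d Hb Hn0. revert a b c d Hb. pattern n0. apply natlike_ind; [lia| |exact Hn0].
  clear n0 Hn0. intros n Hn IH a b c d Hb Hd.
  destruct (Z.eq_dec b 0) as [->|Hb0].
  - assert (Had : a * d = 1) by lia.
    apply Z.mul_eq_1 in Had as Ha.
    destruct Ha as [->| ->].
    + assert (d = 1) as -> by lia.
      generalize (QTn 1 0 0 1 c eq_refl Q0). now rewrite Z.mul_1_r, Z.mul_0_r.
    + assert (d = -1) as -> by lia.
      assert (H : Q (-1) 0 0 (-1)) by exact (QN 1 0 0 1 eq_refl Q0).
      generalize (QTn (-1) 0 0 (-1) (-c) eq_refl H).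
      now replace (0 + - c * -1) with c by ring; rewrite Z.mul_0_r.
  - set (k := d / b).
    assert (Hr : Z.abs (d - k * b) < Z.abs b).
    { unfold k. rewrite Z.mul_comm, <- Z.mod_eq by exact Hb0.
      destruct (Z.lt_total b 0) as [H|[H|H]]; [|lia|].
      - generalize (Z.mod_neg_bound d b H). lia.
      - generalize (Z.mod_pos_bound d b H). lia. }
    assert (H1 : Q (c - k * a) (d - k * b) (-a) (-b)) by (apply IH; lia).
    apply QS in H1; [|lia]. apply QN in H1; [|lia].
    rewrite !Z.opp_involutive in H1.
    apply (QTn _ _ _ _ k) in H1; [|lia].
    now replace c with (c - k * a + k * a) by ring; replace d with (d - k * b + k * b) by ring.
Qed.

Lemma gcd_det a b c d : (a * d - b * c = 1 \/ a * d - b * c = -1) -> Z.gcd a b = 1.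
Proof.
  intros H. apply Z.bezout_1_gcd.
  destruct H as [H|H]; [exists d, (-c)|exists (-d), c]; lia.
Qed.

Lemma gcd_basis a b : Z.gcd a b = 1 -> exists c d, a * d - b * c = 1.
Proof.
  intros H. destruct (Z.gcd_bezout a b 1 H) as [u [v E]].
  exists (-v), u. lia.
Qed.

Lemma gcd_opp a b : Z.gcd a b = 1 -> Z.gcd (-a) (-b) = 1.
Proof. now rewrite Z.gcd_opp_l, Z.gcd_opp_r. Qed.

Lemma gcd_mat a b c d p q : (a * d - b * c = 1 \/ a * d - b * c = -1) ->
  Z.gcd p q = 1 -> Z.gcd (a * p + b * q) (c * p + d * q) = 1.
Proof.
  intros H Hp. destruct (gcd_basis p q Hp) as [r [s E]].
  apply (gcd_det _ _ (a * r + b * s) (c * r + d * s)).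
  destruct H as [H|H]; [left|right];
  replace ((a * p + b * q) * (c * r + d * s) - (c * p + d * q) * (a * r + b * s))
    with ((a * d - b * c) * (p * s - q * r)) by ring; rewrite E, H; reflexivity.
Qed.

(* Euclid's algorithm on the coordinates (i, j) descends the Stern-Brocot tree. *)
Lemma cone_ind (Q : Z -> Z -> Z -> Z -> Prop) :
  (forall a b c d, Q a b c d -> Q a b (a + c) (b + d)) ->
  (forall a b c d, Q a b c d -> Q (a + c) (b + d) c d) ->
  forall a b c d i j, Q a b c d -> 0 < i -> 0 < j -> Z.gcd i j = 1 ->
  exists a' b' c' d', Q a' b' c' d' /\ i * a + j * c = a' + c' /\ i * b + j * d = b' + d'.
Proof.
  intros QL QR a b c d i j HQ Hi Hj Hg.
  remember (Z.to_nat (i + j)) as n eqn:En.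
  revert a b c d i j HQ Hi Hj Hg En.
  induction n as [n IH] using lt_wf_ind. intros a b c d i j HQ Hi Hj Hg En.
  destruct (Z.lt_total i j) as [H|[H|H]].
  - destruct (IH (Z.to_nat (i + (j - i))) ltac:(lia) (a + c) (b + d) c d i (j - i))
      as (a' & b' & c' & d' & H1 & H2 & H3); try lia.
    + now apply QR.
    + rewrite Z.gcd_sub_diag_r. exact Hg.
    + exists a', b', c', d'. split; [exact H1|]. lia.
  - subst j. rewrite Z.gcd_diag in Hg.
    assert (i = 1) as -> by lia. exists a, b, c, d. split; [exact HQ|lia].
  - destruct (IH (Z.to_nat ((i - j) + j)) ltac:(lia) a b (a + c) (b + d) (i - j) j)
      as (a' & b' & c' & d' & H1 & H2 & H3); try lia.
    + now apply QL.
    + rewrite Z.gcd_comm, Z.gcd_sub_diag_r, Z.gcd_comm. exact Hg.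
    + exists a', b', c', d'. split; [exact H1|]. lia.
Qed.

End BasisInduction.

(** * Christoffel words *)

(** The equation says m / n = k + r / n' + s / (n n'), and the last two terms add up to less than
    1. *)
Lemma floor_div_unique (m n n' k r s : nat) : (0 < n')%nat ->
  (m * n' = (k * n' + r) * n + s)%nat -> (r * n + s < n * n')%nat -> (m / n = k)%nat.
Proof.
  intros Hn' E H. symmetry.
  assert (L : (k * n <= m)%nat) by (apply (Nat.mul_le_mono_pos_r _ _ n'); lia).
  apply (Nat.div_unique _ _ _ (m - k * n)); [|lia].
  apply (Nat.mul_lt_mono_pos_r n'); [exact Hn'|].
  rewrite Nat.mul_sub_distr_r. lia.
Qed.

(** Standard factorization of a Christoffel word. The slope of the mediant exceeds b / (a + b) by
    only 1 / (n (a + b)) and falls short of d / (c + d) by only 1 / (n (c + d)), so on each of the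
    two blocks the floors agree with those of the shorter word. *)
Lemma christoffel_cat (a b c d : nat) : (a * d = b * c + 1)%nat ->
  christoffel (a + c) (b + d) = christoffel a b ++ christoffel c d.
Proof.
  intros H. unfold christoffel.
  replace (a + c + (b + d))%nat with ((a + b) + (c + d))%nat by lia.
  assert (Ha : (a <> 0)%nat) by (intros ->; lia). assert (Hd : (d <> 0)%nat) by (intros ->; lia).
  rewrite seq_app, map_app. simpl (0 + (a + b))%nat.
  set (n := (a + b + (c + d))%nat).
  assert (I1 : ((a + b) * (b + d) = b * n + 1)%nat).
  { unfold n. replace ((a + b) * (b + d))%nat with (a * b + b * b + b * d + a * d)%nat by ring.
    rewrite H. ring. }
  assert (I2 : ((b + d) * (c + d) + 1 = d * n)%nat).
  { unfold n. replace (d * (a + b + (c + d)))%nat with (d * b + d * c + d * d + a * d)%nat by ring.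
    rewrite H. ring. }
  assert (Hn : (n = a + b + (c + d))%nat) by reflexivity. clearbody n.
  assert (F1 : forall i, (i <= a + b)%nat -> (i * (b + d) / n = i * b / (a + b))%nat).
  { intros i Hi.
    generalize (Nat.div_mod_eq (i * b) (a + b)) (Nat.mod_upper_bound (i * b) (a + b) ltac:(lia)).
    set (k := (i * b / (a + b))%nat). set (r := (i * b mod (a + b))%nat). intros E Hr.
    apply (floor_div_unique _ _ (a + b) k r i); [lia| |].
    - replace (k * (a + b) + r)%nat with (i * b)%nat by lia.
      replace (i * (b + d) * (a + b))%nat with (i * ((a + b) * (b + d)))%nat by ring.
      rewrite I1. ring.
    - generalize (Nat.mul_le_mono_l (S r) (a + b) n Hr). lia. }
  assert (F2 : forall j, (j <= c + d)%nat ->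
     (((a + b) + j) * (b + d) / n = b + j * d / (c + d))%nat).
  { intros j Hj.
    generalize (Nat.div_mod_eq (j * d) (c + d)) (Nat.mod_upper_bound (j * d) (c + d) ltac:(lia)).
    set (k := (j * d / (c + d))%nat). set (r := (j * d mod (c + d))%nat). intros E Hr.
    apply (floor_div_unique _ _ (c + d) (b + k) r (c + d - j)); [lia| |].
    - replace ((b + k) * (c + d) + r)%nat with (b * (c + d) + j * d)%nat by lia.
      apply (Nat.add_cancel_r _ _ j).
      replace ((b * (c + d) + j * d) * n + (c + d - j) + j)%nat
        with ((b * (c + d) + j * d) * n + (c + d))%nat by lia.
      replace ((a + b + j) * (b + d) * (c + d) + j)%nat
        with (((a + b) * (b + d)) * (c + d) + j * ((b + d) * (c + d) + 1))%nat by ring.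
      rewrite I1, I2. ring.
    - generalize (Nat.mul_le_mono_l (S r) (c + d) n Hr). lia. }
  f_equal.
  - apply map_ext_in. intros i Hi. apply in_seq in Hi.
    rewrite !F1 by lia. reflexivity.
  - replace (seq (a + b) (c + d)) with (map (fun j => (a + b + j)%nat) (seq 0 (c + d))).
    + rewrite map_map. apply map_ext_in. intros j Hj. apply in_seq in Hj.
      replace (a + b + j + 1)%nat with (a + b + (j + 1))%nat by lia.
      rewrite !F2 by lia.
      destruct (Nat.ltb_spec (j * d / (c + d)) ((j + 1) * d / (c + d)));
      destruct (Nat.ltb_spec (b + j * d / (c + d)) (b + (j + 1) * d / (c + d))); try reflexivity; lia.
    + generalize (a + b)%nat (c + d)%nat. clear. intros m n. revert m.
      induction n as [|n IH]; intros m; [reflexivity|].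
      simpl. f_equal; [lia|]. rewrite <- seq_shift, map_map.
      rewrite <- (IH (S m)). apply map_ext. intros; lia.
Qed.

(** * Trace identities for words in two matrices of determinant one *)

Definition mdet (M : mat2) : R := m11 M * m22 M - m12 M * m21 M.

Lemma mat2_eq (M N : mat2) :
  m11 M = m11 N -> m12 M = m12 N -> m21 M = m21 N -> m22 M = m22 N -> M = N.
Proof. destruct M, N; simpl; intros; congruence. Qed.

Lemma mmul_assoc M N P : mmul (mmul M N) P = mmul M (mmul N P).
Proof. apply mat2_eq; simpl; ring. Qed.

Lemma mmul_id_l M : mmul mid M = M.
Proof. apply mat2_eq; simpl; ring. Qed.

Lemma mmul_id_r M : mmul M mid = M.
Proof. apply mat2_eq; simpl; ring. Qed.

Lemma mdet_mul M N : mdet (mmul M N) = mdet M * mdet N.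
Proof. unfold mdet; simpl; ring. Qed.

Lemma mdet_inv M : mdet (minv1 M) = mdet M.
Proof. unfold mdet; simpl; ring. Qed.

Lemma mtr_inv M : mtr (minv1 M) = mtr M.
Proof. unfold mtr; simpl; ring. Qed.

Lemma minv1_invol M : minv1 (minv1 M) = M.
Proof. apply mat2_eq; simpl; ring. Qed.

Lemma minv1_l M : mdet M = 1 -> mmul (minv1 M) M = mid.
Proof. unfold mdet; intros H; apply mat2_eq; simpl; lra. Qed.

Lemma minv1_r M : mdet M = 1 -> mmul M (minv1 M) = mid.
Proof. unfold mdet; intros H; apply mat2_eq; simpl; lra. Qed.

Lemma mtr_mul_inv M N : mtr (mmul M N) + mtr (mmul M (minv1 N)) = mtr M * mtr N.
Proof. unfold mtr; simpl; ring. Qed.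

Definition word (A B : mat2) (p q : Z) : mat2 :=
  fold_left (fun M (bit : bool) => mmul M (if bit then B else A))
            (christoffel (Z.abs_nat p) (Z.abs_nat q)) mid.

Lemma fold_left_mmul (A B : mat2) l M :
  fold_left (fun M (bit : bool) => mmul M (if bit then B else A)) l M =
  mmul M (fold_left (fun M (bit : bool) => mmul M (if bit then B else A)) l mid).
Proof.
  revert M. induction l as [|x l IH]; intros M; simpl.
  - now rewrite mmul_id_r.
  - rewrite IH, (IH (mmul mid _)), mmul_id_l, mmul_assoc. reflexivity.
Qed.

Lemma word_mul A B a b c d : (0 <= a -> 0 <= b -> 0 <= c -> 0 <= d -> a * d - b * c = 1)%Z ->
  (0 <= a)%Z -> (0 <= b)%Z -> (0 <= c)%Z -> (0 <= d)%Z ->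
  word A B (a + c) (b + d) = mmul (word A B a b) (word A B c d).
Proof.
  intros H Ha Hb Hc Hd. specialize (H Ha Hb Hc Hd). unfold word.
  rewrite !Zabs2Nat.inj_add by assumption.
  rewrite christoffel_cat by nia.
  rewrite fold_left_app, fold_left_mmul. reflexivity.
Qed.

Lemma word_det A B p q : mdet A = 1 -> mdet B = 1 -> mdet (word A B p q) = 1.
Proof.
  intros HA HB. unfold word.
  assert (H1 : mdet mid = 1) by (unfold mdet; simpl; ring).
  revert H1. generalize mid. induction (christoffel _ _) as [|x l IH]; intros M HM; simpl; [exact HM|].
  apply IH. rewrite mdet_mul, HM. destruct x; rewrite ?HA, ?HB; ring.
Qed.

Lemma word_10 A B : word A B 1 0 = A.
Proof. apply mmul_id_l. Qed.
Lemma word_01 A B : word A B 0 1 = B.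
Proof. apply mmul_id_l. Qed.

(** Cayley-Hamilton, M^2 = tr(M) M - 1, multiplied by N. *)
Lemma mtr_mul_sq M N : mdet M = 1 -> mtr (mmul M (mmul M N)) = mtr M * mtr (mmul M N) - mtr N.
Proof. 
  intros H. unfold mtr; simpl. unfold mdet in H.
  replace (m11 N + m22 N) with ((m11 N + m22 N) * (m11 M * m22 M - m12 M * m21 M)) by (rewrite H; ring).
  ring.
Qed.

Lemma mtr_mul_sq_r M N : mdet N = 1 -> mtr (mmul (mmul M N) N) = mtr (mmul M N) * mtr N - mtr M.
Proof.
  intros H. rewrite <- (mtr_mul_inv (mmul M N) N), (mmul_assoc M N (minv1 N)), minv1_r, mmul_id_r by exact H. ring.
Qed.

(** A word in the inverses is the inverse of the reversed word. Instead of comparing a Christoffel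
    word with its reversal, the proof lets both sides follow the same second order trace recursion
    down the Stern-Brocot tree; hence three traces are carried along, those of both ends and of the
    mediant. *)
Lemma mtr_word_inv A B p q : mdet A = 1 -> mdet B = 1 -> (0 <= p)%Z -> (0 <= q)%Z -> Z.gcd p q = 1%Z ->
  mtr (word (minv1 A) (minv1 B) p q) = mtr (word A B p q).
Proof.
  intros HA HB Hp Hq Hg.
  destruct (Z.eq_dec p 0) as [->|Hp0].
  { simpl in Hg. replace q with 1%Z by lia. rewrite !word_01. apply mtr_inv. }
  destruct (Z.eq_dec q 0) as [->|Hq0].
  { rewrite Z.gcd_0_r in Hg. replace p with 1%Z by lia. rewrite !word_10. apply mtr_inv. }
  set (A' := minv1 A). set (B' := minv1 B).
  assert (HA' : mdet A' = 1) by (unfold A'; rewrite mdet_inv; exact HA).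
  assert (HB' : mdet B' = 1) by (unfold B'; rewrite mdet_inv; exact HB).
  set (Q := fun a b c d =>
     (0 <= a)%Z /\ (0 <= b)%Z /\ (0 <= c)%Z /\ (0 <= d)%Z /\ (a * d - b * c = 1)%Z /\
     mtr (word A' B' a b) = mtr (word A B a b) /\
     mtr (word A' B' c d) = mtr (word A B c d) /\
     mtr (word A' B' (a + c) (b + d)) = mtr (word A B (a + c) (b + d))).
  assert (QL : forall a b c d, Q a b c d -> Q a b (a + c)%Z (b + d)%Z).
  { intros a b c d (Ha & Hb & Hc & Hd & Hdet & E1 & E2 & E3).
    repeat split; try lia; try assumption.
    rewrite !(word_mul _ _ a b (a + c) (b + d)) by lia.
    rewrite !(word_mul _ _ a b c d) in E3 by lia. rewrite !(word_mul _ _ a b c d) by lia.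
    rewrite !mtr_mul_sq by (apply word_det; assumption). rewrite E1, E2, E3. reflexivity. }
  assert (QR : forall a b c d, Q a b c d -> Q (a + c)%Z (b + d)%Z c d).
  { intros a b c d (Ha & Hb & Hc & Hd & Hdet & E1 & E2 & E3).
    repeat split; try lia; try assumption.
    rewrite !(word_mul _ _ (a + c) (b + d) c d) by lia.
    rewrite !(word_mul _ _ a b c d) in E3 by lia. rewrite !(word_mul _ _ a b c d) by lia.
    rewrite !mtr_mul_sq_r by (apply word_det; assumption). rewrite E1, E2, E3. reflexivity. }
  assert (Q0 : Q 1%Z 0%Z 0%Z 1%Z).
  { repeat split; try lia.
    + rewrite !word_10. apply mtr_inv.
    + rewrite !word_01. apply mtr_inv.
    + rewrite !(word_mul _ _ 1 0 0 1) by lia. rewrite !word_10, !word_01.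
      unfold A', B', mtr; simpl; ring. }
  destruct (cone_ind Q QL QR _ _ _ _ p q Q0 ltac:(lia) ltac:(lia) Hg)
    as (a & b & c & d & (_ & _ & _ & _ & _ & _ & _ & E3) & F1 & F2).
  replace p with (a + c)%Z by lia. replace q with (b + d)%Z by lia. exact E3.
Qed.

(** * Trace functions *)

Definition prim (p q : Z) : Prop := Z.gcd p q = 1%Z.

Definition EvenFn (f : Z -> Z -> R) : Prop :=
  forall p q, prim p q -> f (- p)%Z (- q)%Z = f p q.

(* The recursion is the identity tr UV + tr UV^{-1} = tr U tr V for generators U, V of the free group. *)
Definition TraceFn (f : Z -> Z -> R) : Prop :=
  EvenFn f /\
  forall a b c d, (a * d - b * c = 1)%Z ->
    f (a + c)%Z (b + d)%Z + f (a - c)%Z (b - d)%Z = f a b * f c d.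

Lemma prim_l a b c d : (a * d - b * c = 1)%Z -> prim a b.
Proof. intros H. apply (gcd_det a b c d). now left. Qed.
Lemma prim_r a b c d : (a * d - b * c = 1)%Z -> prim c d.
Proof. intros H. apply (gcd_det c d a b). right. lia. Qed.
Lemma prim_add a b c d : (a * d - b * c = 1)%Z -> prim (a + c) (b + d).
Proof. intros H. apply (gcd_det _ _ c d). left. lia. Qed.
Lemma prim_sub a b c d : (a * d - b * c = 1)%Z -> prim (a - c) (b - d).
Proof. intros H. apply (gcd_det _ _ c d). left. lia. Qed.

(** For two vectors u, v of the closed quadrant with determinant one, u - v or v - u stays in the
    quadrant, where concatenation of words applies. The only exception is u = (1, 0), v = (0, 1),
    whose difference (1, -1) is covered by the separate hypothesis. *)
Lemma trace_rec_quadrant A B f : mdet A = 1 -> mdet B = 1 -> EvenFn f ->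
  (forall p q, (0 <= p)%Z -> (0 <= q)%Z -> prim p q -> f p q = mtr (word A B p q)) ->
  f 1%Z (-1)%Z = mtr (mmul A (minv1 B)) ->
  forall a b c d, (0 <= a)%Z -> (0 <= b)%Z -> (0 <= c)%Z -> (0 <= d)%Z -> (a * d - b * c = 1)%Z ->
    f (a + c)%Z (b + d)%Z + f (a - c)%Z (b - d)%Z = f a b * f c d.
Proof.
  intros HA HB He Hf H11 a b c d Ha Hb Hc Hd Hdet.
  pose proof (prim_l _ _ _ _ Hdet) as Pu. pose proof (prim_r _ _ _ _ Hdet) as Pv.
  pose proof (prim_add _ _ _ _ Hdet) as Pa. pose proof (prim_sub _ _ _ _ Hdet) as Ps.
  rewrite (Hf (a + c)%Z), (Hf a), (Hf c) by (assumption || lia).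
  rewrite (word_mul _ _ a b c d) by lia.
  rewrite <- mtr_mul_inv. f_equal.
  assert (DU : mdet (word A B a b) = 1) by now apply word_det.
  assert (DV : mdet (word A B c d) = 1) by now apply word_det.
  assert (Hcase : (c <= a /\ d <= b)%Z \/ (a <= c /\ b <= d)%Z \/
                  (c < a /\ b < d)%Z \/ (a < c /\ d < b)%Z) by lia.
  destruct Hcase as [[H1 H2]|[[H1 H2]|[[H1 H2]|[H1 H2]]]].
  - rewrite Hf by (assumption || lia).
    assert (E : word A B a b = mmul (word A B (a - c) (b - d)) (word A B c d)).
    { rewrite <- word_mul by lia. f_equal; lia. }
    rewrite E, mmul_assoc, minv1_r, mmul_id_r by exact DV. reflexivity.
  - rewrite <- He by exact Ps. replace (- (a - c))%Z with (c - a)%Z by lia.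
    replace (- (b - d))%Z with (d - b)%Z by lia.
    assert (P' : prim (c - a) (d - b)).
    { replace (c - a)%Z with (- (a - c))%Z by lia. replace (d - b)%Z with (- (b - d))%Z by lia.
      now apply gcd_opp. }
    rewrite Hf by (assumption || lia).
    assert (E : word A B c d = mmul (word A B a b) (word A B (c - a) (d - b))).
    { rewrite <- word_mul by lia. f_equal; lia. }
    assert (E2 : word A B (c - a) (d - b) = mmul (minv1 (word A B a b)) (word A B c d)).
    { rewrite E, <- mmul_assoc, minv1_l, mmul_id_l by exact DU. reflexivity. }
    rewrite E2. unfold mtr; simpl; ring.
  - assert (H3 : ((c + 1) * (b + 1) <= a * d)%Z) by (apply Z.mul_le_mono_nonneg; lia).
    assert (c = 0)%Z by lia. assert (b = 0)%Z by lia. subst b c.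
    destruct (Z.mul_eq_1 a d) as [-> | ->]; try lia. replace d with 1%Z by lia.
    rewrite word_10, word_01. exact H11.
  - assert (a * d <= c * b)%Z by (apply Z.mul_le_mono_nonneg; lia). lia.
Qed.

Definition sgn_inv (p : Z) (A : mat2) : mat2 := if (p <? 0)%Z then minv1 A else A.

Lemma trace_fn_word A B : mdet A = 1 -> mdet B = 1 ->
  TraceFn (fun p q => mtr (word (sgn_inv p A) (sgn_inv q B) p q)).
Proof.
  intros HA HB. set (f := fun p q => _).
  assert (HA' : mdet (minv1 A) = 1) by now rewrite mdet_inv.
  assert (HB' : mdet (minv1 B) = 1) by now rewrite mdet_inv.
  assert (Wabs : forall A B p q, word A B (Z.abs p) (Z.abs q) = word A B p q).
  { intros. unfold word. f_equal. f_equal; lia. }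
  assert (Wopp : forall A B p q, word A B (- p) (- q) = word A B p q).
  { intros. unfold word. f_equal. f_equal; lia. }
  assert (Hinv : forall A B p q, mdet A = 1 -> mdet B = 1 -> prim p q ->
    mtr (word (minv1 A) (minv1 B) p q) = mtr (word A B p q)).
  { intros A0 B0 p q H1 H2 Hg. rewrite <- (Wabs (minv1 A0)), <- (Wabs A0).
    apply mtr_word_inv; try assumption; try lia.
    unfold prim in Hg. now rewrite Z.gcd_abs_l, Z.gcd_abs_r. }
  assert (He : EvenFn f).
  { intros p q Hg. unfold f. rewrite Wopp. unfold sgn_inv.
    destruct (Z.ltb_spec p 0); destruct (Z.ltb_spec (- p) 0); try lia;
    destruct (Z.ltb_spec q 0); destruct (Z.ltb_spec (- q) 0); try lia;
    try reflexivity;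
    try (rewrite <- Hinv by (rewrite ?mdet_inv; assumption); rewrite ?minv1_invol; reflexivity).
    (* On the axes negation inverts only one generator, but then the other one does not occur in the
       word. *)
    - assert (q = 0)%Z as -> by lia. unfold prim in Hg. rewrite Z.gcd_0_r in Hg.
      replace p with (-1)%Z by lia. change (mtr (word A B 1 0) = mtr (word (minv1 A) B 1 0)).
      now rewrite !word_10, mtr_inv.
    - assert (q = 0)%Z as -> by lia. unfold prim in Hg. rewrite Z.gcd_0_r in Hg.
      replace p with (1)%Z by lia. 
      now rewrite !word_10, mtr_inv.
    - assert (p = 0)%Z as -> by lia. unfold prim in Hg. simpl in Hg.
      replace q with (-1)%Z by lia. change (mtr (word A B 0 1) = mtr (word A (minv1 B) 0 1)).
      now rewrite !word_01, mtr_inv.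
    - assert (p = 0)%Z as -> by lia. unfold prim in Hg. simpl in Hg.
      replace q with (1)%Z by lia.
      now rewrite !word_01, mtr_inv. }
  split; [exact He|].
  assert (R1 : forall a b c d, (0 <= a)%Z -> (0 <= b)%Z -> (0 <= c)%Z -> (0 <= d)%Z ->
    (a * d - b * c = 1)%Z -> f (a + c)%Z (b + d)%Z + f (a - c)%Z (b - d)%Z = f a b * f c d).
  { apply (trace_rec_quadrant A B); try assumption.
    - intros p q Hp Hq _. unfold f, sgn_inv.
      destruct (Z.ltb_spec p 0); [lia|]. destruct (Z.ltb_spec q 0); [lia|]. reflexivity.
    - unfold f, sgn_inv. simpl. change (mtr (word A (minv1 B) 1 1) = mtr (mmul A (minv1 B))).
      rewrite (word_mul _ _ 1 0 0 1) by lia. now rewrite word_10, word_01. }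
  assert (Fq : forall p q, (0 <= p)%Z -> (0 <= q)%Z -> prim p q -> f p (- q)%Z = mtr (word A (minv1 B) p q)).
  { intros p q Hp Hq Hg. unfold f, sgn_inv.
    destruct (Z.ltb_spec p 0); [lia|]. destruct (Z.ltb_spec (-q) 0).
    - rewrite <- Wabs. f_equal. f_equal; lia.
    - assert (q = 0)%Z as -> by lia. unfold prim in Hg. rewrite Z.gcd_0_r in Hg.
      replace p with (1)%Z by lia. now rewrite !word_10. }
  (* The fourth quadrant is the first one for the generators A, B^-1. The reflection changes the
     sign of the determinant. *)
  assert (R2 : forall a b c d, (0 <= a)%Z -> (b <= 0)%Z -> (0 <= c)%Z -> (d <= 0)%Z ->
    (b * c - a * d = 1)%Z -> f (a + c)%Z (b + d)%Z + f (a - c)%Z (b - d)%Z = f a b * f c d).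
  { intros a b c d Ha Hb Hc Hd Hdet.
    generalize (trace_rec_quadrant A (minv1 B) (fun p q => f p (- q)%Z) HA HB').
    intros H. specialize (H ltac:(intros p q Hg; apply He; unfold prim in *; now rewrite Z.gcd_opp_r)).
    specialize (H Fq). rewrite minv1_invol in H.
    specialize (H ltac:(change (f 1%Z 1%Z = mtr (mmul A B)); unfold f; simpl;
      change (mtr (word A B 1 1) = mtr (mmul A B));
      rewrite (word_mul _ _ 1 0 0 1) by lia; now rewrite word_10, word_01)).
    specialize (H a (-b)%Z c (-d)%Z Ha ltac:(lia) Hc ltac:(lia) ltac:(lia)).
    simpl in H. rewrite !Z.opp_involutive in H. rewrite <- H. f_equal; f_equal; lia. }
  (* up to the signs and the order of u and v, both lie in one closed quadrant *)
  set (RR := fun a b c d => f (a + c)%Z (b + d)%Z + f (a - c)%Z (b - d)%Z = f a b * f c d).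
  set (dt := fun a b c d => (a * d - b * c = 1 \/ a * d - b * c = -1)%Z).
  assert (Pl : forall a b c d, dt a b c d -> prim a b) by (intros a b c d; apply gcd_det).
  assert (Pr : forall a b c d, dt a b c d -> prim c d).
  { intros a b c d H. apply (gcd_det c d a b). unfold dt in H. lia. }
  assert (Pm : forall a b c d, dt a b c d -> prim (a - c) (b - d)).
  { intros a b c d H. apply (gcd_det _ _ c d). unfold dt in H. lia. }
  assert (Sw : forall a b c d, dt a b c d -> RR c d a b -> RR a b c d).
  { unfold RR. intros a b c d H E. rewrite Rmult_comm, <- E. f_equal; [f_equal; lia|].
    rewrite <- He by (apply Pm; exact H). f_equal; lia. }
  assert (S1 : forall a b c d, dt a b c d -> RR (-a)%Z (-b)%Z c d -> RR a b c d).
  { unfold RR. intros a b c d H E. rewrite He in E by (apply (Pl a b c d); exact H). rewrite <- E.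
    rewrite Rplus_comm. f_equal; [rewrite <- He by (apply Pm; exact H); f_equal; lia|].
    rewrite <- He by (apply (gcd_det _ _ c d); unfold dt in H; lia). f_equal; lia. }
  assert (S2 : forall a b c d, dt a b c d -> RR a b (-c)%Z (-d)%Z -> RR a b c d).
  { unfold RR. intros a b c d H E. rewrite He in E by (apply (Pr a b c d); exact H). rewrite <- E.
    rewrite Rplus_comm. f_equal; f_equal; lia. }
  assert (Q14 : forall a b c d, dt a b c d -> (0 <= a)%Z -> (0 <= c)%Z ->
     ((0 <= b)%Z /\ (0 <= d)%Z) \/ ((b <= 0)%Z /\ (d <= 0)%Z) -> RR a b c d).
  { intros a b c d H Ha Hc [[Hb Hd]|[Hb Hd]]; unfold dt in H.
    - destruct H as [H|H]; [now apply R1|]. apply Sw; [right; lia|]. apply R1; lia.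
    - destruct H as [H|H]; [|now apply R2; lia]. apply Sw; [left; lia|]. apply R2; lia. }
  assert (Q2 : forall a b c d, dt a b c d -> (0 <= a)%Z -> (0 <= c)%Z -> RR a b c d).
  { intros a b c d H Ha Hc.
    destruct (Z_le_gt_dec 0 b); destruct (Z_le_gt_dec 0 d); try (apply Q14; (assumption || lia)).
    - destruct (Z.eq_dec b 0) as [->|]; [apply Q14; (assumption || lia)|].
      destruct (Z.eq_dec a 0) as [->|].
      + apply S1; [exact H|]. apply Q14; unfold dt in *; lia.
      + assert (c = 0)%Z as ->.
        { destruct (Z.eq_dec c 0) as [|Hc0]; [assumption|].
          generalize (Z.mul_le_mono_nonneg 1 a 1 (-d) ltac:(lia) ltac:(lia) ltac:(lia) ltac:(lia))
            (Z.mul_le_mono_nonneg 1 b 1 c ltac:(lia) ltac:(lia) ltac:(lia) ltac:(lia)).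
          unfold dt in H. lia. }
        apply S2; [exact H|].
        apply Q14; unfold dt in *; lia.
    - destruct (Z.eq_dec d 0) as [->|]; [apply Q14; (assumption || lia)|].
      destruct (Z.eq_dec a 0) as [->|].
      + apply S1; [exact H|]. apply Q14; unfold dt in *; lia.
      + assert (c = 0)%Z as ->.
        { destruct (Z.eq_dec c 0) as [|Hc0]; [assumption|].
          generalize (Z.mul_le_mono_nonneg 1 a 1 d ltac:(lia) ltac:(lia) ltac:(lia) ltac:(lia))
            (Z.mul_le_mono_nonneg 1 (-b) 1 c ltac:(lia) ltac:(lia) ltac:(lia) ltac:(lia)).
          unfold dt in H. lia. }
        apply S2; [exact H|].
        apply Q14; unfold dt in *; lia. }
  assert (Q3 : forall a b c d, dt a b c d -> (0 <= a)%Z -> RR a b c d).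
  { intros a b c d H Ha. destruct (Z_le_gt_dec 0 c); [now apply Q2|].
    apply S2; [exact H|]. apply Q2; unfold dt in *; lia. }
  intros a b c d H. assert (H' : dt a b c d) by now left.
  destruct (Z_le_gt_dec 0 a); [now apply Q3|].
  apply S1; [exact H'|]. apply Q3; unfold dt in *; lia.
Qed.

(** The bound says that every simple closed curve is hyperbolic. By Fricke's identity tr [A, B] =
    x^2 + y^2 + z^2 - xyz - 2, the last clause says that the boundary is a cusp: the commutator has
    trace -2. *)
Definition Markov (f : Z -> Z -> R) : Prop :=
  TraceFn f /\ (forall p q, prim p q -> 2 < f p q) /\
  forall a b c d, (a * d - b * c = 1)%Z ->
    f a b * f a b + f c d * f c d + f (a + c)%Z (b + d)%Z * f (a + c)%Z (b + d)%Z =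
    f a b * f c d * f (a + c)%Z (b + d)%Z.

Definition DTraceFn (f g : Z -> Z -> R) : Prop :=
  EvenFn g /\
  forall a b c d, (a * d - b * c = 1)%Z ->
    g (a + c)%Z (b + d)%Z + g (a - c)%Z (b - d)%Z = g a b * f c d + f a b * g c d.

Definition Tan (f g : Z -> Z -> R) : Prop :=
  DTraceFn f g /\
  forall a b c d, (a * d - b * c = 1)%Z ->
    let x := f a b in let y := f c d in let z := f (a + c)%Z (b + d)%Z in
    (2 * x - y * z) * g a b + (2 * y - x * z) * g c d +
    (2 * z - x * y) * g (a + c)%Z (b + d)%Z = 0.

Lemma even_swap (f : Z -> Z -> R) a b c d : EvenFn f -> (a * d - b * c = 1)%Z ->
  f (c - a)%Z (d - b)%Z = f (a - c)%Z (b - d)%Z.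
Proof.
  intros He H. rewrite <- (He (a - c)%Z) by (now apply prim_sub). f_equal; lia.
Qed.

Lemma trace_unique f f' : TraceFn f -> TraceFn f' ->
  f 1%Z 0%Z = f' 1%Z 0%Z -> f 0%Z 1%Z = f' 0%Z 1%Z -> f 1%Z 1%Z = f' 1%Z 1%Z ->
  forall p q, prim p q -> f p q = f' p q.
Proof.
  intros [He Hr] [He' Hr'] E1 E2 E3 p q Hp.
  destruct (gcd_basis p q Hp) as [r [s Hd]].
  cut (f p q = f' p q /\ f r s = f' r s /\ f (p + r)%Z (q + s)%Z = f' (p + r)%Z (q + s)%Z); [tauto|].
  revert p q r s Hd Hp. 
  intros p q r s Hd _. revert p q r s Hd.
  apply (basis_ind (fun p q r s => f p q = f' p q /\ f r s = f' r s /\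
     f (p + r)%Z (q + s)%Z = f' (p + r)%Z (q + s)%Z)).
  - tauto.
  - intros a b c d Hd (A1 & A2 & A3).
    rewrite (He a b), (He' a b) by (now apply (prim_l a b c d)).
    change (c + - a)%Z with (c - a)%Z. change (d + - b)%Z with (d - b)%Z.
    rewrite !(even_swap _ a b c d) by assumption.
    generalize (Hr _ _ _ _ Hd) (Hr' _ _ _ _ Hd). rewrite A1, A2, A3.
    intros. repeat split; try assumption; lra.
  - intros a b c d Hd (A1 & A2 & A3).
    rewrite (Z.add_comm c a), (Z.add_comm d b). 
    generalize (Hr a b (a + c) (b + d) ltac:(lia))%Z (Hr' a b (a + c) (b + d) ltac:(lia))%Z.
    replace (a - (a + c))%Z with (- c)%Z by lia. replace (b - (b + d))%Z with (- d)%Z by lia.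
    rewrite (He c d), (He' c d) by (now apply (prim_r a b c d)).
    rewrite A1, A2, A3. intros. repeat split; try assumption; lra.
  - intros a b c d Hd (A1 & A2 & A3).
    replace (a + (c - a))%Z with c by lia. replace (b + (d - b))%Z with d by lia.
    rewrite !(even_swap _ a b c d) by assumption.
    generalize (Hr _ _ _ _ Hd) (Hr' _ _ _ _ Hd). rewrite A1, A2, A3.
    intros. repeat split; try assumption; lra.
Qed.

Lemma dtrace_unique f g g' : DTraceFn f g -> DTraceFn f g' ->
  g 1%Z 0%Z = g' 1%Z 0%Z -> g 0%Z 1%Z = g' 0%Z 1%Z -> g 1%Z 1%Z = g' 1%Z 1%Z ->
  forall p q, prim p q -> g p q = g' p q.
Proof.
  intros [He Hr] [He' Hr'] E1 E2 E3 p q Hp.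
  destruct (gcd_basis p q Hp) as [r [s Hd]].
  cut (g p q = g' p q /\ g r s = g' r s /\ g (p + r)%Z (q + s)%Z = g' (p + r)%Z (q + s)%Z); [tauto|].
  clear Hp. revert p q r s Hd.
  apply (basis_ind (fun p q r s => g p q = g' p q /\ g r s = g' r s /\
     g (p + r)%Z (q + s)%Z = g' (p + r)%Z (q + s)%Z)).
  - tauto.
  - intros a b c d Hd (A1 & A2 & A3).
    rewrite (He a b), (He' a b) by (now apply (prim_l a b c d)).
    change (c + - a)%Z with (c - a)%Z. change (d + - b)%Z with (d - b)%Z.
    rewrite !(even_swap _ a b c d) by assumption.
    generalize (Hr _ _ _ _ Hd) (Hr' _ _ _ _ Hd). rewrite A1, A2, A3.
    intros. repeat split; try assumption; lra.
  - intros a b c d Hd (A1 & A2 & A3).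
    rewrite (Z.add_comm c a), (Z.add_comm d b). 
    generalize (Hr a b (a + c) (b + d) ltac:(lia))%Z (Hr' a b (a + c) (b + d) ltac:(lia))%Z.
    replace (a - (a + c))%Z with (- c)%Z by lia. replace (b - (b + d))%Z with (- d)%Z by lia.
    rewrite (He c d), (He' c d) by (now apply (prim_r a b c d)).
    rewrite A1, A2, A3. intros. repeat split; try assumption; lra.
  - intros a b c d Hd (A1 & A2 & A3).
    replace (a + (c - a))%Z with c by lia. replace (b + (d - b))%Z with d by lia.
    rewrite !(even_swap _ a b c d) by assumption.
    generalize (Hr _ _ _ _ Hd) (Hr' _ _ _ _ Hd). rewrite A1, A2, A3.
    intros. repeat split; try assumption; lra.
Qed.

(** The other root w = xy - z of the quadratic equation in z is positive, since wz = x^2 + y^2. If w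
    <= 2, then x^2 + y^2 + w^2 = xyw <= 2xy, which is impossible. *)
Lemma flip_gt_2 x y z : 2 < x -> 2 < y -> 2 < z -> x * x + y * y + z * z = x * y * z ->
  2 < x * y - z.
Proof.
  intros Hx Hy Hz H.
  assert (E : (x * y - z) * z = x * x + y * y) by lra.
  assert (E2 : x * x + y * y + (x * y - z) * (x * y - z) = x * y * (x * y - z)) by lra.
  set (w := x * y - z) in *. clearbody w.
  assert (P : 0 < w) by nra.
  apply Rnot_le_lt. intros Hc.
  assert (x * y * w <= x * y * 2) by (apply Rmult_le_compat_l; nra).
  assert (0 < w * w) by nra. generalize (Rle_0_sqr (x - y)). unfold Rsqr. lra.
Qed.

Lemma markov_of_base f : TraceFn f -> Teich (f 1%Z 0%Z, f 0%Z 1%Z, f 1%Z 1%Z) -> Markov f.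
Proof.
  intros Hf (X1 & X2 & X3 & X4). pose proof Hf as [He Hr].
  assert (H : forall a b c d, (a * d - b * c = 1)%Z ->
    Teich (f a b, f c d, f (a + c)%Z (b + d)%Z)).
  { apply basis_ind.
    - now simpl.
    - intros a b c d Hd (A1 & A2 & A3 & A4).
      rewrite (He a b) by (now apply (prim_l a b c d)).
      change (c + - a)%Z with (c - a)%Z. change (d + - b)%Z with (d - b)%Z.
      rewrite !(even_swap _ a b c d) by assumption.
      replace (f (a - c)%Z (b - d)%Z) with (f a b * f c d - f (a + c)%Z (b + d)%Z)
        by (rewrite <- Hr by exact Hd; ring).
      split; [exact A2|]. split; [exact A1|]. split; [now apply flip_gt_2|]. lra.
    - intros a b c d Hd (A1 & A2 & A3 & A4).
      rewrite (Z.add_comm c a), (Z.add_comm d b). 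
      generalize (Hr a b (a + c) (b + d) ltac:(lia))%Z.
      replace (a - (a + c))%Z with (- c)%Z by lia. replace (b - (b + d))%Z with (- d)%Z by lia.
      rewrite (He c d) by (now apply (prim_r a b c d)). intros E.
      replace (f (a + (a + c))%Z (b + (b + d))%Z) with (f a b * f (a + c)%Z (b + d)%Z - f c d) by lra.
      split; [exact A1|]. split; [exact A3|]. split; [apply flip_gt_2; lra|]. lra.
    - intros a b c d Hd (A1 & A2 & A3 & A4).
      replace (a + (c - a))%Z with c by lia. replace (b + (d - b))%Z with d by lia.
      rewrite !(even_swap _ a b c d) by assumption.
      replace (f (a - c)%Z (b - d)%Z) with (f a b * f c d - f (a + c)%Z (b + d)%Z)
        by (rewrite <- Hr by exact Hd; ring).
      split; [exact A1|]. split; [now apply flip_gt_2|]. split; [exact A2|]. lra. }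
  split; [exact Hf|]. split.
  - intros p q Hp. destruct (gcd_basis p q Hp) as [r [s Hd]]. now destruct (H p q r s Hd).
  - intros a b c d Hd. now destruct (H a b c d Hd) as (_ & _ & _ & E).
Qed.

Lemma tan_of_base f g : TraceFn f -> DTraceFn f g ->
  Tangent (f 1%Z 0%Z, f 0%Z 1%Z, f 1%Z 1%Z) (g 1%Z 0%Z, g 0%Z 1%Z, g 1%Z 1%Z) -> Tan f g.
Proof.
  intros [He Hr] Hg HT. split; [exact Hg|]. destruct Hg as [Ge Gr].
  enough (H : forall a b c d, (a * d - b * c = 1)%Z ->
    Tangent (f a b, f c d, f (a + c)%Z (b + d)%Z) (g a b, g c d, g (a + c)%Z (b + d)%Z)) by exact H.
  apply basis_ind.
    - exact HT.
    - intros a b c d Hd A. unfold Tangent in *.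
      rewrite (He a b), (Ge a b) by (now apply (prim_l a b c d)).
      change (c + - a)%Z with (c - a)%Z. change (d + - b)%Z with (d - b)%Z.
      rewrite !(even_swap _ a b c d) by assumption.
      replace (f (a - c)%Z (b - d)%Z) with (f a b * f c d - f (a + c)%Z (b + d)%Z)
        by (rewrite <- Hr by exact Hd; ring).
      replace (g (a - c)%Z (b - d)%Z) with (g a b * f c d + f a b * g c d - g (a + c)%Z (b + d)%Z)
        by (rewrite <- Gr by exact Hd; ring).
      rewrite <- A. ring.
    - intros a b c d Hd A. unfold Tangent in *.
      rewrite (Z.add_comm c a), (Z.add_comm d b). 
      generalize (Hr a b (a + c) (b + d) ltac:(lia))%Z (Gr a b (a + c) (b + d) ltac:(lia))%Z.
      replace (a - (a + c))%Z with (- c)%Z by lia. replace (b - (b + d))%Z with (- d)%Z by lia.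
      rewrite (He c d), (Ge c d) by (now apply (prim_r a b c d)). intros E1 E2.
      replace (f (a + (a + c))%Z (b + (b + d))%Z) with (f a b * f (a + c)%Z (b + d)%Z - f c d) by lra.
      replace (g (a + (a + c))%Z (b + (b + d))%Z) with 
         (g a b * f (a + c)%Z (b + d)%Z + f a b * g (a + c)%Z (b + d)%Z - g c d) by lra.
      rewrite <- A. ring.
    - intros a b c d Hd A. unfold Tangent in *.
      replace (a + (c - a))%Z with c by lia. replace (b + (d - b))%Z with d by lia.
      rewrite !(even_swap _ a b c d) by assumption.
      replace (f (a - c)%Z (b - d)%Z) with (f a b * f c d - f (a + c)%Z (b + d)%Z)
        by (rewrite <- Hr by exact Hd; ring).
      replace (g (a - c)%Z (b - d)%Z) with (g a b * f c d + f a b * g c d - g (a + c)%Z (b + d)%Z)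
        by (rewrite <- Gr by exact Hd; ring).
      rewrite <- A. ring.
Qed.

(** * Change of basis *)

Definition unimod (a b c d : Z) : Prop := (a * d - b * c = 1 \/ a * d - b * c = -1)%Z.

Definition cob (a b c d : Z) (f : Z -> Z -> R) : Z -> Z -> R :=
  fun p q => f (a * p + b * q)%Z (c * p + d * q)%Z.

Lemma even_cob a b c d f : unimod a b c d -> EvenFn f -> EvenFn (cob a b c d f).
Proof.
  intros H He p q Hp. unfold cob.
  rewrite <- (He (a * p + b * q)%Z) by (now apply gcd_mat). f_equal; lia.
Qed.

Lemma trace_cob a b c d f : unimod a b c d -> TraceFn f -> TraceFn (cob a b c d f).
Proof.
  intros H [He Hr]. split; [now apply even_cob|]. intros p q r s E.
  assert (D : ((a * p + b * q) * (c * r + d * s) - (c * p + d * q) * (a * r + b * s)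
    = (a * d - b * c) * (p * s - q * r))%Z) by ring.
  rewrite E in D. unfold cob.
  replace (a * (p + r) + b * (q + s))%Z with ((a * p + b * q) + (a * r + b * s))%Z by ring.
  replace (c * (p + r) + d * (q + s))%Z with ((c * p + d * q) + (c * r + d * s))%Z by ring.
  replace (a * (p - r) + b * (q - s))%Z with ((a * p + b * q) - (a * r + b * s))%Z by ring.
  replace (c * (p - r) + d * (q - s))%Z with ((c * p + d * q) - (c * r + d * s))%Z by ring.
  destruct H as [H|H]; rewrite H in D.
  - now apply Hr.
  - rewrite Rmult_comm, <- Hr by lia. rewrite (Z.add_comm (a * r + b * s)), (Z.add_comm (c * r + d * s)).
    f_equal. apply even_swap; [exact He|lia].
Qed.

Lemma dtrace_cob a b c d f g : unimod a b c d -> DTraceFn f g ->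
  DTraceFn (cob a b c d f) (cob a b c d g).
Proof.
  intros H [He Hr]. split; [now apply even_cob|]. intros p q r s E.
  assert (D : ((a * p + b * q) * (c * r + d * s) - (c * p + d * q) * (a * r + b * s)
    = (a * d - b * c) * (p * s - q * r))%Z) by ring.
  rewrite E in D. unfold cob.
  replace (a * (p + r) + b * (q + s))%Z with ((a * p + b * q) + (a * r + b * s))%Z by ring.
  replace (c * (p + r) + d * (q + s))%Z with ((c * p + d * q) + (c * r + d * s))%Z by ring.
  replace (a * (p - r) + b * (q - s))%Z with ((a * p + b * q) - (a * r + b * s))%Z by ring.
  replace (c * (p - r) + d * (q - s))%Z with ((c * p + d * q) - (c * r + d * s))%Z by ring.
  destruct H as [H|H]; rewrite H in D.
  - now apply Hr.
  - transitivity (g (a * r + b * s)%Z (c * r + d * s)%Z * f (a * p + b * q)%Z (c * p + d * q)%Z +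
       f (a * r + b * s)%Z (c * r + d * s)%Z * g (a * p + b * q)%Z (c * p + d * q)%Z); [|ring].
    rewrite <- Hr by lia. rewrite (Z.add_comm (a * r + b * s)), (Z.add_comm (c * r + d * s)).
    f_equal. apply even_swap; [exact He|lia].
Qed.

Lemma markov_cob a b c d f : unimod a b c d -> Markov f -> Markov (cob a b c d f).
Proof.
  intros H (Ht & Hg & Hm). split; [now apply trace_cob|]. split.
  - intros p q Hp. apply Hg. now apply gcd_mat.
  - intros p q r s E. unfold cob.
    assert (D : ((a * p + b * q) * (c * r + d * s) - (c * p + d * q) * (a * r + b * s)
      = (a * d - b * c) * (p * s - q * r))%Z) by ring.
    rewrite E in D.
    replace (a * (p + r) + b * (q + s))%Z with ((a * p + b * q) + (a * r + b * s))%Z by ring.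
    replace (c * (p + r) + d * (q + s))%Z with ((c * p + d * q) + (c * r + d * s))%Z by ring.
    destruct H as [H|H]; rewrite H in D.
    + now apply Hm.
    + generalize (Hm (a * r + b * s) (c * r + d * s) (a * p + b * q) (c * p + d * q) ltac:(lia))%Z.
      rewrite (Z.add_comm (a * r + b * s)), (Z.add_comm (c * r + d * s)). lra.
Qed.

Lemma tan_cob a b c d f g : unimod a b c d -> Tan f g -> Tan (cob a b c d f) (cob a b c d g).
Proof.
  intros H (Ht & Hm). split; [now apply dtrace_cob|].
  - intros p q r s E. unfold cob.
    assert (D : ((a * p + b * q) * (c * r + d * s) - (c * p + d * q) * (a * r + b * s)
      = (a * d - b * c) * (p * s - q * r))%Z) by ring.
    rewrite E in D.
    replace (a * (p + r) + b * (q + s))%Z with ((a * p + b * q) + (a * r + b * s))%Z by ring.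
    replace (c * (p + r) + d * (q + s))%Z with ((c * p + d * q) + (c * r + d * s))%Z by ring.
    destruct H as [H|H]; rewrite H in D.
    + now apply Hm.
    + generalize (Hm (a * r + b * s) (c * r + d * s) (a * p + b * q) (c * p + d * q) ltac:(lia))%Z.
      rewrite (Z.add_comm (a * r + b * s)), (Z.add_comm (c * r + d * s)). cbv zeta. lra.
Qed.

(** The curve (a, b) is the first column, so precomposition with this matrix moves it to (1, 0). All
    facets are thereby reduced to that of (1, 0). *)
Lemma unimod_to a b : prim a b -> exists c d, unimod a c b d.
Proof.
  intros H. destruct (gcd_basis a b H) as [r [s E]]. exists r, s. left. lia.
Qed.

Lemma unimod_inv a b c d : unimod a b c d -> exists a' b' c' d', unimod a' b' c' d' /\
  (forall p q, a * (a' * p + b' * q) + b * (c' * p + d' * q) = p /\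
               c * (a' * p + b' * q) + d * (c' * p + d' * q) = q /\
               a' * (a * p + b * q) + b' * (c * p + d * q) = p /\
               c' * (a * p + b * q) + d' * (c * p + d * q) = q)%Z.
Proof.
  intros H. set (e := (a * d - b * c)%Z).
  assert (He : (e * e = 1)%Z) by (unfold unimod in H; unfold e; nia).
  exists (e * d)%Z, (- e * b)%Z, (- e * c)%Z, (e * a)%Z. split.
  - unfold unimod. replace (e * d * (e * a) - - e * b * (- e * c))%Z with (e * e * e)%Z by (unfold e; ring).
    rewrite He, Z.mul_1_l. exact H.
  - intros p q.
    assert (Ep : (e * e * p = p)%Z) by (rewrite He; ring). assert (Eq : (e * e * q = q)%Z) by (rewrite He; ring).
    repeat split; [rewrite <- Ep at 3|rewrite <- Eq at 3|rewrite <- Ep at 3|rewrite <- Eq at 3]; unfold e; ring.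
Qed.

(** * The trace function of a point and its differential *)

Definition T (X : point) (p q : Z) : R := mtr (word_matrix X p q).

Lemma fricke_t_inv z : 2 <= z -> 0 < fricke_t z /\ fricke_t z + / fricke_t z = z.
Proof.
  intros Hz. unfold fricke_t.
  assert (Hs : 0 <= sqrt (z * z - 4)) by apply sqrt_pos.
  assert (Hss : sqrt (z * z - 4) * sqrt (z * z - 4) = z * z - 4) by (apply sqrt_sqrt; nra).
  set (s := sqrt (z * z - 4)) in *. split; [lra|].
  replace (/ ((z + s) / 2)) with ((z - s) / 2); [lra|].
  symmetry.
  apply (Rmult_eq_reg_l ((z + s) / 2)); [|lra]. rewrite Rinv_r by lra. lra.
Qed.

Lemma T_trace_fn x y z : 2 <= z -> TraceFn (T (x, y, z)).
Proof.
  intros Hz. destruct (fricke_t_inv z Hz) as [Ht _].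
  apply (trace_fn_word (frickeA (x, y, z)) (frickeB (x, y, z))).
  - unfold mdet, frickeA; simpl; ring.
  - unfold mdet, frickeB; simpl. field. lra.
Qed.

Lemma T_10 x y z : T (x, y, z) 1 0 = x.
Proof. 
  change (mtr (word (frickeA (x, y, z)) (frickeB (x, y, z)) 1 0) = x).
  rewrite word_10. unfold mtr; simpl; ring.
Qed.

Lemma T_01 x y z : T (x, y, z) 0 1 = y.
Proof. 
  change (mtr (word (frickeA (x, y, z)) (frickeB (x, y, z)) 0 1) = y).
  rewrite word_01. unfold mtr; simpl; ring.
Qed.

Lemma T_11 x y z : 2 <= z -> T (x, y, z) 1 1 = z.
Proof.
  intros Hz. destruct (fricke_t_inv z Hz) as [Ht E].
  change (mtr (word (frickeA (x, y, z)) (frickeB (x, y, z)) (1 + 0) (0 + 1)) = z).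
  rewrite word_mul by lia. rewrite word_10, word_01. unfold mtr; simpl.
  rewrite <- E at 3. ring.
Qed.

Lemma T_markov X : Teich X -> Markov (T X).
Proof.
  destruct X as [[x y] z]. intros HX. pose proof HX as (Hx & Hy & Hz & _).
  apply markov_of_base; [apply T_trace_fn; lra|].
  rewrite T_10, T_01, T_11 by lra. exact HX.
Qed.

Definition dT (X v : point) (p q : Z) : R := Derive (fun h => T (padd X (pscal h v)) p q) 0.

Section Differential.

Variables x y z v1 v2 v3 : R.
Hypothesis Hz : 2 < z.

(** The line through the point in direction v leaves the surface of the Markov equation, so [F h] is
    in general only a trace function. Even this is claimed only for h near 0, because [fricke_t]
    needs a third coordinate of at least 2. *)
Let F h := T (padd (x, y, z) (pscal h (v1, v2, v3))).

Lemma F_near : locally 0 (fun h => 2 < z + h * v3).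
Proof.
  assert (C : continuous (fun h => z + h * v3) 0).
  { apply (ex_derive_continuous (fun h => z + h * v3)). auto_derive. exact I. }
  apply (C (fun w => 2 < w)). apply open_gt. simpl. lra.
Qed.

Lemma F_trace : locally 0 (fun h => TraceFn (F h)).
Proof.
  apply (filter_imp _ _ (fun h H => T_trace_fn (x + h * v1) (y + h * v2) (z + h * v3) (Rlt_le _ _ H))).
  exact F_near.
Qed.

Lemma F_10 : is_derive (fun h => F h 1%Z 0%Z) 0 v1.
Proof.
  apply (is_derive_ext (fun h => x + h * v1)).
  - intros h. unfold F. simpl padd. now rewrite T_10.
  - auto_derive; [exact I|ring].
Qed.

Lemma F_01 : is_derive (fun h => F h 0%Z 1%Z) 0 v2.
Proof.
  apply (is_derive_ext (fun h => y + h * v2)).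
  - intros h. unfold F. simpl padd. now rewrite T_01.
  - auto_derive; [exact I|ring].
Qed.

Lemma F_11 : is_derive (fun h => F h 1%Z 1%Z) 0 v3.
Proof.
  apply (is_derive_ext_loc (fun h => z + h * v3)).
  - apply (filter_imp (fun h => 2 < z + h * v3)); [|exact F_near].
    intros h H. unfold F. simpl padd. rewrite T_11; [reflexivity|lra].
  - auto_derive; [exact I|ring].
Qed.

(** The matrix entries contain a square root, but the recursion makes every trace a polynomial in
    the three base traces, which are affine in h near 0. *)
Lemma F_ex_derive p q : prim p q -> ex_derive (fun h => F h p q) 0.
Proof.
  intros Hp. destruct (gcd_basis p q Hp) as [r [s Hd]].
  cut (ex_derive (fun h => F h p q) 0 /\ ex_derive (fun h => F h r s) 0 /\
       ex_derive (fun h => F h (p + r)%Z (q + s)%Z) 0); [tauto|].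
  clear Hp. revert p q r s Hd.
  assert (Even : forall p q, prim p q -> ex_derive (fun h => F h p q) 0 ->
     ex_derive (fun h => F h (-p)%Z (-q)%Z) 0).
  { intros p q Hp. apply ex_derive_ext_loc.
    apply (filter_imp (fun h => TraceFn (F h))); [|exact F_trace].
    intros h [He _]. exact (eq_sym (He p q Hp)). }
  assert (Diff : forall a b c d, (a * d - b * c = 1)%Z ->
     ex_derive (fun h => F h a b) 0 -> ex_derive (fun h => F h c d) 0 ->
     ex_derive (fun h => F h (a - c)%Z (b - d)%Z) 0 -> ex_derive (fun h => F h (a + c)%Z (b + d)%Z) 0).
  { intros a b c d Hd H1 H2 H3.
    apply (ex_derive_ext_loc (fun h => F h a b * F h c d - F h (a - c)%Z (b - d)%Z)).
    - apply (filter_imp (fun h => TraceFn (F h))); [|exact F_trace].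
      intros h [_ Hr]. specialize (Hr _ _ _ _ Hd). match goal with |- ?l = ?r => enough (l - r = 0) by lra end. lra.
    - apply (ex_derive_minus (fun h => F h a b * F h c d)); [|exact H3].
      now apply (ex_derive_mult (fun h => F h a b)). }
  assert (Sum : forall a b c d, (a * d - b * c = 1)%Z ->
     ex_derive (fun h => F h a b) 0 -> ex_derive (fun h => F h c d) 0 ->
     ex_derive (fun h => F h (a + c)%Z (b + d)%Z) 0 -> ex_derive (fun h => F h (c - a)%Z (d - b)%Z) 0).
  { intros a b c d Hd H1 H2 H3.
    apply (ex_derive_ext_loc (fun h => F h a b * F h c d - F h (a + c)%Z (b + d)%Z)).
    - apply (filter_imp (fun h => TraceFn (F h))); [|exact F_trace].
      intros h [He Hr]. specialize (Hr _ _ _ _ Hd). rewrite (even_swap _ a b c d) by assumption.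
      match goal with |- ?l = ?r => enough (l - r = 0) by lra end. lra.
    - apply (ex_derive_minus (fun h => F h a b * F h c d)); [|exact H3].
      now apply (ex_derive_mult (fun h => F h a b)). }
  apply basis_ind.
  - split; [eexists; apply F_10|]. split; [eexists; apply F_01|]. eexists; apply F_11.
  - intros a b c d Hd (A1 & A2 & A3). split; [exact A2|]. split.
    + apply Even; [now apply (prim_l a b c d)|exact A1].
    + now apply Sum.
  - intros a b c d Hd (A1 & A2 & A3). rewrite (Z.add_comm c a), (Z.add_comm d b).
    split; [exact A1|]. split; [exact A3|]. apply Diff; try assumption; [lia|].
    replace (a - (a + c))%Z with (- c)%Z by lia. replace (b - (b + d))%Z with (- d)%Z by lia.
    apply Even; [now apply (prim_r a b c d)|exact A2].
  - intros a b c d Hd (A1 & A2 & A3).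
    split; [exact A1|]. split; [now apply Sum|].
    replace (a + (c - a))%Z with c by lia. replace (b + (d - b))%Z with d by lia. exact A2.
Qed.

Lemma F_0 : F 0 = T (x, y, z).
Proof. unfold F. simpl. now rewrite !Rmult_0_l, !Rplus_0_r. Qed.

Lemma dT_dtrace : DTraceFn (T (x, y, z)) (dT (x, y, z) (v1, v2, v3)).
Proof.
  rewrite <- F_0. unfold dT. fold F. split.
  - intros p q Hp. apply Derive_ext_loc.
    apply (filter_imp (fun h => TraceFn (F h))); [|exact F_trace].
    intros h [He _]. now apply He.
  - intros a b c d Hd.
    assert (D1 : ex_derive (fun h => F h a b) 0) by (apply F_ex_derive; now apply (prim_l a b c d)).
    assert (D2 : ex_derive (fun h => F h c d) 0) by (apply F_ex_derive; now apply (prim_r a b c d)).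
    assert (D3 : ex_derive (fun h => F h (a + c)%Z (b + d)%Z) 0) by (apply F_ex_derive; now apply (prim_add a b c d)).
    assert (D4 : ex_derive (fun h => F h (a - c)%Z (b - d)%Z) 0) by (apply F_ex_derive; now apply (prim_sub a b c d)).
    transitivity (Derive (fun h => F h (a + c)%Z (b + d)%Z + F h (a - c)%Z (b - d)%Z) 0).
    + symmetry. now apply Derive_plus.
    + transitivity (Derive (fun h => F h a b * F h c d) 0).
      * apply Derive_ext_loc. apply (filter_imp (fun h => TraceFn (F h))); [|exact F_trace].
        intros h [_ Hr]. now apply Hr.
      * now apply Derive_mult.
Qed.

End Differential.

Lemma dT_10 x y z v1 v2 v3 : dT (x, y, z) (v1, v2, v3) 1 0 = v1.
Proof. apply is_derive_unique. apply F_10. Qed.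
Lemma dT_01 x y z v1 v2 v3 : dT (x, y, z) (v1, v2, v3) 0 1 = v2.
Proof. apply is_derive_unique. apply F_01. Qed.
Lemma dT_11 x y z v1 v2 v3 : 2 < z -> dT (x, y, z) (v1, v2, v3) 1 1 = v3.
Proof. intros Hz. apply is_derive_unique. now apply F_11. Qed.

Lemma dT_tan X v : Teich X -> Tangent X v -> Tan (T X) (dT X v).
Proof.
  intros HX Hv. destruct (T_markov X HX) as (HT & _ & _).
  destruct X as [[x y] z]. destruct v as [[v1 v2] v3]. destruct HX as (Hx & Hy & Hz & _).
  apply tan_of_base; [exact HT|now apply dT_dtrace|].
  rewrite T_10, T_01, T_11, dT_10, dT_01, dT_11 by lra. exact Hv.
Qed.

(** * Lengths *)

(* With f the trace function, hl is half the hyperbolic length and dhl its derivative along g. *)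
Definition hl (f : Z -> Z -> R) (p q : Z) : R := Racosh (f p q / 2).
Definition dhl (f g : Z -> Z -> R) (p q : Z) : R := g p q / sqrt (f p q * f p q - 4).

Lemma hlength_hl X p q : Teich X -> prim p q -> hlength X p q = 2 * hl (T X) p q.
Proof.
  intros HX Hp. destruct (T_markov X HX) as (_ & H2 & _). specialize (H2 p q Hp).
  unfold hlength, hl. fold (T X p q). rewrite Rabs_right by lra. reflexivity.
Qed.

Lemma Racosh_derive u : 1 < u -> is_derive Racosh u (/ sqrt (u * u - 1)).
Proof.
  intros Hu. unfold Racosh.
  assert (Hs : 0 < sqrt (u * u - 1)) by (apply sqrt_lt_R0; nra).
  auto_derive; replace (u * u + - (1)) with (u * u - 1) by ring.
  - repeat split; [nra|lra].
  - set (s := sqrt (u * u - 1)) in *. field. lra.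
Qed.

Lemma dlength_dhl X v p q : Teich X -> Tangent X v -> prim p q ->
  dlength X p q v = 2 * dhl (T X) (dT X v) p q.
Proof.
  intros HX Hv Hp. destruct (T_markov X HX) as (_ & H2 & _). specialize (H2 p q Hp).
  destruct X as [[x y] z]. destruct v as [[v1 v2] v3]. destruct HX as (Hx & Hy & Hz & _).
  assert (D : ex_derive (fun h => T (padd (x, y, z) (pscal h (v1, v2, v3))) p q) 0) by (now apply F_ex_derive).
  unfold dlength. apply is_derive_unique.
  apply (is_derive_ext_loc (fun h => 2 * Racosh (T (padd (x, y, z) (pscal h (v1, v2, v3))) p q / 2))).
  - assert (C : locally 0 (fun h => 2 < T (padd (x, y, z) (pscal h (v1, v2, v3))) p q)).
    { apply (ex_derive_continuous _ _ D (fun w => 2 < w)). apply open_gt.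
      rewrite (F_0 x y z v1 v2 v3). exact H2. }
    apply (filter_imp (fun h => 2 < T (padd (x, y, z) (pscal h (v1, v2, v3))) p q)); [|exact C].
    intros h Hh. unfold hlength. fold (T (padd (x, y, z) (pscal h (v1, v2, v3))) p q).
    rewrite Rabs_right by lra. reflexivity.
  - apply Derive_correct in D. fold (dT (x, y, z) (v1, v2, v3) p q) in D.
    set (F := fun h => T (padd (x, y, z) (pscal h (v1, v2, v3))) p q) in *.
    assert (E0 : F 0 = T (x, y, z) p q) by (unfold F; now rewrite F_0).
    change (T (padd (x, y, z) (pscal ?h (v1, v2, v3))) p q) with (F h).
    set (t := dT (x, y, z) (v1, v2, v3) p q) in *.
    unfold dhl. fold t. set (w := T (x, y, z) p q) in *.
    assert (D1 : is_derive (fun h => F h / 2) 0 (t / 2)).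
    { apply (is_derive_ext (fun h => /2 * F h)); [intros; simpl; unfold Rdiv; ring|].
      replace (t / 2) with (/2 * t) by (unfold Rdiv; ring). now apply is_derive_scal. }
    assert (D2 := is_derive_comp Racosh (fun h => F h / 2) 0 _ _
      (Racosh_derive (F 0 / 2) ltac:(rewrite E0; lra)) D1).
    apply (is_derive_scal _ _ 2) in D2.
    match goal with |- is_derive _ _ ?r => match type of D2 with is_derive _ _ ?r' => replace r with r' end end; [exact D2|].
    unfold scal; simpl; unfold mult; simpl. rewrite E0.
    replace (w * w - 4) with (2 * 2 * (w / 2 * (w / 2) - 1)) by field.
    rewrite sqrt_mult by nra. rewrite sqrt_square by lra. 
    assert (0 < sqrt (w / 2 * (w / 2) - 1)) by (apply sqrt_lt_R0; nra).
    field. lra.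
Qed.

(** The norm of g is at most K. After [ThNorm_le] and the transfer to relations between families,
    the norm enters only through these sublevel sets. *)
Definition Bnd (f g : Z -> Z -> R) (K : R) : Prop :=
  forall p q, prim p q -> dhl f g p q <= K * hl f p q.

Lemma Racosh_pos u : 1 < u -> 0 < Racosh u.
Proof.
  intros H. unfold Racosh. rewrite <- ln_1. apply ln_increasing; [lra|].
  generalize (sqrt_pos (u * u - 1)). lra.
Qed.

Lemma hl_pos f p q : Markov f -> prim p q -> 0 < hl f p q.
Proof.
  intros (_ & H & _) Hp. apply Racosh_pos. specialize (H p q Hp). lra.
Qed.

Lemma ThNorm_le X v (K : R) : Teich X -> Tangent X v ->
  (Rbar_le (ThNorm X v) (Finite K) <-> Bnd (T X) (dT X v) K).
Proof.
  intros HX Hv. unfold ThNorm.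
  match goal with |- context [Lub_Rbar ?S] => set (E := S) end.
  destruct (Lub_Rbar_correct E) as [Hub Hlub].
  assert (R : forall p q, prim p q -> dlength X p q v / hlength X p q =
     dhl (T X) (dT X v) p q / hl (T X) p q).
  { intros p q Hp. rewrite dlength_dhl, hlength_hl by assumption.
    generalize (hl_pos _ p q (T_markov X HX) Hp). intros. field. lra. }
  split.
  - intros H p q Hp. assert (Hh := hl_pos _ p q (T_markov X HX) Hp).
    assert (H0 : Rbar_le (Finite (dhl (T X) (dT X v) p q / hl (T X) p q)) (Finite K)).
    { eapply Rbar_le_trans; [|exact H]. apply Hub. exists p, q. split; [exact Hp|]. now rewrite R. }
    simpl in H0. apply (Rmult_le_compat_r (hl (T X) p q)) in H0; [|lra].
    unfold Rdiv in H0. rewrite Rmult_assoc, Rinv_l in H0; lra.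
  - intros H. apply Hlub. intros r (p & q & Hp & ->). simpl. rewrite R by exact Hp.
    assert (Hh := hl_pos _ p q (T_markov X HX) Hp).
    apply (Rmult_le_reg_r (hl (T X) p q)); [exact Hh|].
    unfold Rdiv. rewrite Rmult_assoc, Rinv_l by lra. rewrite Rmult_1_r. now apply H.
Qed.

(** * Linear structure of tangent families and their base values *)

Definition eqp (f f' : Z -> Z -> R) : Prop := forall p q, prim p q -> f p q = f' p q.

Definition lc (a b : R) (g1 g2 : Z -> Z -> R) : Z -> Z -> R := fun p q => a * g1 p q + b * g2 p q.

Lemma prim_10 : prim 1 0. Proof. reflexivity. Qed.
Lemma prim_01 : prim 0 1. Proof. reflexivity. Qed.
Lemma prim_11 : prim 1 1. Proof. reflexivity. Qed.

Lemma prim_opp p q : prim p q -> prim (- p) (- q).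
Proof. apply gcd_opp. Qed.

Lemma dtrace_eqp f f' g g' : eqp f f' -> eqp g g' -> DTraceFn f g -> DTraceFn f' g'.
Proof.
  intros Ef Eg [He Hr]. split.
  - intros p q Hp. rewrite <- !Eg by (try apply prim_opp; assumption). now apply He.
  - intros a b c d Hd.
    pose proof (prim_l _ _ _ _ Hd). pose proof (prim_r _ _ _ _ Hd).
    pose proof (prim_add _ _ _ _ Hd). pose proof (prim_sub _ _ _ _ Hd).
    rewrite <- !Ef, <- !Eg by assumption. now apply Hr.
Qed.

Lemma tan_eqp f f' g g' : eqp f f' -> eqp g g' -> Tan f g -> Tan f' g'.
Proof.
  intros Ef Eg [Hd Ht]. split; [now apply (dtrace_eqp f f' g g')|].
  intros a b c d H. pose proof (prim_l _ _ _ _ H). pose proof (prim_r _ _ _ _ H).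
  pose proof (prim_add _ _ _ _ H). cbv zeta. rewrite <- !Ef, <- !Eg by assumption. now apply Ht.
Qed.

Lemma dtrace_lc f g1 g2 a b : DTraceFn f g1 -> DTraceFn f g2 -> DTraceFn f (lc a b g1 g2).
Proof.
  intros [E1 R1] [E2 R2]. unfold lc. split.
  - intros p q Hp. now rewrite E1, E2.
  - intros p q r s H. specialize (R1 _ _ _ _ H). specialize (R2 _ _ _ _ H). 
    transitivity (a * (g1 (p + r)%Z (q + s)%Z + g1 (p - r)%Z (q - s)%Z) +
                  b * (g2 (p + r)%Z (q + s)%Z + g2 (p - r)%Z (q - s)%Z)); [ring|].
    rewrite R1, R2. ring.
Qed.

Lemma tan_lc f g1 g2 a b : Tan f g1 -> Tan f g2 -> Tan f (lc a b g1 g2).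
Proof.
  intros [D1 T1] [D2 T2]. split; [now apply dtrace_lc|].
  intros p q r s H. specialize (T1 _ _ _ _ H). specialize (T2 _ _ _ _ H). cbv zeta in *. unfold lc.
  match type of T1 with ?l = 0 => match type of T2 with ?l' = 0 =>
    transitivity (a * l + b * l'); [ring|]; rewrite T1, T2; ring end end.
Qed.

Lemma dhl_lc f g1 g2 a b p q : dhl f (lc a b g1 g2) p q = a * dhl f g1 p q + b * dhl f g2 p q.
Proof. unfold dhl, lc, Rdiv. ring. Qed.

Lemma dhl_eqp f g g' p q : eqp g g' -> prim p q -> dhl f g p q = dhl f g' p q.
Proof. intros E Hp. unfold dhl. now rewrite E. Qed.

Lemma bnd_eqp f g g' K : eqp g g' -> Bnd f g K -> Bnd f g' K.
Proof.
  intros E H p q Hp. rewrite <- (dhl_eqp f g g') by assumption. now apply H.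
Qed.

Lemma markov_T f : Markov f ->
  Teich (f 1%Z 0%Z, f 0%Z 1%Z, f 1%Z 1%Z) /\ eqp f (T (f 1%Z 0%Z, f 0%Z 1%Z, f 1%Z 1%Z)).
Proof.
  intros (Ht & H2 & HF). 
  pose proof (H2 _ _ prim_10) as Hx. pose proof (H2 _ _ prim_01) as Hy. pose proof (H2 _ _ prim_11) as Hz.
  split.
  - repeat split; try assumption. exact (HF 1 0 0 1 eq_refl)%Z.
  - intros p q. apply trace_unique; [exact Ht|apply T_trace_fn; lra| | |].
    + now rewrite T_10.
    + now rewrite T_01.
    + now rewrite T_11 by lra.
Qed.

Lemma tan_extend f g1 g2 g3 : Markov f -> 
  Tangent (f 1%Z 0%Z, f 0%Z 1%Z, f 1%Z 1%Z) (g1, g2, g3) ->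
  exists g, Tan f g /\ g 1%Z 0%Z = g1 /\ g 0%Z 1%Z = g2 /\ g 1%Z 1%Z = g3.
Proof.
  intros Hf Ht. destruct (markov_T f Hf) as [HX E].
  exists (dT (f 1%Z 0%Z, f 0%Z 1%Z, f 1%Z 1%Z) (g1, g2, g3)).
  split; [|rewrite dT_10, dT_01, dT_11; [tauto|apply HX]].
  apply (tan_eqp (T (f 1%Z 0%Z, f 0%Z 1%Z, f 1%Z 1%Z)) _ (dT (f 1%Z 0%Z, f 0%Z 1%Z, f 1%Z 1%Z) (g1, g2, g3))).
  - intros p q Hp. symmetry. now apply E.
  - intros p q _. reflexivity.
  - now apply dT_tan.
Qed.

Lemma tan_base f g : Tan f g ->
  Tangent (f 1%Z 0%Z, f 0%Z 1%Z, f 1%Z 1%Z) (g 1%Z 0%Z, g 0%Z 1%Z, g 1%Z 1%Z).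
Proof. intros [_ H]. exact (H 1 0 0 1 eq_refl)%Z. Qed.

Lemma T_base X : Teich X -> (T X 1%Z 0%Z, T X 0%Z 1%Z, T X 1%Z 1%Z) = X.
Proof.
  destruct X as [[x y] z]. intros (_ & _ & Hz & _). now rewrite T_10, T_01, T_11 by lra.
Qed.

Lemma dT_base X v : Teich X -> (dT X v 1%Z 0%Z, dT X v 0%Z 1%Z, dT X v 1%Z 1%Z) = v.
Proof.
  destruct X as [[x y] z]. destruct v as [[v1 v2] v3].
  intros (_ & _ & Hz & _). now rewrite dT_10, dT_01, dT_11 by lra.
Qed.

Lemma dT_of_base X g : Teich X -> Tan (T X) g ->
  Tangent X (g 1%Z 0%Z, g 0%Z 1%Z, g 1%Z 1%Z) /\
  eqp (dT X (g 1%Z 0%Z, g 0%Z 1%Z, g 1%Z 1%Z)) g.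
Proof.
  intros HX Hg. assert (Ht := tan_base _ _ Hg). rewrite T_base in Ht by exact HX.
  split; [exact Ht|].
  assert (Eb := dT_base X (g 1%Z 0%Z, g 0%Z 1%Z, g 1%Z 1%Z) HX). injection Eb as E1 E2 E3.
  intros p q. apply (dtrace_unique (T X)); try assumption.
  - apply dT_tan; assumption.
  - apply Hg.
Qed.

Lemma tangent_lin X u v a b : Tangent X u -> Tangent X v -> Tangent X (padd (pscal a u) (pscal b v)).
Proof.
  destruct X as [[x y] z]. destruct u as [[u1 u2] u3]. destruct v as [[v1 v2] v3]. simpl.
  intros H1 H2. match type of H1 with ?l = 0 => match type of H2 with ?l' = 0 =>
    transitivity (a * l + b * l'); [ring|]; rewrite H1, H2; ring end end.
Qed.

Lemma dT_lin X u v a b : Teich X -> Tangent X u -> Tangent X v ->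
  eqp (dT X (padd (pscal a u) (pscal b v))) (lc a b (dT X u) (dT X v)).
Proof.
  intros HX Hu Hv. intros p q.
  destruct (dT_tan X _ HX (tangent_lin X u v a b Hu Hv)) as [D _].
  destruct (dT_tan X _ HX Hu) as [D1 _]. destruct (dT_tan X _ HX Hv) as [D2 _].
  pose proof (dT_base X u HX) as Eu. pose proof (dT_base X v HX) as Ev.
  pose proof (dT_base X (padd (pscal a u) (pscal b v)) HX) as E.
  destruct u as [[u1 u2] u3]. destruct v as [[v1 v2] v3].
  injection Eu as U1 U2 U3. injection Ev as V1 V2 V3. simpl in E. injection E as E1 E2 E3.
  apply (dtrace_unique (T X)); [exact D|now apply dtrace_lc| | |]; unfold lc; simpl; congruence.
Qed.

(** * Points of one orbit have isometric tangent spaces *)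

Lemma Racosh_inj u v : 1 < u -> 1 < v -> Racosh u = Racosh v -> u = v.
Proof.
  intros Hu Hv E.
  assert (M : forall a b, 1 < a -> a < b -> Racosh a < Racosh b).
  { intros a b Ha Hab. unfold Racosh. apply ln_increasing.
    - generalize (sqrt_pos (a * a - 1)). lra.
    - apply Rplus_lt_compat; [exact Hab|]. apply sqrt_lt_1; nra. }
  destruct (Rtotal_order u v) as [H|[H|H]]; [|exact H|].
  - generalize (M u v Hu H). lra.
  - generalize (M v u Hv H). lra.
Qed.

Lemma orbit_iff X Y : Teich X -> Teich Y ->
  (same_emcg_orbit X Y <-> exists a b c d, unimod a b c d /\ eqp (T Y) (cob a b c d (T X))).
Proof.
  intros HX HY. split; intros (a & b & c & d & Hu & H); exists a, b, c, d; (split; [exact Hu|]).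
  - intros p q Hp. specialize (H p q Hp).
    assert (Hq : prim (a * p + b * q) (c * p + d * q)) by now apply gcd_mat.
    rewrite !hlength_hl in H by assumption. unfold hl in H. unfold cob.
    destruct (T_markov X HX) as (_ & GX & _). destruct (T_markov Y HY) as (_ & GY & _).
    specialize (GX _ _ Hq). specialize (GY _ _ Hp).
    assert (E : T Y p q / 2 = T X (a * p + b * q)%Z (c * p + d * q)%Z / 2) by (apply Racosh_inj; lra).
    lra.
  - intros p q Hp. assert (Hq : prim (a * p + b * q) (c * p + d * q)) by now apply gcd_mat.
    rewrite !hlength_hl by assumption. unfold hl. rewrite (H p q Hp). reflexivity.
Qed.

Lemma isometry_of_orbit X Y : Teich X -> Teich Y -> same_emcg_orbit X Y ->
  exists L, ThIsometricIso X Y L.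
Proof.
  intros HX HY HO. apply orbit_iff in HO; [|assumption|assumption].
  destruct HO as (a & b & c & d & Hu & HE).
  set (base := fun g : Z -> Z -> R => (g 1%Z 0%Z, g 0%Z 1%Z, g 1%Z 1%Z)).
  exists (fun v => base (cob a b c d (dT X v))).
  assert (Hcob : forall v, Tangent X v -> Tan (T Y) (cob a b c d (dT X v))).
  { intros v Hv. apply (tan_eqp (cob a b c d (T X)) _ (cob a b c d (dT X v))).
    - intros p q Hp. symmetry. now apply HE.
    - intros p q _. reflexivity.
    - apply tan_cob; [exact Hu|]. now apply dT_tan. }
  assert (HL : forall v, Tangent X v -> eqp (dT Y (base (cob a b c d (dT X v)))) (cob a b c d (dT X v))).
  { intros v Hv. apply (dT_of_base Y _ HY (Hcob v Hv)). }
  destruct (unimod_inv a b c d Hu) as (a' & b' & c' & d' & Hu' & HM).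
  assert (Hback : forall (g : Z -> Z -> R) p q, cob a' b' c' d' (cob a b c d g) p q = g p q).
  { intros g p q. unfold cob. destruct (HM p q) as (E1 & E2 & _). now rewrite E1, E2. }
  assert (Hforth : forall (g : Z -> Z -> R) p q, cob a b c d (cob a' b' c' d' g) p q = g p q).
  { intros g p q. unfold cob. destruct (HM p q) as (_ & _ & E1 & E2). now rewrite E1, E2. }
  repeat split.
  - intros u v r s Hu1 Hv1.
    pose proof (dT_lin X u v r s HX Hu1 Hv1) as E. unfold base, cob.
    rewrite !E by (apply gcd_mat; [exact Hu|reflexivity]). reflexivity.
  - intros v Hv. apply (dT_of_base Y _ HY (Hcob v Hv)).
  - intros u v Hu1 Hv1 E. rewrite <- (dT_base X u HX), <- (dT_base X v HX).
    assert (Euv : eqp (dT X u) (dT X v)).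
    { intros p q Hp. rewrite <- (Hback (dT X u)), <- (Hback (dT X v)).
      unfold cob at 1 3. rewrite <- !HL by (assumption || now apply gcd_mat). now rewrite E. }
    now rewrite !Euv by reflexivity.
  - intros w Hw. pose proof (dT_tan Y w HY Hw) as Hg.
    assert (Tg : Tan (T X) (cob a' b' c' d' (dT Y w))).
    { apply (tan_eqp (cob a' b' c' d' (T Y)) _ (cob a' b' c' d' (dT Y w))).
      - intros p q Hp. rewrite <- (Hback (T X)). unfold cob at 1 2.
        apply HE. now apply gcd_mat.
      - intros p q _. reflexivity.
      - now apply tan_cob. }
    destruct (dT_of_base X _ HX Tg) as [Tb Eb].
    eexists. split; [exact Tb|].
    assert (Ec : eqp (cob a b c d (dT X (base (cob a' b' c' d' (dT Y w))))) (dT Y w)).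
    { intros p q Hp. rewrite <- (Hforth (dT Y w) p q).
      exact (Eb _ _ (gcd_mat _ _ _ _ _ _ Hu Hp)). }
    transitivity (base (dT Y w)); [|now apply dT_base].
    unfold base at 1. now rewrite !Ec by reflexivity.
  - intros v Hv. unfold ThNorm. apply Lub_Rbar_eqset. intros r.
    assert (Hv' : Tangent Y (base (cob a b c d (dT X v)))) by apply (dT_of_base Y _ HY (Hcob v Hv)).
    split; intros (p & q & Hp & ->).
    + exists (a * p + b * q)%Z, (c * p + d * q)%Z. split; [now apply gcd_mat|].
      rewrite !dlength_dhl, !hlength_hl by (assumption || now apply gcd_mat).
      unfold dhl, hl. rewrite HL, HE by assumption. reflexivity.
    + exists (a' * p + b' * q)%Z, (c' * p + d' * q)%Z. split; [now apply gcd_mat|].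
      rewrite !dlength_dhl, !hlength_hl by (assumption || now apply gcd_mat).
      unfold dhl, hl. rewrite HL, HE by (assumption || now apply gcd_mat).
      unfold cob. destruct (HM p q) as (E1 & E2 & _). now rewrite E1, E2.
Qed.

(** * Isometries as relations between tangent families *)

(** A relation instead of a map, because a family is meaningful only on primitive classes; the
    fourth clause makes it single valued and injective modulo [eqp]. Surjectivity is expressed by
    asking the same of the transposed relation. *)
Definition IsoRel (f f' : Z -> Z -> R) (Rl : (Z -> Z -> R) -> (Z -> Z -> R) -> Prop) : Prop :=
  (forall g g', Rl g g' -> Tan f g /\ Tan f' g') /\
  (forall g, Tan f g -> exists g', Rl g g') /\
  (forall g1 g1' g2 g2' a b, Rl g1 g1' -> Rl g2 g2' -> Rl (lc a b g1 g2) (lc a b g1' g2')) /\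
  (forall g g' h h', Rl g g' -> Rl h h' -> (eqp g h <-> eqp g' h')) /\
  (forall g g' K, Rl g g' -> (Bnd f g K <-> Bnd f' g' K)).

Lemma isorel_of_isometry X Y L : Teich X -> Teich Y -> ThIsometricIso X Y L ->
  exists Rl, IsoRel (T X) (T Y) Rl /\ IsoRel (T Y) (T X) (fun g' g => Rl g g').
Proof.
  intros HX HY (Hlin & HTan & Hinj & Hsurj & Hnorm).
  set (Rl := fun g g' => exists u, Tangent X u /\ eqp (dT X u) g /\ eqp (dT Y (L u)) g').
  assert (ET : forall Z u g, Teich Z -> Tangent Z u -> eqp (dT Z u) g -> Tan (T Z) g).
  { intros Z u g HZ Hu E. apply (tan_eqp (T Z) _ (dT Z u)); [intros p q _; reflexivity|exact E|].
    now apply dT_tan. }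
  assert (E1 : forall g g', Rl g g' -> Tan (T X) g /\ Tan (T Y) g').
  { intros g g' (u & Hu & A & B). split; eapply ET; eauto. }
  assert (E2 : forall g, Tan (T X) g -> exists g', Rl g g').
  { intros g Hg. destruct (dT_of_base X g HX Hg) as [Ht Eg].
    eexists. eexists. split; [exact Ht|]. split; [exact Eg|]. intros p q _; reflexivity. }
  assert (E3 : forall g, Tan (T Y) g -> exists g', Rl g' g).
  { intros g Hg. destruct (dT_of_base Y g HY Hg) as [Ht Eg].
    destruct (Hsurj _ Ht) as (u & Hu & Eu).
    exists (dT X u), u. split; [exact Hu|]. split; [intros p q _; reflexivity|]. now rewrite Eu. }
  assert (E4 : forall g1 g1' g2 g2' a b, Rl g1 g1' -> Rl g2 g2' -> Rl (lc a b g1 g2) (lc a b g1' g2')).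
  { intros g1 g1' g2 g2' a b (u1 & Hu1 & A1 & B1) (u2 & Hu2 & A2 & B2).
    exists (padd (pscal a u1) (pscal b u2)). split; [now apply tangent_lin|]. split.
    - intros p q Hp. rewrite dT_lin by assumption. unfold lc. now rewrite A1, A2.
    - intros p q Hp. rewrite Hlin by assumption. rewrite dT_lin by (try apply HTan; assumption).
      unfold lc. now rewrite B1, B2. }
  assert (Einj : forall Z u v, Teich Z -> eqp (dT Z u) (dT Z v) -> u = v).
  { intros Z u v HZ E. rewrite <- (dT_base Z u HZ), <- (dT_base Z v HZ).
    now rewrite !E by reflexivity. }
  assert (E5 : forall g g' h h', Rl g g' -> Rl h h' -> (eqp g h <-> eqp g' h')).
  { intros g g' h h' (u & Hu & A1 & B1) (v & Hv & A2 & B2). split; intros E.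
    - assert (Euv : u = v).
      { apply (Einj X); [exact HX|]. intros p q Hp. rewrite A1, A2 by exact Hp. now apply E. }
      subst v. intros p q Hp. now rewrite <- B1, <- B2.
    - assert (Euv : L u = L v).
      { apply (Einj Y); [exact HY|]. intros p q Hp. rewrite B1, B2 by exact Hp. now apply E. }
      apply Hinj in Euv; try assumption. subst v.
      intros p q Hp. now rewrite <- A1, <- A2. }
  assert (E6 : forall g g' K, Rl g g' -> (Bnd (T X) g K <-> Bnd (T Y) g' K)).
  { intros g g' K (u & Hu & A & B).
    assert (A' : eqp g (dT X u)) by (intros p q Hp; symmetry; now apply A).
    assert (B' : eqp g' (dT Y (L u))) by (intros p q Hp; symmetry; now apply B).
    pose proof (ThNorm_le X u K HX Hu) as N1. pose proof (ThNorm_le Y (L u) K HY (HTan u Hu)) as N2.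
    rewrite (Hnorm u Hu) in N2. split; intros H.
    - apply (bnd_eqp _ (dT Y (L u))); [exact B|]. apply N2, N1. now apply (bnd_eqp _ g).
    - apply (bnd_eqp _ (dT X u)); [exact A|]. apply N1, N2. now apply (bnd_eqp _ g'). }
  exists Rl. split; (split; [|split; [|split; [|split]]]).
  - exact E1.
  - exact E2.
  - exact E4.
  - exact E5.
  - exact E6.
  - intros g g' H. apply and_comm. now apply E1.
  - exact E3.
  - intros g1 g1' g2 g2' a b H1 H2. now apply E4.
  - intros g g' h h' H1 H2. apply iff_sym. now apply E5.
  - intros g g' K H. apply iff_sym. now apply E6.
Qed.

(** * Hyperbolic functions *)

Lemma exp_neg x : exp x * exp (- x) = 1.
Proof. rewrite <- exp_plus. replace (x + - x) with 0 by ring. apply exp_0. Qed.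

Lemma cosh_sinh_sq x : cosh x * cosh x = 1 + sinh x * sinh x.
Proof. unfold cosh, sinh. generalize (exp_neg x). lra. Qed.

Lemma cosh_plus x y : cosh (x + y) = cosh x * cosh y + sinh x * sinh y.
Proof.
  unfold cosh, sinh. rewrite Ropp_plus_distr, !exp_plus. field.
Qed.

Lemma sinh_plus x y : sinh (x + y) = sinh x * cosh y + cosh x * sinh y.
Proof.
  unfold cosh, sinh. rewrite Ropp_plus_distr, !exp_plus. field.
Qed.

Lemma exp_cosh_sinh x : exp x = cosh x + sinh x.
Proof. unfold cosh, sinh. field. Qed.

Lemma exp_neg_cosh_sinh x : exp (- x) = cosh x - sinh x.
Proof. unfold cosh, sinh. field. Qed.

Lemma sinh_pos x : 0 < x -> 0 < sinh x.
Proof.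
  intros Hx. unfold sinh. assert (exp (- x) < exp x) by (apply exp_increasing; lra). lra.
Qed.

Lemma cosh_ge_1 x : 1 <= cosh x.
Proof.
  generalize (cosh_sinh_sq x). assert (0 < cosh x) by (unfold cosh; generalize (exp_pos x) (exp_pos (-x)); lra).
  nra.
Qed.

Lemma cosh_gt_1 x : 0 < x -> 1 < cosh x.
Proof. intros Hx. generalize (cosh_sinh_sq x) (sinh_pos x Hx) (cosh_ge_1 x). nra. Qed.

Lemma sinh_ge_id x : 0 <= x -> x <= sinh x.
Proof.
  intros Hx. destruct (Rle_lt_or_eq_dec 0 x Hx) as [H|<-].
  - destruct (MVT_gen sinh 0 x cosh) as (t & _ & E).
    + intros t _. unfold sinh, cosh. auto_derive; [exact I|field].
    + intros t _. apply continuity_pt_filterlim. 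
      apply (ex_derive_continuous sinh). unfold sinh. auto_derive. exact I.
    + replace (sinh 0) with 0 in E by (unfold sinh; rewrite Ropp_0; field).
      generalize (cosh_ge_1 t). nra.
  - unfold sinh. rewrite Ropp_0. lra.
Qed.

Lemma cosh_lt x y : 0 <= x -> x < y -> cosh x < cosh y.
Proof.
  intros Hx Hxy. replace y with (x + (y - x)) by ring. rewrite cosh_plus.
  assert (1 < cosh (y - x)) by (apply cosh_gt_1; lra).
  assert (0 < sinh (y - x)) by (apply sinh_pos; lra).
  assert (0 <= sinh x) by (generalize (sinh_ge_id x Hx); lra).
  generalize (cosh_ge_1 x). nra.
Qed.

Lemma cosh_le_inv x y : 0 <= x -> 0 <= y -> cosh x <= cosh y -> x <= y.
Proof.
  intros Hx Hy H. apply Rnot_lt_le. intros Hc. generalize (cosh_lt y x Hy Hc). lra.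
Qed.

Lemma Racosh_cosh u : 1 < u -> cosh (Racosh u) = u.
Proof.
  intros Hu. assert (Hs : 0 <= sqrt (u * u - 1)) by apply sqrt_pos.
  assert (Hss : sqrt (u * u - 1) * sqrt (u * u - 1) = u * u - 1) by (apply sqrt_sqrt; nra).
  unfold cosh, Racosh. rewrite exp_Ropp, exp_ln by lra.
  set (s := sqrt (u * u - 1)) in *. replace (/ (u + s)) with (u - s); [field|].
  apply (Rmult_eq_reg_l (u + s)); [|lra]. rewrite Rinv_r by lra. lra.
Qed.

Lemma hl_cosh f p q : Markov f -> prim p q -> f p q = 2 * cosh (hl f p q).
Proof.
  intros (_ & H & _) Hp. specialize (H p q Hp). unfold hl. rewrite Racosh_cosh by lra. field.
Qed.

Lemma hl_sinh f p q : Markov f -> prim p q -> sqrt (f p q * f p q - 4) = 2 * sinh (hl f p q).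
Proof.
  intros Hf Hp. rewrite (hl_cosh f p q) by assumption.
  assert (Hs := sinh_pos _ (hl_pos f p q Hf Hp)).
  apply sqrt_lem_1.
  - generalize (cosh_sinh_sq (hl f p q)). nra.
  - lra.
  - generalize (cosh_sinh_sq (hl f p q)). lra.
Qed.

Lemma dhl_sinh f g p q : Markov f -> prim p q -> g p q = 2 * sinh (hl f p q) * dhl f g p q.
Proof.
  intros Hf Hp. unfold dhl. rewrite hl_sinh by assumption.
  assert (Hs := sinh_pos _ (hl_pos f p q Hf Hp)). field. lra.
Qed.

Lemma trace_rec_unimod f a b c d : TraceFn f -> unimod a b c d ->
  f (a + c)%Z (b + d)%Z + f (a - c)%Z (b - d)%Z = f a b * f c d.
Proof.
  intros [He Hr] [H|H]; [now apply Hr|].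
  rewrite Rmult_comm, <- Hr by lia. rewrite (Z.add_comm c), (Z.add_comm d). f_equal.
  apply even_swap; [exact He|lia].
Qed.

Lemma dtrace_rec_unimod f g a b c d : DTraceFn f g -> unimod a b c d ->
  g (a + c)%Z (b + d)%Z + g (a - c)%Z (b - d)%Z = g a b * f c d + f a b * g c d.
Proof.
  intros [He Hr] [H|H]; [now apply Hr|].
  transitivity (g c d * f a b + f c d * g a b); [|ring]. rewrite <- Hr by lia.
  rewrite (Z.add_comm c), (Z.add_comm d). f_equal. apply even_swap; [exact He|lia].
Qed.

(** * Matrices over the dual numbers, with logarithmically bounded derivative *)

(* A nonnegative quantity g = g_1 under the scaling of all logarithmic parameters by s
   satisfies g_s <= g_1^s e^{-c(s-1)}; this is the derivative of that inequality at s = 1. *)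
Definition LogBnd (c g g' : R) : Prop := 0 <= g /\ g' <= g * (ln g - c).

Lemma logbnd_zero c : LogBnd c 0 0.
Proof. split; lra. Qed.

(** Monotonicity of ln gives g ln g + k ln k <= (g + k) ln (g + k). Positivity of both terms is
    essential, whence the nonnegative matrices. *)
Lemma logbnd_add c g g' k k' : LogBnd c g g' -> LogBnd c k k' -> LogBnd c (g + k) (g' + k').
Proof.
  intros [Hg Eg] [Hk Ek]. split; [lra|].
  assert (M : forall u v, 0 <= u -> 0 <= v -> u * (ln u - c) <= u * (ln (u + v) - c)).
  { intros u v Hu Hv. destruct (Rle_lt_or_eq_dec 0 u Hu) as [H|<-]; [|lra].
    apply Rmult_le_compat_l; [lra|]. assert (ln u <= ln (u + v)); [|lra].
    destruct (Rle_lt_or_eq_dec 0 v Hv) as [H1|<-]; [left; apply ln_increasing; lra|rewrite Rplus_0_r; lra]. }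
  generalize (M g k Hg Hk) (M k g Hk Hg). rewrite (Rplus_comm k g). lra.
Qed.

Lemma logbnd_mul c1 c2 g g' k k' : LogBnd c1 g g' -> LogBnd c2 k k' ->
  LogBnd (c1 + c2) (g * k) (g * k' + g' * k).
Proof.
  intros [Hg Eg] [Hk Ek]. split; [nra|].
  assert (A : g * k' <= g * (k * (ln k - c2))) by (apply Rmult_le_compat_l; lra).
  assert (B : g' * k <= g * (ln g - c1) * k) by (apply Rmult_le_compat_r; lra).
  destruct (Rle_lt_or_eq_dec 0 g Hg) as [H|<-]; [|lra].
  destruct (Rle_lt_or_eq_dec 0 k Hk) as [H1|<-]; [|lra].
  rewrite ln_mult by assumption. nra.
Qed.

Definition dmat := (mat2 * mat2)%type.
Definition madd (a b : mat2) : mat2 :=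
  M2 (m11 a + m11 b) (m12 a + m12 b) (m21 a + m21 b) (m22 a + m22 b).
Definition dmul (A B : dmat) : dmat :=
  (mmul (fst A) (fst B), madd (mmul (fst A) (snd B)) (mmul (snd A) (fst B))).
Definition dtr (A : dmat) : R * R := (mtr (fst A), mtr (snd A)).
Definition ddet1 (A : dmat) : Prop :=
  mdet (fst A) = 1 /\
  m11 (fst A) * m22 (snd A) + m11 (snd A) * m22 (fst A)
  - m12 (fst A) * m21 (snd A) - m12 (snd A) * m21 (fst A) = 0.
Definition MLogBnd (c : R) (A : dmat) : Prop :=
  LogBnd c (m11 (fst A)) (m11 (snd A)) /\ LogBnd c (m12 (fst A)) (m12 (snd A)) /\
  LogBnd c (m21 (fst A)) (m21 (snd A)) /\ LogBnd c (m22 (fst A)) (m22 (snd A)).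

Lemma mlogbnd_mul c1 c2 A B : MLogBnd c1 A -> MLogBnd c2 B -> MLogBnd (c1 + c2) (dmul A B).
Proof.
  destruct A as [[a1 a2 a3 a4] [b1 b2 b3 b4]], B as [[e1 e2 e3 e4] [k1 k2 k3 k4]].
  unfold MLogBnd; simpl. intros (H1 & H2 & H3 & H4) (K1 & K2 & K3 & K4).
  assert (X : forall g g' k k' h h' l l', LogBnd c1 g g' -> LogBnd c2 k k' -> LogBnd c1 h h' -> LogBnd c2 l l' ->
     LogBnd (c1 + c2) (g * k + h * l) (g * k' + h * l' + (g' * k + h' * l))).
  { intros. replace (g * k' + h * l' + (g' * k + h' * l)) with ((g * k' + g' * k) + (h * l' + h' * l)) by ring.
    apply logbnd_add; now apply logbnd_mul. }
  split; [|split; [|split]]; apply X; assumption.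
Qed.

Lemma ddet1_mul A B : ddet1 A -> ddet1 B -> ddet1 (dmul A B).
Proof.
  intros [A1 A2] [B1 B2]. split.
  - simpl. rewrite mdet_mul, A1, B1. ring.
  - unfold mdet in *. destruct A as [[a1 a2 a3 a4] [b1 b2 b3 b4]], B as [[e1 e2 e3 e4] [k1 k2 k3 k4]].
    simpl in *.
    transitivity ((a1 * a4 - a2 * a3) * (e1 * k4 + k1 * e4 - e2 * k3 - k2 * e3) +
                  (e1 * e4 - e2 * e3) * (a1 * b4 + b1 * a4 - a2 * b3 - b2 * a3)); [ring|].
    rewrite A2, B2. ring.
Qed.

(** Cayley-Hamilton over the dual numbers. *)
Lemma dtr_mul_sq A B : ddet1 A ->
  dtr (dmul A (dmul A B)) =
  (fst (dtr A) * fst (dtr (dmul A B)) - fst (dtr B),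
   fst (dtr A) * snd (dtr (dmul A B)) + snd (dtr A) * fst (dtr (dmul A B)) - snd (dtr B)).
Proof.
  intros [A1 A2]. unfold dtr. f_equal.
  - simpl. now apply mtr_mul_sq.
  - unfold mdet in A1. destruct A as [[a1 a2 a3 a4] [b1 b2 b3 b4]], B as [[e1 e2 e3 e4] [k1 k2 k3 k4]].
    unfold mtr. simpl in *.
    replace (k1 + k4) with ((a1 * a4 - a2 * a3) * (k1 + k4) + (a1 * b4 + b1 * a4 - a2 * b3 - b2 * a3) * (e1 + e4))
      by (rewrite A1, A2; ring).
    ring.
Qed.

Lemma dtr_mul_sq_r A B : ddet1 B ->
  dtr (dmul (dmul A B) B) =
  (fst (dtr B) * fst (dtr (dmul A B)) - fst (dtr A),
   fst (dtr B) * snd (dtr (dmul A B)) + snd (dtr B) * fst (dtr (dmul A B)) - snd (dtr A)).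
Proof.
  intros [A1 A2]. unfold dtr. f_equal.
  - simpl. rewrite mtr_mul_sq_r by exact A1. ring.
  - unfold mdet in A1. destruct A as [[e1 e2 e3 e4] [k1 k2 k3 k4]], B as [[a1 a2 a3 a4] [b1 b2 b3 b4]].
    unfold mtr. simpl in *.
    replace (k1 + k4) with ((a1 * a4 - a2 * a3) * (k1 + k4) + (a1 * b4 + b1 * a4 - a2 * b3 - b2 * a3) * (e1 + e4))
      by (rewrite A1, A2; ring).
    ring.
Qed.

Fixpoint dpow (A : dmat) (n : nat) : dmat :=
  match n with O => (mid, M2 0 0 0 0) | S n => dmul A (dpow A n) end.

Lemma mlogbnd_pow c A n : MLogBnd c A -> MLogBnd (INR n * c) (dpow A n).
Proof.
  intros H. induction n as [|n IH].
  - simpl. rewrite Rmult_0_l. unfold MLogBnd, LogBnd; simpl. rewrite ln_1. lra.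
  - rewrite S_INR. replace ((INR n + 1) * c) with (c + INR n * c) by ring.
    now apply mlogbnd_mul.
Qed.

(** Over the dual numbers the trace is 2 cosh (q + eps q'), so the recursion of [dtr_mul_sq] is the
    addition formula for cosh n (q + eps q'). *)
Lemma dtr_pow A q q' n : ddet1 A -> dtr A = (2 * cosh q, 2 * sinh q * q') ->
  dtr (dpow A n) = (2 * cosh (INR n * q), 2 * sinh (INR n * q) * (INR n * q')).
Proof.
  intros Hd E.
  enough (H : dtr (dpow A n) = (2 * cosh (INR n * q), 2 * sinh (INR n * q) * (INR n * q')) /\
     dtr (dpow A (S n)) = (2 * cosh (INR (S n) * q), 2 * sinh (INR (S n) * q) * (INR (S n) * q'))) by tauto.
  induction n as [|n [IH1 IH2]].
  - split.
    + simpl. rewrite !Rmult_0_l. unfold dtr, mtr; simpl. unfold cosh, sinh. rewrite Ropp_0, exp_0.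
      f_equal; field.
    + replace (INR 1) with 1 by reflexivity. rewrite !Rmult_1_l, <- E.
      destruct A as [[a1 a2 a3 a4] [b1 b2 b3 b4]]. unfold dtr, mtr; simpl. f_equal; ring.
  - split; [exact IH2|]. change (dpow A (S (S n))) with (dmul A (dmul A (dpow A n))).
    rewrite dtr_mul_sq by exact Hd. change (dmul A (dpow A n)) with (dpow A (S n)).
    rewrite IH1, IH2, E. cbn [fst snd].
    replace (INR (S (S n)) * q) with (INR (S n) * q + q) by (rewrite !S_INR; ring).
    replace (INR n * q) with (INR (S n) * q + - q) by (rewrite !S_INR; ring).
    replace (INR n * q') with (INR (S n) * q' - q') by (rewrite !S_INR; ring).
    replace (INR (S (S n)) * q') with (INR (S n) * q' + q') by (rewrite !S_INR; ring).
    rewrite !cosh_plus, !sinh_plus.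
    assert (cosh (- q) = cosh q) as -> by (unfold cosh; rewrite Ropp_involutive; field).
    assert (sinh (- q) = - sinh q) as -> by (unfold sinh; rewrite Ropp_involutive; field).
    f_equal; ring.
Qed.

Lemma x_exp_neg_le_1 x : x * exp (- x) <= 1.
Proof.
  assert (H := exp_ineq1_le x). generalize (exp_neg x) (exp_pos (- x)). nra.
Qed.

(* The n-th power of A has trace 2cosh(nq); letting n tend to infinity removes the
   additive constant ln 2. *)
Lemma mlogbnd_trace c A q q' : 0 < q -> ddet1 A -> MLogBnd c A ->
  dtr A = (2 * cosh q, 2 * sinh q * q') -> q' <= q - c.
Proof.
  intros Hq Hd HA E. apply Rnot_lt_le. intros Hc.
  set (dl := q' - q + c). assert (Hdl : 0 < dl) by (unfold dl; lra).
  enough (B : forall n, INR n * dl <= ln 2 + Rabs q' / q).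
  { assert (P : 0 < ln 2 + Rabs q' / q + 1).
    { assert (0 <= Rabs q' / q) by (apply Rmult_le_pos; [apply Rabs_pos|left; now apply Rinv_0_lt_compat]).
      generalize ln_lt_2. lra. }
    set (W := ln 2 + Rabs q' / q) in *. clearbody W.
    destruct (archimed_cor1 (dl / (W + 1))) as (n & Hn & Hn0); [now apply Rdiv_lt_0_compat|].
    specialize (B n). assert (HnR : 0 < INR n) by (now apply lt_0_INR).
    apply (Rmult_lt_compat_r (INR n * (W + 1))) in Hn; [|nra].
    replace (/ INR n * (INR n * (W + 1))) with (W + 1) in Hn by (field; lra).
    replace (dl / (W + 1) * (INR n * (W + 1))) with (INR n * dl) in Hn by (field; lra). lra. }
  intros n. destruct (mlogbnd_pow c A n HA) as (L1 & _ & _ & L4).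
  pose proof (logbnd_add _ _ _ _ _ L1 L4) as [_ L].
  pose proof (dtr_pow A q q' n Hd E) as Ep. unfold dtr, mtr in Ep. injection Ep as Ep1 Ep2.
  rewrite Ep1, Ep2 in L. set (N := INR n) in *. assert (HN : 0 <= N) by apply pos_INR.
  assert (Hx : 0 <= N * q) by nra.
  assert (C1 := cosh_ge_1 (N * q)).
  assert (Hln : ln (2 * cosh (N * q)) <= ln 2 + N * q).
  { rewrite ln_mult by lra. apply Rplus_le_compat_l. rewrite <- (ln_exp (N * q)) at 2.
    apply ln_le; [lra|]. rewrite (exp_cosh_sinh (N * q)). generalize (sinh_ge_id _ Hx). lra. }
  (* Replacing sinh by cosh in the derivative of the trace costs N exp(-Nq) |q'|, which stays below
     |q'| / q for all N. *)
  assert (Hexp : N * exp (- (N * q)) <= / q).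
  { generalize (x_exp_neg_le_1 (N * q)). intros H.
    apply (Rmult_le_reg_r q); [exact Hq|]. rewrite Rinv_l by lra. lra. }
  rewrite exp_neg_cosh_sinh in Hexp.
  assert (Hd0 : 0 <= cosh (N * q) - sinh (N * q)) by (rewrite <- exp_neg_cosh_sinh; left; apply exp_pos).
  set (Ch := cosh (N * q)) in *. set (Sh := sinh (N * q)) in *.
  assert (H1 : Sh * (N * q') <= Ch * (ln 2 + N * q - N * c)).
  { assert (Ch * ln (2 * Ch) <= Ch * (ln 2 + N * q)) by (apply Rmult_le_compat_l; lra). lra. }
  assert (H2 : Ch * (N * dl) <= Ch * ln 2 + (N * (Ch - Sh)) * q') by (unfold dl; lra).
  assert (H3 : N * (Ch - Sh) * q' <= / q * Rabs q').
  { apply (Rle_trans _ (N * (Ch - Sh) * Rabs q')).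
    - apply Rmult_le_compat_l; [nra|apply Rle_abs].
    - apply Rmult_le_compat_r; [apply Rabs_pos|exact Hexp]. }
  assert (H4 : 0 <= / q * Rabs q') by (apply Rmult_le_pos; [left; now apply Rinv_0_lt_compat|apply Rabs_pos]).
  unfold Rdiv. rewrite (Rmult_comm (Rabs q')).
  apply (Rmult_le_reg_l Ch); [lra|]. nra.
Qed.

(** * The strip of curves meeting a given curve once *)

(* These values give f n 1 = a e^{np} + b e^{-np}, the traces of the curves meeting (1, 0) once;
   the relation for a b is the equation x^2 + y^2 + z^2 = xyz. *)
Definition Strip (f : Z -> Z -> R) (p a b : R) : Prop :=
  0 < p /\ 0 < a /\ 0 < b /\ f 1%Z 0%Z = 2 * cosh p /\
  f 0%Z 1%Z = a + b /\ f 1%Z 1%Z = a * exp p + b * exp (- p) /\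
  a * b * (sinh p * sinh p) = cosh p * cosh p.

(* (dp, al, be) are the derivatives of (p, ln a, ln b) along g. *)
Definition STan (p a b : R) (g : Z -> Z -> R) (dp al be : R) : Prop :=
  g 1%Z 0%Z = 2 * sinh p * dp /\ g 0%Z 1%Z = al * a + be * b /\
  g 1%Z 1%Z = (al + dp) * (a * exp p) + (be - dp) * (b * exp (- p)) /\
  (al + be) * (sinh p * cosh p) = - 2 * dp.

(** The traces of (0, 1) and (1, 1) form a linear system for a and b. The Markov equation gives the
    product a b, hence ab > 0, and a + b > 2 then makes both positive. *)
Lemma strip_exists f : Markov f -> exists a b, Strip f (hl f 1 0) a b.
Proof.
  intros Hf. pose proof (hl_pos f _ _ Hf prim_10) as Hp. set (p := hl f 1%Z 0%Z) in *.
  pose proof (hl_cosh f _ _ Hf prim_10) as Ex. fold p in Ex.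
  destruct Hf as (_ & H2 & HF). 
  pose proof (H2 _ _ prim_01) as Hy. pose proof (H2 _ _ prim_11) as Hz.
  specialize (HF 1 0 0 1 eq_refl)%Z. simpl in HF.
  set (y := f 0%Z 1%Z) in *. set (z := f 1%Z 1%Z) in *. rewrite Ex in HF.
  assert (Hs := sinh_pos p Hp). assert (Hc := cosh_ge_1 p). assert (Hcs := cosh_sinh_sq p).
  pose (a := (z - y * exp (- p)) / (2 * sinh p)). pose (b := (y * exp p - z) / (2 * sinh p)).
  assert (Ea : 2 * sinh p * a = z - y * exp (-p)) by (unfold a; field; lra).
  assert (Eb : 2 * sinh p * b = y * exp p - z) by (unfold b; field; lra).
  rewrite exp_neg_cosh_sinh in Ea. rewrite exp_cosh_sinh in Eb.
  assert (Eab : a + b = y) by (apply (Rmult_eq_reg_l (2 * sinh p)); [|lra]; nra).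
  assert (Eq : a * b * (sinh p * sinh p) = cosh p * cosh p).
  { assert (X : (2 * sinh p * a) * (2 * sinh p * b) = 4 * (cosh p * cosh p)).
    { rewrite Ea, Eb. 
      transitivity (2 * cosh p * y * z - z * z - y * y * (cosh p * cosh p - sinh p * sinh p)); [ring|].
      rewrite Hcs. lra. }
    lra. }
  assert (Hab : 0 < a * b).
  { apply (Rmult_lt_reg_r (sinh p * sinh p)); [nra|]. nra. }
  assert (Ha : 0 < a) by nra. assert (Hb : 0 < b) by nra.
  exists a, b. split; [exact Hp|]. split; [exact Ha|]. split; [exact Hb|]. split; [exact Ex|].
  split; [symmetry; exact Eab|]. split; [|exact Eq]. fold z.
  rewrite exp_neg_cosh_sinh, exp_cosh_sinh. apply (Rmult_eq_reg_l (2 * sinh p)); [|lra].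
  transitivity ((2 * sinh p * a) * (cosh p + sinh p) + (2 * sinh p * b) * (cosh p - sinh p)); [|ring].
  rewrite Ea, Eb. ring.
Qed.

(** Logarithmic derivative of ab = coth(p)^2: al + be = 2 dp (tanh p - coth p) = -2 dp / (sinh p
    cosh p). *)
Lemma strip_tangent f p a b x' dp al be : Strip f p a b -> x' = 2 * sinh p * dp ->
  (Tangent (f 1%Z 0%Z, f 0%Z 1%Z, f 1%Z 1%Z)
     (x', al * a + be * b, (al + dp) * (a * exp p) + (be - dp) * (b * exp (- p))) <->
   (al + be) * (sinh p * cosh p) = - 2 * dp).
Proof.
  intros (Hp & Ha & Hb & Ex & Ey & Ez & Eq) ->. unfold Tangent. rewrite Ex, Ey, Ez.
  rewrite exp_neg_cosh_sinh, exp_cosh_sinh.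
  assert (Hs := sinh_pos p Hp). assert (Hc := cosh_ge_1 p). assert (Hcs := cosh_sinh_sq p).
  set (s := sinh p) in *. set (c := cosh p) in *.
  match goal with |- ?l = 0 <-> _ => assert (El : l * s = - 4 * c * ((al + be) * (s * c) + 2 * dp)) end.
  { assert (Ec : c * c = 1 + s * s) by exact Hcs.
    assert (R1 : (2 * (2 * c) - (a + b) * (a * (c + s) + b * (c - s))) * (2 * s * dp) +
      (2 * (a + b) - 2 * c * (a * (c + s) + b * (c - s))) * (al * a + be * b) +
      (2 * (a * (c + s) + b * (c - s)) - 2 * c * (a + b)) * ((al + dp) * (a * (c + s)) + (be - dp) * (b * (c - s)))
      = 2 * s * (4 * c * dp - 4 * c * dp * (a * b)) - 4 * (s * s) * (a * b) * (al + be)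
        + 2 * (1 + s * s - c * c) * ((a + b) * (al * a + be * b))).
    { ring. }
    rewrite R1, Hcs.
    transitivity (8 * s * s * c * dp - 8 * c * dp * (a * b * (s * s)) - 4 * s * (a * b * (s * s)) * (al + be)); [ring|].
    rewrite Eq.
    transitivity (- 8 * c * dp * (c * c - s * s) - 4 * s * (c * c) * (al + be)); [ring|].
    rewrite Hcs at 1. ring. }
  split; intros H.
  - rewrite H in El.
    assert (H1 : c * ((al + be) * (s * c) + 2 * dp) = 0) by lra.
    apply Rmult_integral in H1. destruct H1; lra.
  - assert (E0 : (al + be) * (s * c) + 2 * dp = 0) by lra. rewrite E0, Rmult_0_r in El.
    apply Rmult_integral in El. destruct El; [assumption|lra].
Qed.

Lemma stan_exists f p a b g : Strip f p a b -> Tan f g -> exists dp al be, STan p a b g dp al be.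
Proof.
  intros HS Hg. pose proof HS as (Hp & Ha & Hb & Ex & Ey & Ez & Eq).
  assert (Hs := sinh_pos p Hp).
  pose (dp := g 1%Z 0%Z / (2 * sinh p)).
  (* The derivative of a exp p + b exp(-p) with p held fixed. *)
  pose (w := g 1%Z 1%Z - dp * (a * exp p - b * exp (- p))).
  pose (al := (w - g 0%Z 1%Z * exp (- p)) / (2 * sinh p * a)).
  pose (be := (g 0%Z 1%Z * exp p - w) / (2 * sinh p * b)).
  assert (E1 : g 1%Z 0%Z = 2 * sinh p * dp) by (unfold dp; field; lra).
  assert (Ea : al * a = (w - g 0%Z 1%Z * exp (- p)) / (2 * sinh p)) by (unfold al; field; lra).
  assert (Eb : be * b = (g 0%Z 1%Z * exp p - w) / (2 * sinh p)) by (unfold be; field; lra).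
  assert (E2 : g 0%Z 1%Z = al * a + be * b).
  { rewrite Ea, Eb, exp_neg_cosh_sinh, exp_cosh_sinh. field. lra. }
  assert (E3 : g 1%Z 1%Z = (al + dp) * (a * exp p) + (be - dp) * (b * exp (- p))).
  { transitivity ((al * a) * exp p + (be * b) * exp (- p) + dp * (a * exp p - b * exp (- p))); [|ring].
    rewrite Ea, Eb. assert (En := exp_neg p).
    transitivity (w + dp * (a * exp p - b * exp (-p))); [unfold w; ring|]. f_equal.
    rewrite exp_neg_cosh_sinh, exp_cosh_sinh. field. lra. }
  exists dp, al, be. repeat split; try assumption.
  apply (strip_tangent f p a b (g 1%Z 0%Z) dp al be HS E1).
  rewrite <- E2, <- E3. now apply tan_base.
Qed.

Lemma stan_realize f p a b dp al be : Markov f -> Strip f p a b ->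
  (al + be) * (sinh p * cosh p) = - 2 * dp -> exists g, Tan f g /\ STan p a b g dp al be.
Proof.
  intros Hf HS E. apply (strip_tangent f p a b _ dp al be HS eq_refl) in E as Ht.
  destruct (tan_extend f _ _ _ Hf Ht) as (g & Hg & E1 & E2 & E3).
  exists g. split; [exact Hg|]. repeat split; assumption.
Qed.

Lemma stan_lc p a b g1 g2 d1 a1 b1 d2 a2 b2 r s :
  STan p a b g1 d1 a1 b1 -> STan p a b g2 d2 a2 b2 ->
  STan p a b (lc r s g1 g2) (r * d1 + s * d2) (r * a1 + s * a2) (r * b1 + s * b2).
Proof.
  intros (A1 & A2 & A3 & A4) (B1 & B2 & B3 & B4). unfold lc. repeat split.
  - rewrite A1, B1. ring.
  - rewrite A2, B2. ring.
  - rewrite A3, B3. ring.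
  - transitivity (r * ((a1 + b1) * (sinh p * cosh p)) + s * ((a2 + b2) * (sinh p * cosh p))); [ring|].
    rewrite A4, B4. ring.
Qed.

Lemma stan_unique f p a b g g' dp al be : Tan f g -> Tan f g' ->
  STan p a b g dp al be -> STan p a b g' dp al be -> eqp g g'.
Proof.
  intros [D1 _] [D2 _] (A1 & A2 & A3 & A4) (B1 & B2 & B3 & B4). intros q r.
  apply (dtrace_unique f); try assumption; congruence.
Qed.

(** The model is U = diag(exp p, exp(-p)) for (1, 0) and the symmetric V with rows (a, h), (h, b), h
    = 1 / sinh p, for (0, 1); det V = ab - h^2 = 1 is the strip equation. All entries are
    nonnegative. The entries of U satisfy the logarithmic bound with slack 0, those of V with slack
    c, so a word with k letters V has slack c k. *)
Lemma mlogbnd_word f g p a b al be c : Markov f -> Tan f g -> Strip f p a b ->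
  STan p a b g p al be -> 0 <= c ->
  al <= ln a - c -> be <= ln b - c -> c <= p * cosh p / sinh p - ln (sinh p) ->
  forall m k, (0 < k)%Z -> prim m k ->
  exists A, ddet1 A /\ MLogBnd (c * IZR k) A /\ dtr A = (f m k, g m k).
Proof.
  intros Hf Hg HS HT Hc Hal Hbe Hcc m k Hk Hp.
  pose proof HS as (Pp & Pa & Pb & Ex & Ey & Ez & Eq).
  pose proof HT as (G1 & G2 & G3 & G4).
  assert (Hs := sinh_pos p Pp). assert (Hch := cosh_ge_1 p).
  (* [eta] is the derivative of ln h = - ln (sinh p) when p moves with speed p. *)
  set (h := / sinh p). set (eta := - p * (cosh p / sinh p)).
  assert (Hh : 0 < h) by (now apply Rinv_0_lt_compat).
  assert (Hhs : h * sinh p = 1) by (unfold h; field; lra).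
  set (V := (M2 a h h b, M2 (al * a) (eta * h) (eta * h) (be * b)) : dmat).
  set (U := (M2 (exp p) 0 0 (exp (- p)), M2 (p * exp p) 0 0 (- p * exp (- p))) : dmat).
  set (U' := (M2 (exp (- p)) 0 0 (exp p), M2 (- p * exp (- p)) 0 0 (p * exp p)) : dmat).
  assert (Ehh : a * b - h * h = 1).
  { apply (Rmult_eq_reg_r (sinh p * sinh p)); [|nra].
    replace ((a * b - h * h) * (sinh p * sinh p)) with (a * b * (sinh p * sinh p) - (h * sinh p) * (h * sinh p)) by ring.
    rewrite Eq, Hhs, cosh_sinh_sq. ring. }
  assert (DV : ddet1 V).
  { split; unfold mdet, V; simpl; [exact Ehh|].
    apply (Rmult_eq_reg_r (sinh p * sinh p)); [|nra].
    transitivity ((al + be) * (a * b * (sinh p * sinh p)) - 2 * eta * ((h * sinh p) * (h * sinh p))); [ring|].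
    rewrite Hhs, Eq. unfold eta. 
    apply (Rmult_eq_reg_r (sinh p)); [|lra].
    transitivity (((al + be) * (sinh p * cosh p)) * cosh p + 2 * p * cosh p); [field; lra|]. rewrite G4. ring. }
  assert (DU : ddet1 U).
  { split; unfold mdet, U; simpl; generalize (exp_neg p); [lra|]. intros _; ring. }
  assert (DU' : ddet1 U').
  { split; unfold mdet, U'; simpl; generalize (exp_neg p); [lra|]. intros _; ring. }
  assert (LV : MLogBnd (c * IZR 1) V).
  { rewrite Rmult_1_r.
    assert (Lh : LogBnd c h (eta * h)).
    { split; [lra|]. rewrite Rmult_comm. apply Rmult_le_compat_l; [lra|].
      unfold h. rewrite ln_Rinv by exact Hs. unfold eta.
      replace (- p * (cosh p / sinh p)) with (- (p * cosh p / sinh p)) by (unfold Rdiv; ring). lra. }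
    unfold MLogBnd, V; simpl. split; [|split; [exact Lh|split; [exact Lh|]]].
    - split; [lra|]. rewrite Rmult_comm. apply Rmult_le_compat_l; lra.
    - split; [lra|]. rewrite Rmult_comm. apply Rmult_le_compat_l; lra. }
  assert (Le : LogBnd (c * IZR 0) (exp p) (p * exp p)).
  { split; [left; apply exp_pos|]. rewrite ln_exp. lra. }
  assert (Le' : LogBnd (c * IZR 0) (exp (- p)) (- p * exp (- p))).
  { split; [left; apply exp_pos|]. rewrite ln_exp. lra. }
  assert (LU : MLogBnd (c * IZR 0) U).
  { split; [exact Le|]. split; [apply logbnd_zero|]. split; [apply logbnd_zero|exact Le']. }
  assert (LU' : MLogBnd (c * IZR 0) U').
  { split; [exact Le'|]. split; [apply logbnd_zero|]. split; [apply logbnd_zero|exact Le]. }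
  destruct Hf as (Ht & _). destruct Hg as (Hd & _).
  pose (Q := fun r s t u => exists A B, unimod r s t u /\ ddet1 A /\ ddet1 B /\
     MLogBnd (c * IZR s) A /\ MLogBnd (c * IZR u) B /\ dtr A = (f r s, g r s) /\ dtr B = (f t u, g t u) /\
     dtr (dmul A B) = (f (r + t)%Z (s + u)%Z, g (r + t)%Z (s + u)%Z)).
  assert (QL : forall r s t u, Q r s t u -> Q r s (r + t)%Z (s + u)%Z).
  { intros r s t u (A & B & Hu & DA & DB & LA & LB & TA & TB & TAB).
    assert (Hu' : unimod r s (r + t) (s + u)) by (unfold unimod in *; lia).
    exists A, (dmul A B). split; [exact Hu'|]. split; [exact DA|]. split; [now apply ddet1_mul|].
    split; [exact LA|]. split; [rewrite plus_IZR, Rmult_plus_distr_l; now apply mlogbnd_mul|].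
    split; [exact TA|]. split; [exact TAB|].
    rewrite dtr_mul_sq by exact DA. rewrite TA, TB, TAB. simpl.
    generalize (trace_rec_unimod f _ _ _ _ Ht Hu') (dtrace_rec_unimod f g _ _ _ _ Hd Hu').
    replace (r - (r + t))%Z with (- t)%Z by lia. replace (s - (s + u))%Z with (- u)%Z by lia.
    assert (Pv : prim t u) by (apply (gcd_det t u r s); unfold unimod in Hu; lia).
    destruct Ht as [He _]. destruct Hd as [He' _]. rewrite He, He' by exact Pv.
    intros R1 R2. f_equal; lra. }
  assert (QR : forall r s t u, Q r s t u -> Q (r + t)%Z (s + u)%Z t u).
  { intros r s t u (A & B & Hu & DA & DB & LA & LB & TA & TB & TAB).
    assert (Hu' : unimod (r + t) (s + u) t u) by (unfold unimod in *; lia).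
    exists (dmul A B), B. split; [exact Hu'|]. split; [now apply ddet1_mul|]. split; [exact DB|].
    split; [rewrite plus_IZR, Rmult_plus_distr_l; now apply mlogbnd_mul|]. split; [exact LB|].
    split; [exact TAB|]. split; [exact TB|].
    rewrite dtr_mul_sq_r by exact DB. rewrite TA, TB, TAB. simpl.
    generalize (trace_rec_unimod f _ _ _ _ Ht Hu') (dtrace_rec_unimod f g _ _ _ _ Hd Hu').
    replace (r + t - t)%Z with r by lia. replace (s + u - u)%Z with s by lia.
    intros R1 R2. f_equal; lra. }
  assert (TV : dtr V = (f 0%Z 1%Z, g 0%Z 1%Z)).
  { unfold dtr, mtr, V; simpl. now rewrite Ey, G2. }
  assert (Q1 : Q 1%Z 0%Z 0%Z 1%Z).
  { exists U, V. split; [now left|]. repeat (split; [assumption|]). split; [|split; [exact TV|]].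
    - unfold dtr, mtr, U; simpl. rewrite Ex, G1. f_equal; unfold cosh, sinh; field.
    - simpl Z.add. rewrite Ez, G3. unfold dtr, mtr, U, V; simpl. f_equal; ring. }
  (* Curves with m < 0 are words in U^-1 and V. Since U is diagonal, its inverse is nonnegative
     too. *)
  assert (Q2 : Q (-1)%Z 0%Z 0%Z 1%Z).
  { exists U', V. split; [now right|]. repeat (split; [assumption|]). split; [|split; [exact TV|]].
    - destruct Ht as [He _]. destruct Hd as [He' _].
      rewrite <- (He (-1)%Z), <- (He' (-1)%Z) by reflexivity. simpl Z.opp.
      unfold dtr, mtr, U'; simpl. rewrite Ex, G1. f_equal; unfold cosh, sinh; field.
    - generalize (trace_rec_unimod f (-1) 0 0 1 Ht ltac:(now right))
        (dtrace_rec_unimod f g (-1) 0 0 1 Hd ltac:(now right)). simpl Z.add; simpl Z.sub.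
      destruct Ht as [He _]. destruct Hd as [He' _].
      rewrite <- (He (-1)%Z 0%Z), <- (He' (-1)%Z 0%Z) by reflexivity.
      rewrite <- (He (-1)%Z (-1)%Z), <- (He' (-1)%Z (-1)%Z) by reflexivity. simpl Z.opp.
      intros R1 R2.
      assert (f (-1)%Z 1%Z = f 1%Z 0%Z * f 0%Z 1%Z - f 1%Z 1%Z) as -> by lra.
      assert (g (-1)%Z 1%Z = g 1%Z 0%Z * f 0%Z 1%Z + f 1%Z 0%Z * g 0%Z 1%Z - g 1%Z 1%Z) as -> by lra.
      rewrite Ex, Ey, Ez, G1, G2, G3. unfold dtr, mtr, U', V, cosh, sinh; simpl.
      f_equal; field. }
  destruct (Z.lt_total m 0) as [H|[->|H]].
  - assert (Hg : Z.gcd (- m) k = 1%Z) by (now rewrite Z.gcd_opp_l).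
    destruct (cone_ind Q QL QR _ _ _ _ (- m) k Q2 ltac:(lia) Hk Hg)
      as (r & s & t & u & (A & B & Hu & DA & DB & LA & LB & TA & TB & TAB) & E1 & E2).
    exists (dmul A B). replace m with (r + t)%Z by lia. replace k with (s + u)%Z by lia.
    split; [now apply ddet1_mul|]. split; [|exact TAB].
    rewrite plus_IZR, Rmult_plus_distr_l. now apply mlogbnd_mul.
  - assert (k = 1%Z) as -> by (unfold prim in Hp; simpl in Hp; lia).
    exists V. repeat split; try apply DV; try apply LV. exact TV.
  - destruct (cone_ind Q QL QR _ _ _ _ m k Q1 H Hk Hp)
      as (r & s & t & u & (A & B & Hu & DA & DB & LA & LB & TA & TB & TAB) & E1 & E2).
    exists (dmul A B). replace m with (r + t)%Z by lia. replace k with (s + u)%Z by lia.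
    split; [now apply ddet1_mul|]. split; [|exact TAB].
    rewrite plus_IZR, Rmult_plus_distr_l. now apply mlogbnd_mul.
Qed.

(* Infinitesimal version of the fact that stretch maps along a lamination spiralling to the curve (1, 0)
   have Lipschitz constant e^t. *)
Lemma stretch_bound f g p a b al be c : Markov f -> Tan f g -> Strip f p a b ->
  STan p a b g p al be -> 0 <= c ->
  al <= ln a - c -> be <= ln b - c -> c <= p * cosh p / sinh p - ln (sinh p) ->
  forall m k, (0 < k)%Z -> prim m k -> dhl f g m k <= hl f m k - c * IZR k.
Proof.
  intros Hf Hg HS HT Hc Hal Hbe Hcc m k Hk Hp.
  destruct (mlogbnd_word f g p a b al be c Hf Hg HS HT Hc Hal Hbe Hcc m k Hk Hp) as (A & DA & LA & TA).
  apply (mlogbnd_trace _ A); [now apply hl_pos|exact DA|exact LA|].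
  rewrite TA. now rewrite <- hl_cosh, <- dhl_sinh.
Qed.

(** * Facets of the unit ball *)

Lemma hl_even f p q : EvenFn f -> prim p q -> hl f (- p) (- q) = hl f p q.
Proof. intros He Hp. unfold hl. now rewrite He. Qed.

Lemma dhl_even f g p q : EvenFn f -> EvenFn g -> prim p q -> dhl f g (- p) (- q) = dhl f g p q.
Proof. intros He Hg Hp. unfold dhl. now rewrite He, Hg. Qed.

Lemma bnd_cob a b c d f g K : unimod a b c d ->
  (Bnd f g K <-> Bnd (cob a b c d f) (cob a b c d g) K).
Proof.
  intros Hu. split.
  - intros H p q Hp. apply (H (a * p + b * q)%Z (c * p + d * q)%Z). now apply gcd_mat.
  - intros H p q Hp. destruct (unimod_inv a b c d Hu) as (a' & b' & c' & d' & Hu' & HM).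
    destruct (HM p q) as (E1 & E2 & _).
    specialize (H (a' * p + b' * q) (c' * p + d' * q) (gcd_mat _ _ _ _ _ _ Hu' Hp))%Z.
    unfold dhl, hl, cob in H. rewrite E1, E2 in H. exact H.
Qed.

Lemma prim_m_0 m : prim m 0 -> m = 1%Z \/ m = (-1)%Z.
Proof. unfold prim. rewrite Z.gcd_0_r. lia. Qed.

Lemma stan_dhl f g p a b dp al be : Markov f -> p = hl f 1 0 -> STan p a b g dp al be ->
  dhl f g 1 0 = dp.
Proof.
  intros Hf -> (E & _). 
  assert (Hs := sinh_pos _ (hl_pos f _ _ Hf prim_10)).
  rewrite (dhl_sinh f g _ _ Hf prim_10) in E. nra.
Qed.

(* Bounds the slack c available to the entry 1/sinh p of the matrix V in mlogbnd_word. *)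
Lemma ln_sinh_lt p : 0 < p -> ln (sinh p) < p * cosh p / sinh p.
Proof.
  intros Hp. assert (Hs := sinh_pos p Hp). apply (Rlt_trans _ p).
  - rewrite <- (ln_exp p) at 2. apply ln_increasing; [exact Hs|].
    rewrite exp_cosh_sinh. generalize (cosh_ge_1 p). lra.
  - apply (Rmult_lt_reg_r (sinh p)); [exact Hs|]. unfold Rdiv.
    rewrite Rmult_assoc, Rinv_l, Rmult_1_r by lra. apply Rmult_lt_compat_l; [exact Hp|].
    generalize (exp_pos (- p)). rewrite exp_neg_cosh_sinh. lra.
Qed.

(** Slack 0 covers the curves with k > 0 and evenness those with k < 0; for k = 0 only (1, 0) up to
    sign remains, where equality holds. *)
Lemma bnd_facet f g a b al be : Markov f -> Tan f g -> Strip f (hl f 1 0) a b ->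
  STan (hl f 1 0) a b g (hl f 1 0) al be -> al <= ln a -> be <= ln b -> Bnd f g 1.
Proof.
  intros Hf Hg HS HT Hal Hbe.
  assert (Hpos : forall m k, (0 < k)%Z -> prim m k -> dhl f g m k <= 1 * hl f m k).
  { intros m k Hk Hp. rewrite Rmult_1_l, <- (Rminus_0_r (hl f m k)), <- (Rmult_0_l (IZR k)).
    apply (stretch_bound f g (hl f 1 0) a b al be 0); try assumption; try lra.
    generalize (ln_sinh_lt _ (hl_pos f _ _ Hf prim_10)). lra. }
  destruct Hf as (Ht & Hf'). pose proof Ht as (He & _). destruct Hg as ((He' & Hg1) & Hg').
  intros m k Hp.
  destruct (Z.lt_total k 0) as [H|[->|H]].
  - rewrite <- (hl_even f), <- (dhl_even f) by assumption.
    apply Hpos; [lia|now apply prim_opp].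
  - assert (E : dhl f g 1 0 = hl f 1 0) by (apply (stan_dhl f g _ a b _ al be (conj Ht Hf') eq_refl HT)).
    destruct (prim_m_0 m Hp) as [-> | ->].
    + rewrite E. lra.
    + change (dhl f g (- (1)) (- 0) <= 1 * hl f (- (1)) (- 0)).
      rewrite (hl_even f), (dhl_even f), E by (assumption || reflexivity). lra.
  - now apply Hpos.
Qed.

(** Inside the facet there is a positive slack c, paid once for each of the |k| crossings with (1,
    0). Thus (1, 0) is the only curve attaining the norm there, which will make the matching of
    curves injective. *)
Lemma facet_strict f g a b al be : Markov f -> Tan f g -> Strip f (hl f 1 0) a b ->
  STan (hl f 1 0) a b g (hl f 1 0) al be -> al < ln a -> be < ln b ->
  forall m k, prim m k -> k <> 0%Z -> dhl f g m k < hl f m k.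
Proof.
  intros Hf Hg HS HT Hal Hbe.
  set (c := Rmin (Rmin (ln a - al) (ln b - be)) (hl f 1 0 * cosh (hl f 1 0) / sinh (hl f 1 0) - ln (sinh (hl f 1 0)))).
  assert (Hl := ln_sinh_lt _ (hl_pos f _ _ Hf prim_10)).
  assert (Hc : 0 < c).
  { unfold c. apply Rmin_glb_lt; [apply Rmin_glb_lt|]; lra. }
  assert (Hc1 : c <= ln a - al) by (unfold c; eapply Rle_trans; [apply Rmin_l|apply Rmin_l]).
  assert (Hc2 : c <= ln b - be) by (unfold c; eapply Rle_trans; [apply Rmin_l|apply Rmin_r]).
  assert (Hc3 := Rmin_r (Rmin (ln a - al) (ln b - be)) (hl f 1 0 * cosh (hl f 1 0) / sinh (hl f 1 0) - ln (sinh (hl f 1 0)))).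
  fold c in Hc3.
  assert (Hpos : forall m k, (0 < k)%Z -> prim m k -> dhl f g m k < hl f m k).
  { intros m k Hk Hp.
    assert (B := stretch_bound f g (hl f 1 0) a b al be c Hf Hg HS HT ltac:(lra) ltac:(lra) ltac:(lra) Hc3 m k Hk Hp).
    apply IZR_lt in Hk. nra. }
  destruct Hf as (Ht & Hf'). pose proof Ht as (He & _). destruct Hg as ((He' & Hg1) & Hg').
  intros m k Hp Hk. destruct (Z.lt_total k 0) as [H|[H|H]]; [|lia|now apply Hpos].
  rewrite <- (hl_even f), <- (dhl_even f) by assumption.
  apply Hpos; [lia|now apply prim_opp].
Qed.

(* The length, in the coordinate al, of the facet of the unit sphere where the norm is attained by (1, 0);
   it depends on the length 2p of that curve only. *)
Definition Theta (p : R) : R := 2 * ln (cosh p / sinh p) + 2 * p / (sinh p * cosh p).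

Lemma strip_ln f p a b : Strip f p a b -> ln a + ln b = 2 * ln (cosh p / sinh p).
Proof.
  intros (Hp & Ha & Hb & _ & _ & _ & E). assert (Hs := sinh_pos p Hp). assert (Hc := cosh_ge_1 p).
  rewrite <- ln_mult by assumption.
  assert (P : 0 < cosh p / sinh p) by (apply Rdiv_lt_0_compat; lra).
  replace (2 * ln (cosh p / sinh p)) with (ln (cosh p / sinh p) + ln (cosh p / sinh p)) by ring.
  rewrite <- ln_mult by exact P. f_equal.
  apply (Rmult_eq_reg_r (sinh p * sinh p)); [|nra]. rewrite E. field. lra.
Qed.

Lemma Theta_pos p : 0 < p -> 0 < Theta p.
Proof.
  intros Hp. unfold Theta. assert (Hs := sinh_pos p Hp). assert (Hc := cosh_ge_1 p).
  assert (0 < ln (cosh p / sinh p)).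
  { rewrite <- ln_1. apply ln_increasing; [lra|]. apply (Rmult_lt_reg_r (sinh p)); [exact Hs|].
    unfold Rdiv. rewrite Rmult_assoc, Rinv_l by lra. generalize (exp_pos (- p)). rewrite exp_neg_cosh_sinh. lra. }
  assert (0 < 2 * p / (sinh p * cosh p)) by (apply Rdiv_lt_0_compat; nra). lra.
Qed.

Lemma stan_be p a b g dp al be : 0 < p -> STan p a b g dp al be ->
  be = - (2 * dp / (sinh p * cosh p)) - al.
Proof.
  intros Hp (_ & _ & _ & E). assert (Hs := sinh_pos p Hp). assert (Hc := cosh_ge_1 p).
  apply (Rmult_eq_reg_r (sinh p * cosh p)); [|nra].
  transitivity (- 2 * dp - al * (sinh p * cosh p)); [lra|]. field. lra.
Qed.

(** Turns the pair of conditions al <= ln a, be <= ln b into one interval for al of length Theta. *)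
Lemma strip_be f p a b g al be : Strip f p a b -> STan p a b g p al be ->
  be - ln b = ln a - Theta p - al.
Proof.
  intros HS HT. pose proof (strip_ln f p a b HS). pose proof HS as (Hp & _).
  rewrite (stan_be p a b g p al be Hp HT). unfold Theta. lra.
Qed.

Lemma strip_nat f p a b n : TraceFn f -> Strip f p a b ->
  f (Z.of_nat n) 1%Z = a * exp (INR n * p) + b * exp (- (INR n * p)).
Proof.
  intros [He Hr] (Hp & Ha & Hb & Ex & Ey & Ez & _).
  enough (H : f (Z.of_nat n) 1%Z = a * exp (INR n * p) + b * exp (- (INR n * p)) /\
    f (Z.of_nat (S n)) 1%Z = a * exp (INR (S n) * p) + b * exp (- (INR (S n) * p))) by tauto.
  induction n as [|n [IH1 IH2]].
  - split.
    + simpl. rewrite Rmult_0_l, Ropp_0, exp_0, Ey. ring.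
    + change (Z.of_nat 1) with 1%Z. simpl INR. rewrite Rmult_1_l. exact Ez.
  - split; [exact IH2|].
    generalize (Hr 1 0 (Z.of_nat (S n)) 1 ltac:(lia))%Z.
    replace (1 + Z.of_nat (S n))%Z with (Z.of_nat (S (S n))) by lia.
    change (0 + 1)%Z with 1%Z.
    replace (1 - Z.of_nat (S n))%Z with (- Z.of_nat n)%Z by lia. change (0 - 1)%Z with (- (1))%Z.
    rewrite He by (unfold prim; now rewrite Z.gcd_1_r). rewrite IH1, IH2, Ex. intros E.
    replace (INR (S (S n)) * p) with (INR (S n) * p + p) by (rewrite !S_INR; ring).
    replace (INR n * p) with (INR (S n) * p + - p) in E by (rewrite !S_INR; ring).
    rewrite !Ropp_plus_distr, !exp_plus in *. rewrite Ropp_involutive in E. unfold cosh in E. lra.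
Qed.

Lemma stan_nat f p a b g dp al be n : TraceFn f -> DTraceFn f g -> Strip f p a b -> STan p a b g dp al be ->
  g (Z.of_nat n) 1%Z = (al + INR n * dp) * (a * exp (INR n * p)) + (be - INR n * dp) * (b * exp (- (INR n * p))).
Proof.
  intros Ht [He Hr] HS (G1 & G2 & G3 & _).
  pose proof HS as (Hp & Ha & Hb & Ex & _).
  enough (H : g (Z.of_nat n) 1%Z = (al + INR n * dp) * (a * exp (INR n * p)) + (be - INR n * dp) * (b * exp (- (INR n * p))) /\
    g (Z.of_nat (S n)) 1%Z = (al + INR (S n) * dp) * (a * exp (INR (S n) * p)) + (be - INR (S n) * dp) * (b * exp (- (INR (S n) * p)))) by tauto.
  induction n as [|n [IH1 IH2]].
  - split.
    + simpl. rewrite !Rmult_0_l, Ropp_0, exp_0, G2. ring.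
    + change (Z.of_nat 1) with 1%Z. simpl INR. rewrite !Rmult_1_l. exact G3.
  - split; [exact IH2|].
    generalize (Hr 1 0 (Z.of_nat (S n)) 1 ltac:(lia))%Z.
    replace (1 + Z.of_nat (S n))%Z with (Z.of_nat (S (S n))) by lia.
    change (0 + 1)%Z with 1%Z.
    replace (1 - Z.of_nat (S n))%Z with (- Z.of_nat n)%Z by lia. change (0 - 1)%Z with (- (1))%Z.
    rewrite He by (unfold prim; now rewrite Z.gcd_1_r). rewrite IH1, IH2, Ex, G1, (strip_nat f p a b) by assumption.
    intros E.
    replace (INR (S (S n)) * p) with (INR (S n) * p + p) by (rewrite !S_INR; ring).
    replace (INR (S (S n)) * dp) with (INR (S n) * dp + dp) by (rewrite !S_INR; ring).
    replace (INR n * p) with (INR (S n) * p + - p) in E by (rewrite !S_INR; ring).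
    replace (INR n * dp) with (INR (S n) * dp + - dp) in E by (rewrite !S_INR; ring).
    rewrite !Ropp_plus_distr, !exp_plus in *. rewrite Ropp_involutive in E. unfold cosh, sinh in E. lra.
Qed.

(** * Estimates along the strip *)

Section Heights.

(* P = n p + ln a is the asymptotic value of the half length q of the curve (n, 1). *)
Variables P C2 q : R.
Hypothesis HP : 1 <= P.
Hypothesis HC : 1 < C2.
Hypothesis Hq : 0 < q.
Hypothesis HT : 2 * cosh q = exp P + C2 * exp (- P).
Let x := C2 * (exp (- P) * exp (- P)).

Lemma exp_w : C2 * exp (- P) = x * exp P.
Proof.
  unfold x. transitivity (C2 * exp (- P) * (exp P * exp (- P))); [rewrite exp_neg|]; ring.
Qed.

Lemma height_ge : P <= q.
Proof.
  apply cosh_le_inv; [lra|lra|]. unfold cosh at 1. generalize (exp_pos (- P)). nra.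
Qed.

Lemma height_le : q <= P + x.
Proof.
  apply Rnot_lt_le. intros Hc. apply exp_increasing in Hc. revert Hc. apply Rle_not_lt.
  rewrite exp_plus. assert (exp q <= 2 * cosh q) by (unfold cosh; generalize (exp_pos (- q)); lra).
  rewrite HT, exp_w in H. generalize (exp_ineq1_le x) (exp_pos P). nra.
Qed.

Lemma two_sinh_le : 2 * sinh q <= exp P * (1 + x).
Proof.
  assert (2 * sinh q <= 2 * cosh q) by (generalize (exp_pos (- q)); rewrite exp_neg_cosh_sinh; lra).
  rewrite HT, exp_w in H. lra.
Qed.

(** The left side is 2 sinh P, written so as to show the gain (C2 - 1) exp(-P) over the factor exp P
    - C2 exp(-P) that multiplies the derivative of P in the derivative of the trace. *)
Lemma two_sinh_ge : exp P - C2 * exp (- P) + (C2 - 1) * exp (- P) <= 2 * sinh q.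
Proof.
  assert (Hs := sinh_pos q Hq).
  assert (E : (2 * sinh q) * (2 * sinh q) = (exp P - C2 * exp (- P)) * (exp P - C2 * exp (- P)) + 4 * (C2 - 1)).
  { transitivity ((2 * cosh q) * (2 * cosh q) - 4); [generalize (cosh_sinh_sq q); lra|].
    rewrite HT. generalize (exp_neg P). nra. }
  assert (En := exp_neg P). assert (Pw := exp_pos (- P)).
  set (D := exp P) in *. set (w := exp (- P)) in *.
  apply Rnot_lt_le. intros Hc.
  assert (H1 : 2 * sinh q * (2 * sinh q) < (D - w) * (D - w)) by nra.
  assert (H2 : (D - w) * (D - w) = D * D - 2 * (D * w) + w * w) by ring.
  assert (H3 : (D - C2 * w) * (D - C2 * w) = D * D - 2 * C2 * (D * w) + C2 * C2 * (w * w)) by ring.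
  rewrite E, H2, H3, En in H1.
  assert (H4 : 1 * (w * w) <= C2 * C2 * (w * w)) by (apply Rmult_le_compat_r; nra).
  lra.
Qed.

(** The equation is the derivative of the trace when P moves with speed P + tau and C2 with speed
    -K. The excess of dq over q is then tau up to an error of order P exp(-2P). *)
Lemma lower_estimate tau K dq : 0 <= tau -> 0 <= K -> x <= / 4 -> K * (exp (- P) * exp (- P)) <= / 2 ->
  2 * sinh q * dq = (exp P - C2 * exp (- P)) * (P + tau) - K * exp (- P) ->
  tau * (1 - 2 * x) - (2 * x * P + K * (exp (- P) * exp (- P)) + x) <= dq - q.
Proof.
  intros Htau HK Hx HKw E. rewrite exp_w in E.
  assert (Ew : exp (- P) = exp (- P) * exp (- P) * exp P)
    by (transitivity (exp (- P) * (exp P * exp (- P))); [rewrite exp_neg|]; ring).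
  rewrite Ew in E. set (w2 := exp (- P) * exp (- P)) in *.
  assert (Hx0 : 0 < x).
  { unfold x. repeat apply Rmult_lt_0_compat; try apply exp_pos. lra. }
  assert (PD := exp_pos P). set (D := exp P) in *.
  assert (Hs := sinh_pos q Hq).
  assert (E2 : 2 * sinh q * dq = D * ((1 - x) * (P + tau) - K * w2)) by lra.
  assert (Hn : 0 <= (1 - x) * (P + tau) - K * w2).
  { assert (3 / 4 * 1 <= (1 - x) * (P + tau)) by (apply Rmult_le_compat; lra). lra. }
  assert (Hdq : 0 <= dq).
  { apply (Rmult_le_reg_l (2 * sinh q)); [lra|]. rewrite E2, Rmult_0_r. apply Rmult_le_pos; lra. }
  assert (B : D * ((1 - x) * (P + tau) - K * w2) <= D * ((1 + x) * dq)).
  { rewrite <- E2. rewrite <- Rmult_assoc. apply Rmult_le_compat_r; [exact Hdq|exact two_sinh_le]. }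
  apply Rmult_le_reg_l in B; [|exact PD].
  assert (Kw0 : 0 <= K * w2) by (apply Rmult_le_pos; [exact HK|apply Rmult_le_pos; left; apply exp_pos]).
  assert (B2 : (1 - 2 * x) * (P + tau) - K * w2 <= dq).
  { apply (Rmult_le_reg_l (1 + x)); [lra|].
    apply (Rle_trans _ ((1 - x) * (P + tau) - K * w2)); [|exact B].
    assert (0 <= (x * x) * (P + tau)) by (apply Rmult_le_pos; [apply Rmult_le_pos; lra|lra]).
    assert (0 <= x * (K * w2)) by (apply Rmult_le_pos; lra). lra. }
  generalize height_le. lra.
Qed.

(** Here the curve attains the norm, so its half length q moves with speed q, while P moves with
    speed [Pd] and C2 with speed -K (1 - eps). Such a vector lies beyond the facet by at least the
    order P exp(-2P), up to the term K eps. *)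
Lemma upper_estimate Pd K eps : 0 <= eps -> 0 <= K -> x <= / 4 -> 
  2 * sinh q * q = (exp P - C2 * exp (- P)) * Pd - K * (1 - eps) * exp (- P) ->
  P * (C2 - 1) * (exp (- P) * exp (- P)) - K * eps <= Pd - P.
Proof.
  intros He HK Hx E.
  assert (B1 : (exp P - C2 * exp (- P) + (C2 - 1) * exp (- P)) * P <= 2 * sinh q * q).
  { generalize two_sinh_ge height_ge (sinh_pos q Hq). intros.
    apply (Rle_trans _ (2 * sinh q * P)); [apply Rmult_le_compat_r; lra|apply Rmult_le_compat_l; lra]. }
  rewrite E in B1.
  assert (PD := exp_pos P). assert (Pw := exp_pos (- P)). assert (En := exp_neg P).
  assert (Hxw := exp_w).
  set (D := exp P) in *. set (w := exp (- P)) in *.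
  assert (B2 : P * (C2 - 1) * w - K * eps * w <= (D - C2 * w) * (Pd - P)).
  { assert (0 <= K * w) by (apply Rmult_le_pos; lra). lra. }
  assert (Hww : 0 < w * w) by (now apply Rmult_lt_0_compat).
  assert (W2 : 1 * (w * w) <= C2 * (w * w)) by (apply Rmult_le_compat_r; lra).
  change (C2 * (w * w) <= / 4) in Hx.
  assert (HD1 : 1 + P <= D) by apply exp_ineq1_le.
  assert (HC2w : 0 <= C2 * w <= / 4 * D).
  { split; [apply Rmult_le_pos; lra|]. rewrite Hxw. unfold x. apply Rmult_le_compat_r; lra. }
  apply Rnot_lt_le. intros Hc.
  assert (HPC : 0 <= P * (C2 - 1)) by (apply Rmult_le_pos; lra).
  assert (A1 : (D - C2 * w) * (P * (C2 - 1) * (w * w)) <= P * (C2 - 1) * w).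
  { apply (Rle_trans _ (D * (P * (C2 - 1) * (w * w)))); [apply Rmult_le_compat_r; [apply Rmult_le_pos; lra|lra]|].
    right. transitivity (D * w * (P * (C2 - 1) * w)); [ring|]. rewrite En. ring. }
  assert (HKe : 0 <= K * eps) by (apply Rmult_le_pos; lra).
  assert (Hw1 : w <= 1) by (apply Rnot_lt_le; intros Hw1; assert (1 * 1 < w * w) by (apply Rmult_le_0_lt_compat; lra); lra).
  assert (A2 : K * eps * w <= (D - C2 * w) * (K * eps)).
  { rewrite (Rmult_comm (D - C2 * w)). apply Rmult_le_compat_l; [exact HKe|]. lra. }
  assert (A3 : (D - C2 * w) * (Pd - P) < (D - C2 * w) * (P * (C2 - 1) * (w * w) - K * eps))
    by (apply Rmult_lt_compat_l; lra).
  lra.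
Qed.

End Heights.

(** * The norm beyond the end of a facet *)

Lemma tan_pull a b c d f g1 : unimod a b c d -> Tan (cob a b c d f) g1 ->
  exists g, Tan f g /\ forall p q, cob a b c d g p q = g1 p q.
Proof.
  intros Hu Hg. destruct (unimod_inv a b c d Hu) as (a' & b' & c' & d' & Hu' & HM).
  exists (cob a' b' c' d' g1). split.
  - apply (tan_eqp (cob a' b' c' d' (cob a b c d f)) _ (cob a' b' c' d' g1)).
    + intros p q _. unfold cob. destruct (HM p q) as (E1 & E2 & _). now rewrite E1, E2.
    + intros p q _. reflexivity.
    + now apply tan_cob.
  - intros p q. unfold cob. destruct (HM p q) as (_ & _ & E1 & E2). now rewrite E1, E2.
Qed.

Lemma cob_10 a b c d f : cob a b c d f 1 0 = f a c.
Proof. unfold cob. f_equal; ring. Qed.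

Lemma facet_end_exists f a b : Markov f -> Strip f (hl f 1 0) a b ->
  exists g be, Tan f g /\ STan (hl f 1 0) a b g (hl f 1 0) (ln a) be.
Proof.
  intros Hf HS. set (p := hl f 1 0) in *. assert (Hp := hl_pos f _ _ Hf prim_10). fold p in Hp.
  assert (Hs := sinh_pos p Hp). assert (Hc := cosh_ge_1 p).
  destruct (stan_realize f p a b p (ln a) (- (2 * p / (sinh p * cosh p)) - ln a) Hf HS) as (g & Hg & HT).
  - field. lra.
  - eauto.
Qed.

Lemma facet_end_bnd f a b g be : Markov f -> Tan f g -> Strip f (hl f 1 0) a b ->
  STan (hl f 1 0) a b g (hl f 1 0) (ln a) be -> Bnd f g 1.
Proof.
  intros Hf Hg HS HT. apply (bnd_facet f g a b (ln a) be); try assumption; [lra|].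
  generalize (strip_be _ _ _ _ _ _ _ HS HT) (Theta_pos _ (hl_pos f _ _ Hf prim_10)). lra.
Qed.

Lemma stretch_exists f m k : Markov f -> prim m k ->
  exists y, Tan f y /\ Bnd f y 1 /\ dhl f y m k = hl f m k.
Proof.
  intros Hf Hp. destruct (unimod_to m k Hp) as (r & s & Hu).
  set (f1 := cob m r k s f). assert (Hf1 : Markov f1) by now apply markov_cob.
  destruct (strip_exists f1 Hf1) as (a & b & HS).
  destruct (facet_end_exists f1 a b Hf1 HS) as (g1 & be & Hg1 & HT).
  pose proof (facet_end_bnd f1 a b g1 be Hf1 Hg1 HS HT) as HB.
  pose proof (stan_dhl f1 g1 _ a b _ _ _ Hf1 eq_refl HT) as HD.
  destruct (tan_pull m r k s f g1 Hu Hg1) as (y & Hy & E).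
  exists y. split; [exact Hy|]. split.
  - apply (bnd_cob m r k s f y 1 Hu). apply (bnd_eqp _ g1); [|exact HB].
    intros p q _. symmetry. apply E.
  - unfold dhl, hl in *. rewrite <- E in HD. unfold f1 in HD. rewrite !cob_10 in HD. exact HD.
Qed.

Lemma strip_gt_1 f p a b : Strip f p a b -> 1 < a * b.
Proof.
  intros (Hp & Ha & Hb & _ & _ & _ & E). assert (Hs := sinh_pos p Hp).
  generalize (cosh_sinh_sq p). intros Hcs. rewrite Hcs in E.
  apply Rnot_le_lt. intros H. assert (0 < sinh p * sinh p) by nra.
  assert (a * b * (sinh p * sinh p) <= 1 * (sinh p * sinh p)) by (apply Rmult_le_compat_r; lra). lra.
Qed.

(** With the dominant term normalized to exp P, the trace depends on n only through P, and on the
    surface only through ab. *)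
Lemma strip_height f p a b n : TraceFn f -> Strip f p a b ->
  let P := INR n * p + ln a in
  f (Z.of_nat n) 1%Z = exp P + a * b * exp (- P).
Proof.
  intros Ht HS P. rewrite (strip_nat f p a b n Ht HS). destruct HS as (_ & Ha & _).
  unfold P. rewrite Ropp_plus_distr, !exp_plus, exp_Ropp with (x := ln a), exp_ln by exact Ha. field. lra.
Qed.

Lemma stan_height f p a b g dp al be n : TraceFn f -> DTraceFn f g -> Strip f p a b ->
  STan p a b g dp al be ->
  let P := INR n * p + ln a in
  g (Z.of_nat n) 1%Z =
  (exp P - a * b * exp (- P)) * (INR n * dp + al) - 2 * dp / (sinh p * cosh p) * (a * b) * exp (- P).
Proof.
  intros Ht Hd HS HT P. rewrite (stan_nat f p a b g dp al be n) by assumption.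
  pose proof HS as (Hp & Ha & _). rewrite (stan_be p a b g dp al be Hp HT).
  assert (Hs := sinh_pos p Hp). assert (Hc := cosh_ge_1 p).
  unfold P. rewrite Ropp_plus_distr, !exp_plus, exp_Ropp with (x := ln a), exp_ln by exact Ha. field. lra.
Qed.

Lemma prim_n_1 n : prim n 1.
Proof. unfold prim. apply Z.gcd_1_r. Qed.

(* - Kst is the derivative of C2 = a b along a tangent vector with dp = p. *)
Definition Kst (p C2 : R) : R := 2 * p * C2 / (sinh p * cosh p).

Lemma Kst_pos p C2 : 0 < p -> 0 < C2 -> 0 < Kst p C2.
Proof.
  intros Hp HC. assert (Hs := sinh_pos p Hp). assert (Hc := cosh_ge_1 p).
  apply Rdiv_lt_0_compat; [|nra]. apply Rmult_lt_0_compat; lra.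
Qed.

(** Convexity: g is a combination of the facet end z and a vector y of the unit ball at which (n, 1)
    attains the norm. The coefficients add up to 1 + bt eps, which bounds the norm; the upper bound
    on tau keeps both of them nonnegative. *)
Lemma facet_upper f a b n g tau be : Markov f -> Tan f g -> Strip f (hl f 1 0) a b ->
  STan (hl f 1 0) a b g (hl f 1 0) (ln a + tau) be ->
  let P := INR n * hl f 1 0 + ln a in
  let w2 := exp (- P) * exp (- P) in
  1 <= P -> a * b * w2 <= / 4 -> Kst (hl f 1 0) (a * b) < P ->
  0 < tau -> tau <= P * (a * b - 1) * w2 ->
  Bnd f g (1 + tau / (P - Kst (hl f 1 0) (a * b))).
Proof.
  intros Hf Hg HS HT P w2 HP Hw HK Htau Htau2.
  destruct (stretch_exists f (Z.of_nat n) 1 Hf (prim_n_1 _)) as (y & Hy & By & Ey).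
  set (p := hl f 1 0) in *. assert (Hp := hl_pos f _ _ Hf prim_10). fold p in Hp.
  destruct (stan_exists f p a b y HS Hy) as (dp & al & be' & HTy).
  destruct (facet_end_exists f a b Hf HS) as (z & bz & Hz & HTz). fold p in HTz.
  pose proof (facet_end_bnd f a b z bz Hf Hz HS HTz) as Bz.
  assert (HC2 := strip_gt_1 f p a b HS).
  assert (HKp := Kst_pos p (a * b) Hp ltac:(lra)).
  set (K := Kst p (a * b)) in *.
  assert (Hdp : dp <= p).
  { rewrite <- (stan_dhl f y p a b dp al be' Hf eq_refl HTy). unfold p. 
    generalize (By 1 0 prim_10)%Z. lra. }
  (* [eps] is the relative amount by which y fails to stretch (1, 0) maximally. *)
  pose (eps := 1 - dp / p). assert (Edp : dp = p * (1 - eps)) by (unfold eps; field; lra).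
  assert (Heps : 0 <= eps) by nra.
  set (q := hl f (Z.of_nat n) 1) in *.
  assert (Hq : 0 < q) by (apply hl_pos; [exact Hf|apply prim_n_1]).
  assert (HT1 : 2 * cosh q = exp P + a * b * exp (- P)).
  { unfold q. rewrite <- hl_cosh by (try apply prim_n_1; assumption). apply strip_height; [apply Hf|exact HS]. }
  assert (HG : 2 * sinh q * q = (exp P - a * b * exp (- P)) * (INR n * dp + al) - K * (1 - eps) * exp (- P)).
  { transitivity (y (Z.of_nat n) 1%Z).
    - rewrite (dhl_sinh f y) by (try apply prim_n_1; assumption). rewrite Ey. reflexivity.
    - rewrite (stan_height f p a b y dp al be' n) by (apply Hf || apply Hy || assumption). fold P.
      unfold K, Kst. rewrite Edp. 
      assert (Hs := sinh_pos p Hp). assert (Hc := cosh_ge_1 p). field. lra. }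
  pose proof (upper_estimate P (a * b) q HP HC2 Hq HT1 (INR n * dp + al) K eps Heps ltac:(lra) Hw HG) as HU.
  fold w2 in HU.
  assert (Hw2 : 0 < w2) by (unfold w2; apply Rmult_lt_0_compat; apply exp_pos).
  assert (E1 : INR n * dp + al - P = al - ln a - eps * (INR n * p)) by (unfold P; rewrite Edp; ring).
  assert (HPK : 0 < P - K) by lra.
  (* The conditions at_ p + bt dp = p and at_ ln a + bt al = ln a + tau reduce to bt den = tau. *)
  pose (den := al - ln a + eps * ln a).
  assert (HA : P * (a * b - 1) * w2 + eps * (P - K) <= den).
  { unfold den. assert (eps * P = eps * (INR n * p) + eps * ln a) by (unfold P; ring). lra. }
  assert (HA0 : 0 <= eps * (P - K)) by (apply Rmult_le_pos; lra).
  assert (Hden : 0 < den) by (assert (0 < P * (a * b - 1) * w2) by (apply Rmult_lt_0_compat; [apply Rmult_lt_0_compat; lra|lra]); lra).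
  pose (bt := tau / den).
  assert (Hbt0 : 0 < bt) by (unfold bt; now apply Rdiv_lt_0_compat).
  assert (Ebt : bt * den = tau) by (unfold bt; field; lra).
  assert (Hbt1 : bt <= 1) by (apply (Rmult_le_reg_r den); [exact Hden|lra]).
  assert (Hbe : bt * eps <= tau / (P - K)).
  { apply (Rmult_le_reg_r (P - K)); [exact HPK|]. 
    replace (tau / (P - K) * (P - K)) with tau by (field; lra).
    rewrite <- Ebt, Rmult_assoc. apply Rmult_le_compat_l; [lra|].
    assert (0 < P * (a * b - 1) * w2) by (apply Rmult_lt_0_compat; [apply Rmult_lt_0_compat; lra|lra]). lra. }
  pose (at_ := 1 - bt * (1 - eps)).
  assert (Hat : 0 <= at_).
  { unfold at_. destruct (Rle_dec eps 1); nra. }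
  assert (EQ : eqp g (lc at_ bt z y)).
  { pose proof (stan_lc p a b z y p (ln a) bz dp al be' at_ bt HTz HTy) as HTl.
    assert (D : at_ * p + bt * dp = p) by (unfold at_; rewrite Edp; ring).
    assert (A : at_ * ln a + bt * al = ln a + tau).
    { rewrite <- Ebt. unfold at_, den. ring. }
    rewrite D, A in HTl.
    assert (Tl : Tan f (lc at_ bt z y)) by now apply tan_lc.
    assert (B : at_ * bz + bt * be' = be).
    { rewrite (stan_be p a b _ p (ln a + tau) _ Hp HTl). symmetry. apply (stan_be p a b g p _ _ Hp HT). }
    rewrite B in HTl. apply (stan_unique f p a b g _ p (ln a + tau) be); assumption. }
  intros r s Hrs. rewrite (dhl_eqp f g (lc at_ bt z y)) by assumption. rewrite dhl_lc.
  specialize (Bz r s Hrs). specialize (By r s Hrs). pose proof (hl_pos f r s Hf Hrs) as Hh.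
  apply (Rle_trans _ ((at_ + bt) * hl f r s)).
  - rewrite Rmult_plus_distr_r. apply Rplus_le_compat; apply Rmult_le_compat_l; lra.
  - apply Rmult_le_compat_r; [lra|]. unfold at_. lra.
Qed.

(** The single curve (n, 1) serves as a test curve for the norm; the bound on its half length is
    needed to pass to the ratio. *)
Lemma facet_lower f a b n g tau be : Markov f -> Tan f g -> Strip f (hl f 1 0) a b ->
  STan (hl f 1 0) a b g (hl f 1 0) (ln a + tau) be ->
  let P := INR n * hl f 1 0 + ln a in
  let w2 := exp (- P) * exp (- P) in
  1 <= P -> a * b * w2 <= / 4 -> Kst (hl f 1 0) (a * b) * w2 <= / 2 -> 0 <= tau ->
  tau * (1 - 2 * (a * b * w2)) - (2 * (a * b * w2) * P + Kst (hl f 1 0) (a * b) * w2 + a * b * w2) <=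
  dhl f g (Z.of_nat n) 1 - hl f (Z.of_nat n) 1 /\ hl f (Z.of_nat n) 1 <= P + 1.
Proof.
  intros Hf Hg HS HT P w2 HP Hw HK Htau.
  set (p := hl f 1 0) in *. assert (Hp := hl_pos f _ _ Hf prim_10). fold p in Hp.
  assert (HC2 := strip_gt_1 f p a b HS).
  assert (HKp := Kst_pos p (a * b) Hp ltac:(lra)).
  set (K := Kst p (a * b)) in *.
  set (q := hl f (Z.of_nat n) 1) in *.
  assert (Hq : 0 < q) by (apply hl_pos; [exact Hf|apply prim_n_1]).
  assert (HT1 : 2 * cosh q = exp P + a * b * exp (- P)).
  { unfold q. rewrite <- hl_cosh by (try apply prim_n_1; assumption). apply strip_height; [apply Hf|exact HS]. }
  split.
  - apply (lower_estimate P (a * b) q HP HC2 Hq HT1 tau K); try assumption; [lra|].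
    unfold q. rewrite <- dhl_sinh by (try apply prim_n_1; assumption).
    rewrite (stan_height f p a b g p (ln a + tau) be n) by (apply Hf || apply Hg || assumption). fold P.
    unfold K, Kst. assert (Hs := sinh_pos p Hp). assert (Hc := cosh_ge_1 p).
    replace (P + tau) with (INR n * p + (ln a + tau)) by (unfold P; ring). field. lra.
  - generalize (height_le P (a * b) q HT1). fold w2. lra.
Qed.

Lemma grid_point p l x : 0 < p -> l <= x -> exists m : nat, x <= INR m * p + l <= x + p.
Proof.
  intros Hp Hx. destruct (nfloor_ex ((x - l) / p)) as (n & H1 & H2).
  { apply Rmult_le_pos; [lra|left; now apply Rinv_0_lt_compat]. }
  exists (S n). rewrite S_INR.
  apply (Rmult_le_compat_r p) in H1; [|lra]. apply (Rmult_lt_compat_r p) in H2; [|exact Hp].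
  replace ((x - l) / p * p) with (x - l) in H1, H2 by (field; lra). lra.
Qed.

Lemma exp_neg_sq_le P : 0 < P -> exp (- P) * exp (- P) <= / (2 * P).
Proof.
  intros HP. rewrite <- exp_plus.
  replace (- P + - P) with (- (2 * P)) by ring.
  generalize (x_exp_neg_le_1 (2 * P)). intros H.
  apply (Rmult_le_reg_l (2 * P)); [lra|]. rewrite Rinv_r by lra. exact H.
Qed.

Lemma ln_le_sqrt s : 0 < s -> ln s <= 2 * sqrt s.
Proof.
  intros Hs. assert (Hq := sqrt_lt_R0 s Hs). rewrite <- (sqrt_sqrt s) at 1 by lra.
  rewrite ln_mult by exact Hq.
  assert (ln (sqrt s) <= sqrt s); [|lra].
  rewrite <- (ln_exp (sqrt s)) at 2. apply ln_le; [exact Hq|]. generalize (exp_ineq1_le (sqrt s)). lra.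
Qed.

(* Comparing the two estimates at heights s and s + ln s gives Th <= Th' in the limit. *)
Lemma growth_comparison Th Th' A B p : 0 < Th -> 0 < Th' -> 0 <= A -> 0 < B -> 0 < p ->
  (forall S, exists s P, S <= s /\ s <= P /\ P <= s + ln s + p /\
     (Th - A / s) * (s - B) <= Th' * (P + 1)) -> Th <= Th'.
Proof.
  intros HTh HTh' HA HB Hp H. apply Rnot_lt_le. intros Hc.
  set (D := Th' * (2 + p + 1) + A + Th * B).
  assert (HD : 0 < D).
  { unfold D. assert (0 < Th' * (2 + p + 1)) by (apply Rmult_lt_0_compat; lra).
    assert (0 < Th * B) by (now apply Rmult_lt_0_compat). lra. }
  set (S := Rmax 1 (D / (Th - Th') * (D / (Th - Th')) + 1)).
  destruct (H S) as (s & P & Hs & HsP & HP & HI).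
  assert (H1 : 1 <= s) by (eapply Rle_trans; [apply Rmax_l|exact Hs]).
  assert (H2 : D / (Th - Th') * (D / (Th - Th')) + 1 <= s) by (eapply Rle_trans; [apply Rmax_r|exact Hs]).
  assert (Hln := ln_le_sqrt s ltac:(lra)).
  assert (Hss := sqrt_sqrt s ltac:(lra)). assert (Hs0 := sqrt_pos s). set (r := sqrt s) in *.
  assert (Hr : 1 <= r) by nra.
  assert (E : (Th - A / s) * (s - B) = Th * s - A - Th * B + A * B / s) by (field; lra).
  assert (0 <= A * B / s) by (apply Rmult_le_pos; [nra|left; apply Rinv_0_lt_compat; lra]).
  assert (H3 : Th' * (P + 1) <= Th' * (s + 2 * r + p + 1)) by (apply Rmult_le_compat_l; lra).
  assert (H4 : Th' * (2 * r + p + 1) <= Th' * ((2 + p + 1) * r)) by (apply Rmult_le_compat_l; nra).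
  assert (H5 : A + Th * B <= (A + Th * B) * r).
  { assert (0 <= A + Th * B) by nra. nra. }
  assert (H6 : (Th - Th') * s <= D * r) by (unfold D; lra).
  assert (H7 : (Th - Th') * r <= D).
  { apply (Rmult_le_reg_r r); [lra|]. rewrite Rmult_assoc, Hss. exact H6. }
  assert (H8 : r <= D / (Th - Th')).
  { apply (Rmult_le_reg_l (Th - Th')); [lra|]. replace ((Th - Th') * (D / (Th - Th'))) with D by (field; lra). exact H7. }
  assert (r * r <= D / (Th - Th') * (D / (Th - Th'))) by (apply Rmult_le_compat; lra). lra.
Qed.

(** The vector (1 + t) gp - t gm lies beyond the facet end by t Theta, and its counterpart by t
    Theta'. Its norm is bounded above through f' by [facet_upper] at height s and below through f by
    [facet_lower] at height P about s + ln s. To first order both excesses are divided by s, so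
    Theta <= Theta' in the limit. *)
Lemma theta_le f f' a b a' b' gp gm gp' gm' bp bm bp' bm' :
  Markov f -> Markov f' -> Strip f (hl f 1 0) a b -> Strip f' (hl f' 1 0) a' b' ->
  Tan f gp -> Tan f gm -> Tan f' gp' -> Tan f' gm' ->
  STan (hl f 1 0) a b gp (hl f 1 0) (ln a) bp ->
  STan (hl f 1 0) a b gm (hl f 1 0) (ln a - Theta (hl f 1 0)) bm ->
  STan (hl f' 1 0) a' b' gp' (hl f' 1 0) (ln a') bp' ->
  STan (hl f' 1 0) a' b' gm' (hl f' 1 0) (ln a' - Theta (hl f' 1 0)) bm' ->
  (forall r s K, Bnd f' (lc r s gp' gm') K -> Bnd f (lc r s gp gm) K) ->
  Theta (hl f 1 0) <= Theta (hl f' 1 0).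
Proof.
  intros Hf Hf' HS HS' Tp Tm Tp' Tm' Sp Sm Sp' Sm' HB.
  assert (Hp := hl_pos f _ _ Hf prim_10). assert (Hp' := hl_pos f' _ _ Hf' prim_10).
  assert (HTh := Theta_pos _ Hp). assert (HTh' := Theta_pos _ Hp').
  assert (HC := strip_gt_1 _ _ _ _ HS). assert (HC' := strip_gt_1 _ _ _ _ HS').
  assert (HK := Kst_pos _ (a * b) Hp ltac:(lra)). assert (HK' := Kst_pos _ (a' * b') Hp' ltac:(lra)).
  set (p := hl f 1 0) in *. set (p' := hl f' 1 0) in *.
  set (Th := Theta p) in *. set (Th' := Theta p') in *.
  set (C := a * b) in *. set (C' := a' * b') in *. set (K := Kst p C) in *. set (K' := Kst p' C') in *.
  assert (Dir : forall u v h1 h2 q x y b1 b2 t th, STan q x y h1 q u b1 -> STan q x y h2 q (u - th) b2 -> v = u + t * th ->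
    STan q x y (lc (1 + t) (- t) h1 h2) q v ((1 + t) * b1 + - t * b2)).
  { intros u v h1 h2 q x y b1 b2 t th H1 H2 ->.
    generalize (stan_lc _ _ _ _ _ _ _ _ _ _ _ (1 + t) (- t) H1 H2).
    replace ((1 + t) * q + - t * q) with q by ring.
    now replace ((1 + t) * u + - t * (u - th)) with (u + t * th) by ring. }
  (* Collects the errors of the lower estimate after division by t: the first term comes from the
     factor 1 - 2 C w, the second from the additive error. *)
  set (A1 := Th * C + Th' * (7 * C + K) / (C' - 1)).
  assert (HA1 : 0 <= Th' * (7 * C + K) / (C' - 1)).
  { apply Rmult_le_pos; [apply Rmult_le_pos; lra|left; apply Rinv_0_lt_compat; lra]. }
  apply (growth_comparison Th Th' A1 K' p); try assumption.
  { unfold A1. assert (0 < Th * C) by (apply Rmult_lt_0_compat; lra). lra. }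
  intros S.
  destruct (grid_point p' (ln a') (Rmax S (Rmax (ln a') (Rmax (2 * C') (Rmax (K' + 1)
     (Rmax (2 * C) (Rmax (K + 1) (Rmax (ln a) (p + 1)))))))) Hp') as (n & Hn & _).
  { eapply Rle_trans; [apply Rmax_l|apply Rmax_r]. }
  set (s := INR n * p' + ln a') in *.
  assert (G : S <= s /\ 2 * C' <= s /\ K' + 1 <= s /\ 2 * C <= s /\ K + 1 <= s /\ ln a <= s /\ p + 1 <= s).
  { repeat split; (eapply Rle_trans; [|exact Hn]); repeat (rewrite Rmax_Rle); lra. }
  clear Hn. destruct G as (G1 & G2 & G3 & G4 & G5 & G6 & G7).
  assert (Hs2 : 2 <= s) by lra.
  assert (Hlns : 0 < ln s) by (rewrite <- ln_1; apply ln_increasing; lra).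
  assert (Hlns2 : ln s <= s).
  { rewrite <- (ln_exp s) at 2. apply ln_le; [lra|]. generalize (exp_ineq1_le s). lra. }
  (* The offset ln s gives exp(-2P) <= exp(-2s) / s^2, which makes the error at height P negligible
     against t, while P / s still tends to 1. *)
  destruct (grid_point p (ln a) (s + ln s) Hp ltac:(lra)) as (m & Hm1 & Hm2).
  set (P := INR m * p + ln a) in *.
  exists s, P. split; [exact G1|]. split; [lra|]. split; [exact Hm2|].
  assert (WB : forall Q C0, 1 <= Q -> 2 * C0 <= Q -> 0 <= C0 -> C0 * (exp (- Q) * exp (- Q)) <= / 4).
  { intros Q C0 H1 H2 H3. apply (Rle_trans _ (C0 * / (2 * Q))).
    - apply Rmult_le_compat_l; [exact H3|]. apply exp_neg_sq_le. lra.
    - apply (Rmult_le_reg_r (4 * Q)); [lra|]. replace (C0 * / (2 * Q) * (4 * Q)) with (2 * C0) by (field; lra).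
      replace (/ 4 * (4 * Q)) with Q by field. exact H2. }
  set (w' := exp (- s) * exp (- s)). set (w := exp (- P) * exp (- P)).
  assert (Hw'0 : 0 < w') by (apply Rmult_lt_0_compat; apply exp_pos).
  assert (Hw0 : 0 < w) by (apply Rmult_lt_0_compat; apply exp_pos).
  assert (Hww : w * (s * s) <= w').
  { unfold w, w'. 
    assert (X : exp (- P) * s <= exp (- s)).
    { apply (Rmult_le_reg_l (exp P)); [apply exp_pos|]. rewrite <- Rmult_assoc, exp_neg, Rmult_1_l.
      rewrite <- exp_plus. rewrite <- (exp_ln s) at 1 by lra.
      destruct (Rle_lt_or_eq_dec (ln s) (P + - s) ltac:(lra)) as [H|H]; [left; now apply exp_increasing|right; now rewrite H]. }
    replace (exp (- P) * exp (- P) * (s * s)) with ((exp (- P) * s) * (exp (- P) * s)) by ring.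
    assert (0 < exp (- P) * s) by (apply Rmult_lt_0_compat; [apply exp_pos|lra]).
    apply Rmult_le_compat; lra. }
  assert (Hw's : w' <= / (2 * s)) by (apply exp_neg_sq_le; lra).
  (* The largest t that [facet_upper] allows at height s. *)
  pose (t := s * (C' - 1) * w' / Th').
  assert (Htau : t * Th' = s * (C' - 1) * w') by (unfold t; field; lra).
  assert (Ht : 0 < t).
  { unfold t. apply Rdiv_lt_0_compat; [|exact HTh'].
    apply Rmult_lt_0_compat; [apply Rmult_lt_0_compat; lra|exact Hw'0]. }
  assert (U : Bnd f' (lc (1 + t) (- t) gp' gm') (1 + (t * Th') / (s - K'))).
  { apply (facet_upper f' a' b' n _ (t * Th') ((1 + t) * bp' + - t * bm') Hf' (tan_lc _ _ _ _ _ Tp' Tm') HS').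
    - now apply (Dir (ln a') (ln a' + t * Th') gp' gm' p' a' b' bp' bm' t Th').
    - change (1 <= s). lra.
    - apply (WB s C'); lra.
    - change (K' < s). lra.
    - now apply Rmult_lt_0_compat.
    - change (t * Th' <= s * (C' - 1) * w'). lra. }
  apply HB in U. specialize (U (Z.of_nat m) 1%Z (prim_n_1 _)).
  destruct (facet_lower f a b m (lc (1 + t) (- t) gp gm) (t * Th) ((1 + t) * bp + - t * bm) Hf (tan_lc _ _ _ _ _ Tp Tm) HS) as [L1 L2].
  - now apply (Dir (ln a) (ln a + t * Th) gp gm p a b bp bm t Th).
  - change (1 <= P). lra.
  - apply (WB P C); lra.
  - apply (Rle_trans _ (/ 4)); [|lra]. change (K * w <= / 4).
    apply (Rle_trans _ (K * (w' / (s * s)))).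
    + apply Rmult_le_compat_l; [lra|]. apply (Rmult_le_reg_r (s * s)); [nra|].
      replace (w' / (s * s) * (s * s)) with w' by (field; lra). exact Hww.
    + apply (Rmult_le_reg_r (s * s)); [nra|]. replace (K * (w' / (s * s)) * (s * s)) with (K * w') by (field; lra).
      assert (w' * (2 * s) <= 1).
      { apply (Rmult_le_compat_r (2 * s)) in Hw's; [|lra]. rewrite Rinv_l in Hw's by lra. exact Hw's. }
      nra.
  - apply Rmult_le_pos; lra.
  - set (q := hl f (Z.of_nat m) 1) in *.
    change (t * Th * (1 - 2 * (C * w)) - (2 * (C * w) * P + K * w + C * w) <=
      dhl f (lc (1 + t) (- t) gp gm) (Z.of_nat m) 1 - q) in L1. change (q <= P + 1) in L2.
    assert (Hq : 0 < q) by (apply hl_pos; [exact Hf|apply prim_n_1]).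
    assert (Main : t * Th * (1 - 2 * (C * w)) - (2 * (C * w) * P + K * w + C * w) <= t * Th' / (s - K') * (P + 1)).
    { apply (Rle_trans _ (t * Th' / (s - K') * q)).
      - fold q in U. lra.
      - apply Rmult_le_compat_l; [|exact L2].
        apply Rmult_le_pos; [apply Rmult_le_pos; lra|left; apply Rinv_0_lt_compat; lra]. }
    (* divide by t, using w s^2 <= w' = t Th' / (s (C' - 1)) *)
    assert (Hw2 : w * (s * s * s) <= t * Th' / (C' - 1)).
    { rewrite Htau. replace (s * (C' - 1) * w' / (C' - 1)) with (s * w') by (field; lra). nra. }
    assert (HP3 : P <= 3 * s) by lra.
    assert (E1 : (2 * (C * w) * P + K * w + C * w) * s <= t * (Th' * (7 * C + K) / (C' - 1))).
    { apply (Rle_trans _ ((7 * C + K) * (w * (s * s * s)))).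
      - assert (0 < C * w) by (apply Rmult_lt_0_compat; lra). assert (0 < K * w) by (now apply Rmult_lt_0_compat).
        assert (X1 : C * w * P <= C * w * (3 * s)) by (apply Rmult_le_compat_l; lra).
        assert (X2 : C * w * 1 <= C * w * s) by (apply Rmult_le_compat_l; lra).
        assert (X3 : K * w * 1 <= K * w * s) by (apply Rmult_le_compat_l; lra).
        assert (X4 : (2 * (C * w) * P + K * w + C * w) * s <= (7 * C + K) * (w * s) * s).
        { apply Rmult_le_compat_r; lra. }
        assert (X5 : 0 <= (7 * C + K) * (w * s) * s).
        { apply Rmult_le_pos; [apply Rmult_le_pos; [lra|apply Rmult_le_pos; lra]|lra]. }
        assert (X6 : (7 * C + K) * (w * s) * s * 1 <= (7 * C + K) * (w * s) * s * s) by (apply Rmult_le_compat_l; lra).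
        lra.
      - apply (Rle_trans _ ((7 * C + K) * (t * Th' / (C' - 1)))); [apply Rmult_le_compat_l; lra|].
        right. field. lra. }
    assert (E2 : 2 * (C * w) * s <= C).
    { assert (w * (2 * s) <= 1); [|assert (C * (w * (2 * s)) <= C * 1) by (apply Rmult_le_compat_l; lra); lra].
      assert (w' * (2 * s) <= 1).
      { apply (Rmult_le_compat_r (2 * s)) in Hw's; [|lra]. rewrite Rinv_l in Hw's by lra. exact Hw's. }
      assert (w * 1 <= w * (s * s)) by (apply Rmult_le_compat_l; nra). nra. }
    assert (E3 : t * (Th * s - A1) <= (t * Th * (1 - 2 * (C * w)) - (2 * (C * w) * P + K * w + C * w)) * s).
    { unfold A1. assert (t * Th * (2 * (C * w) * s) <= t * Th * C) by (apply Rmult_le_compat_l; [apply Rmult_le_pos; lra|exact E2]). lra. }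
    assert (E4 : t * (Th * s - A1) <= t * Th' / (s - K') * (P + 1) * s).
    { eapply Rle_trans; [exact E3|]. apply Rmult_le_compat_r; lra. }
    assert (E5 : (Th * s - A1) * (s - K') <= Th' * (P + 1) * s).
    { apply (Rmult_le_reg_l t); [exact Ht|].
      apply (Rmult_le_compat_r (s - K')) in E4; [|lra].
      replace (t * Th' / (s - K') * (P + 1) * s * (s - K')) with (t * (Th' * (P + 1) * s)) in E4 by (field; lra). lra. }
    apply (Rmult_le_reg_r s); [lra|].
    replace ((Th - A1 / s) * (s - K') * s) with ((Th * s - A1) * (s - K')) by (field; lra). exact E5.
Qed.

(** * The local geometry of the unit sphere at a facet *)

(** If al exceeded ln a by a fixed tau, the errors in [facet_lower] would tend to 0 as n grows, and
    (n, 1) would be stretched by more than its length. *)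
Lemma facet_al_le f g a b al be : Markov f -> Tan f g -> Strip f (hl f 1 0) a b ->
  STan (hl f 1 0) a b g (hl f 1 0) al be -> Bnd f g 1 -> al <= ln a.
Proof.
  intros Hf Hg HS HT HB. apply Rnot_lt_le. intros Hc.
  assert (Hp := hl_pos f _ _ Hf prim_10). assert (HC := strip_gt_1 _ _ _ _ HS).
  assert (HK := Kst_pos _ (a * b) Hp ltac:(lra)).
  set (p := hl f 1 0) in *. set (C := a * b) in *. set (K := Kst p C) in *.
  set (tau := al - ln a). assert (Htau : 0 < tau) by (unfold tau; lra).
  assert (HX : 0 <= 2 * (3 * C + K) / tau) by (apply Rmult_le_pos; [lra|left; now apply Rinv_0_lt_compat]).
  destruct (grid_point p (ln a) (Rmax (ln a) (Rmax (2 * C + 2 * K + 1) (2 * (3 * C + K) / tau + 1))) Hp (Rmax_l _ _)) as (n & Hn & _).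
  set (P := INR n * p + ln a) in *.
  assert (G1 : 2 * C + 2 * K + 1 <= P) by (eapply Rle_trans; [|exact Hn]; rewrite !Rmax_Rle; lra).
  assert (G2 : 2 * (3 * C + K) / tau + 1 <= P) by (eapply Rle_trans; [|exact Hn]; rewrite !Rmax_Rle; lra).
  clear Hn. set (w := exp (- P) * exp (- P)).
  assert (Hw0 : 0 < w) by (apply Rmult_lt_0_compat; apply exp_pos).
  assert (HwP : w * P * P <= 1).
  { unfold w. assert (X := x_exp_neg_le_1 P). assert (0 < exp (- P)) by apply exp_pos.
    replace (exp (- P) * exp (- P) * P * P) with ((P * exp (- P)) * (P * exp (- P))) by ring.
    assert (0 <= P * exp (- P)) by (apply Rmult_le_pos; lra). nra. }
  assert (HwP1 : 0 < w * P) by (apply Rmult_lt_0_compat; lra).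
  assert (Hb : forall c, 0 <= c -> 2 * c <= P -> c * w <= / 2 /\ (4 * c <= P * P -> c * w <= / 4)).
  { intros c H0 H1. assert (c * (w * P * P) <= c * 1) by (apply Rmult_le_compat_l; lra).
    assert (HPP : P * 1 <= P * P) by (apply Rmult_le_compat_l; lra).
    split; [|intros H2]; apply (Rmult_le_reg_r (P * P)); lra. }
  assert (HPP : P * 3 <= P * P) by (apply Rmult_le_compat_l; lra).
  assert (Hx : C * w <= / 4) by (apply Hb; lra).
  assert (HKw : K * w <= / 2) by (apply Hb; lra).
  assert (HT' : STan p a b g p (ln a + tau) be).
  { replace (ln a + tau) with al by (unfold tau; ring). exact HT. }
  destruct (facet_lower f a b n g tau be Hf Hg HS HT') as [L _]; try assumption.
  - change (1 <= P). lra.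
  - lra.
  - change (tau * (1 - 2 * (C * w)) - (2 * (C * w) * P + K * w + C * w) <=
      dhl f g (Z.of_nat n) 1 - hl f (Z.of_nat n) 1) in L.
    specialize (HB (Z.of_nat n) 1%Z (prim_n_1 _)).
    assert (L2 : tau * / 2 <= 2 * (C * w) * P + K * w + C * w).
    { assert (tau * / 2 <= tau * (1 - 2 * (C * w))) by (apply Rmult_le_compat_l; lra). lra. }
    assert (L3 : (2 * (C * w) * P + K * w + C * w) * P <= 3 * C + K).
    { assert (X1 : C * (w * P * P) <= C * 1) by (apply Rmult_le_compat_l; lra).
      assert (X2 : K * (w * P * 1) <= K * (w * P * P)) by (apply Rmult_le_compat_l; [lra|apply Rmult_le_compat_l; lra]).
      assert (X3 : C * (w * P * 1) <= C * (w * P * P)) by (apply Rmult_le_compat_l; [lra|apply Rmult_le_compat_l; lra]).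
      assert (X4 : K * (w * P * P) <= K * 1) by (apply Rmult_le_compat_l; lra). lra. }
    assert (L4 : tau * / 2 * P <= 3 * C + K).
    { eapply Rle_trans; [|exact L3]. apply Rmult_le_compat_r; lra. }
    assert (L5 : tau * (2 * (3 * C + K) / tau + 1) <= tau * P) by (apply Rmult_le_compat_l; lra).
    replace (tau * (2 * (3 * C + K) / tau + 1)) with (2 * (3 * C + K) + tau) in L5 by (field; lra). lra.
Qed.

Lemma refl_unimod : unimod (-1) 0 0 1. Proof. now right. Qed.

Lemma refl_hl f : TraceFn f -> hl (cob (-1) 0 0 1 f) 1 0 = hl f 1 0.
Proof.
  intros [He _]. unfold hl, cob. simpl. change (Racosh (f (- (1))%Z (- 0)%Z / 2) = Racosh (f 1%Z 0%Z / 2)).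
  now rewrite He.
Qed.

(** Reversing (1, 0) replaces n by -n in a exp(np) + b exp(-np), so a and b are exchanged. Bounds on
    al at one end of the facet become bounds on be at the other. *)
Lemma strip_refl f p a b : TraceFn f -> Strip f p a b -> Strip (cob (-1) 0 0 1 f) p b a.
Proof.
  intros [He Hr] (Hp & Ha & Hb & Ex & Ey & Ez & E). repeat split; try assumption.
  - unfold cob; simpl. change (f (- (1))%Z (- 0)%Z = 2 * cosh p). now rewrite He.
  - unfold cob; simpl. rewrite Ey. ring.
  - unfold cob; simpl. generalize (Hr 1 0 0 1 eq_refl)%Z. simpl.
    rewrite <- (He 1%Z (-1)%Z) by reflexivity. simpl. rewrite Ex, Ey, Ez. unfold cosh. intros. lra.
  - rewrite (Rmult_comm b). exact E.
Qed.

Lemma stan_refl f g p a b dp al be : TraceFn f -> DTraceFn f g -> Strip f p a b ->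
  STan p a b g dp al be -> STan p b a (cob (-1) 0 0 1 g) dp be al.
Proof.
  intros [He Hr] [He' Hr'] (Hp & Ha & Hb & Ex & Ey & Ez & E) (G1 & G2 & G3 & G4). repeat split.
  - unfold cob; simpl. change (g (- (1))%Z (- 0)%Z = 2 * sinh p * dp). now rewrite He'.
  - unfold cob; simpl. rewrite G2. ring.
  - unfold cob; simpl. generalize (Hr' 1 0 0 1 eq_refl)%Z. simpl.
    rewrite <- (He' 1%Z (-1)%Z) by reflexivity. simpl. rewrite Ex, Ey, G1, G2, G3. unfold cosh, sinh. intros. lra.
  - rewrite (Rplus_comm be). exact G4.
Qed.

Lemma facet_be_le f g a b al be : Markov f -> Tan f g -> Strip f (hl f 1 0) a b ->
  STan (hl f 1 0) a b g (hl f 1 0) al be -> Bnd f g 1 -> be <= ln b.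
Proof.
  intros Hf Hg HS HT HB.
  apply (facet_al_le (cob (-1) 0 0 1 f) (cob (-1) 0 0 1 g) b a be al).
  - now apply markov_cob; [apply refl_unimod|].
  - now apply tan_cob; [apply refl_unimod|].
  - rewrite refl_hl by apply Hf. apply strip_refl; [apply Hf|exact HS].
  - rewrite refl_hl by apply Hf. apply (stan_refl f); try assumption; [apply Hf|apply Hg].
  - exact (proj1 (bnd_cob (-1) 0 0 1 f g 1 refl_unimod) HB).
Qed.

Lemma facet_iff f g a b al be : Markov f -> Tan f g -> Strip f (hl f 1 0) a b ->
  STan (hl f 1 0) a b g (hl f 1 0) al be ->
  (Bnd f g 1 <-> ln a - Theta (hl f 1 0) <= al <= ln a).
Proof.
  intros Hf Hg HS HT. assert (E := strip_be _ _ _ _ _ _ _ HS HT). split.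
  - intros HB. pose proof (facet_al_le f g a b al be Hf Hg HS HT HB).
    pose proof (facet_be_le f g a b al be Hf Hg HS HT HB). lra.
  - intros [H1 H2]. apply (bnd_facet f g a b al be); try assumption. lra.
Qed.

(** Ends of a segment are recognized by the fact that it cannot be prolonged beyond them, a property
    that a linear isometry preserves. The order of the ends is not. *)
Lemma segment_end l u A B : l < u -> l <= A <= u -> l <= B <= u ->
  (forall t, 0 < t -> ~ (l <= A + t * (A - B) <= u)) ->
  (forall t, 0 < t -> ~ (l <= B + t * (B - A) <= u)) ->
  (A = u /\ B = l) \/ (A = l /\ B = u).
Proof.
  intros Hlu HA HB H1 H2.
  assert (HAB : A <> B).
  { intros ->. apply (H1 1); [lra|]. lra. }
  assert (X : forall A B, l <= A <= u -> l <= B <= u -> B < A -> (forall t, 0 < t -> ~ (l <= A + t * (A - B) <= u)) -> A = u).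
  { clear. intros A B HA HB H H1. destruct (Rle_lt_or_eq_dec A u (proj2 HA)) as [H2|]; [|assumption].
    exfalso. apply (H1 ((u - A) / (A - B))); [apply Rdiv_lt_0_compat; lra|].
    replace (A + (u - A) / (A - B) * (A - B)) with u by (field; lra). lra. }
  assert (Y : forall A B, l <= A <= u -> l <= B <= u -> A < B -> (forall t, 0 < t -> ~ (l <= A + t * (A - B) <= u)) -> A = l).
  { clear. intros A B HA HB H H1. destruct (Rle_lt_or_eq_dec l A (proj1 HA)) as [H2|]; [|lra].
    exfalso. apply (H1 ((A - l) / (B - A))); [apply Rdiv_lt_0_compat; lra|].
    replace (A + (A - l) / (B - A) * (A - B)) with l by (field; lra). lra. }
  destruct (Rtotal_order A B) as [H|[H|H]]; [right|contradiction|left].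
  - split; [now apply (Y A B)|now apply (X B A)].
  - split; [now apply (X A B)|now apply (Y B A)].
Qed.

(** By [facet_iff] on both sides, membership in the unit ball along the common line identifies the
    two intervals of al, so gp' and gm' must be the ends of the facet of f'. *)
Lemma corner_theta_le f f' a b gp gm gp' gm' bp bm :
  Markov f -> Markov f' -> Strip f (hl f 1 0) a b ->
  Tan f gp -> Tan f gm -> Tan f' gp' -> Tan f' gm' ->
  STan (hl f 1 0) a b gp (hl f 1 0) (ln a) bp ->
  STan (hl f 1 0) a b gm (hl f 1 0) (ln a - Theta (hl f 1 0)) bm ->
  dhl f' gp' 1 0 = hl f' 1 0 -> dhl f' gm' 1 0 = hl f' 1 0 ->
  (forall r s K, Bnd f' (lc r s gp' gm') K <-> Bnd f (lc r s gp gm) K) ->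
  Theta (hl f 1 0) <= Theta (hl f' 1 0).
Proof.
  intros Hf Hf' HS Tp Tm Tp' Tm' Sp Sm Dp Dm HB.
  destruct (strip_exists f' Hf') as (a' & b' & HS').
  assert (Hp := hl_pos f _ _ Hf prim_10). assert (Hp' := hl_pos f' _ _ Hf' prim_10).
  assert (HTh := Theta_pos _ Hp). assert (HTh' := Theta_pos _ Hp').
  destruct (stan_exists f' _ a' b' gp' HS' Tp') as (dp & A & bA & SA).
  destruct (stan_exists f' _ a' b' gm' HS' Tm') as (dm & B & bB & SB).
  assert (E1 : dp = hl f' 1 0) by (rewrite <- Dp; symmetry; exact (stan_dhl f' gp' _ a' b' _ _ _ Hf' eq_refl SA)).
  assert (E2 : dm = hl f' 1 0) by (rewrite <- Dm; symmetry; exact (stan_dhl f' gm' _ a' b' _ _ _ Hf' eq_refl SB)).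
  subst dp dm.
  set (p := hl f 1 0) in *. set (p' := hl f' 1 0) in *.
  assert (Comb : forall (h1 h2 : Z -> Z -> R) q x y u v b1 b2 r s, r + s = 1 -> STan q x y h1 q u b1 -> STan q x y h2 q v b2 ->
     STan q x y (lc r s h1 h2) q (r * u + s * v) (r * b1 + s * b2)).
  { intros h1 h2 q x y u v b1 b2 r s Hrs H1 H2. generalize (stan_lc _ _ _ _ _ _ _ _ _ _ _ r s H1 H2).
    replace (r * q + s * q) with q; [tauto|]. rewrite <- Rmult_plus_distr_r, Hrs. ring. }
  assert (IFF : forall r s, r + s = 1 ->
     (ln a' - Theta p' <= r * A + s * B <= ln a' <-> ln a - Theta p <= r * ln a + s * (ln a - Theta p) <= ln a)).
  { intros r s Hrs.
    pose proof (facet_iff f' (lc r s gp' gm') a' b' _ _ Hf' (tan_lc _ _ _ _ _ Tp' Tm') HS'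
      (Comb _ _ _ _ _ _ _ _ _ r s Hrs SA SB)) as I1.
    pose proof (facet_iff f (lc r s gp gm) a b _ _ Hf (tan_lc _ _ _ _ _ Tp Tm) HS
      (Comb _ _ _ _ _ _ _ _ _ r s Hrs Sp Sm)) as I2.
    fold p' in I1. fold p in I2. specialize (HB r s 1). tauto. }
  destruct (segment_end (ln a' - Theta p') (ln a') A B) as [[EA EB]|[EA EB]].
  - lra.
  - generalize (proj2 (IFF 1 0 ltac:(lra)) ltac:(lra)). lra.
  - generalize (proj2 (IFF 0 1 ltac:(lra)) ltac:(lra)). lra.
  - intros t Ht H. assert (H' : ln a' - Theta p' <= (1 + t) * A + - t * B <= ln a') by lra.
    apply IFF in H'; [|lra]. assert (0 < t * Theta p) by (now apply Rmult_lt_0_compat). lra.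
  - intros t Ht H. assert (H' : ln a' - Theta p' <= - t * A + (1 + t) * B <= ln a') by lra.
    apply IFF in H'; [|lra]. assert (0 < t * Theta p) by (now apply Rmult_lt_0_compat). lra.
  - subst A B. apply (theta_le f f' a b a' b' gp gm gp' gm' bp bm bA bB); try assumption.
    intros r s K. apply HB.
  - (* the images of the two ends are exchanged: reflect f' *)
    pose proof (strip_be _ _ _ _ _ _ _ HS' SA) as F1. pose proof (strip_be _ _ _ _ _ _ _ HS' SB) as F2.
    assert (Ehl := refl_hl f' (proj1 Hf')).
    unfold p'. rewrite <- Ehl.
    apply (theta_le f (cob (-1) 0 0 1 f') a b b' a' gp gm (cob (-1) 0 0 1 gp') (cob (-1) 0 0 1 gm') bp bm A B);
      rewrite ?Ehl; try assumption.
    + apply markov_cob; [apply refl_unimod|exact Hf'].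
    + apply strip_refl; [apply Hf'|exact HS'].
    + apply tan_cob; [apply refl_unimod|exact Tp'].
    + apply tan_cob; [apply refl_unimod|exact Tm'].
    + replace (ln b') with bA by lra. apply (stan_refl f'); try assumption; [apply Hf'|apply Tp'].
    + replace (ln b' - Theta (hl f' 1 0)) with bB by (unfold p' in *; lra).
      apply (stan_refl f'); try assumption; [apply Hf'|apply Tm'].
    + intros r s K H. apply HB. exact (proj2 (bnd_cob (-1) 0 0 1 f' (lc r s gp' gm') K refl_unimod) H).
Qed.

(** * The length of a curve is recovered from its facet *)

Lemma sinh_convex x y : 0 <= x -> x <= y -> y * sinh x <= x * sinh y.
Proof.
  intros Hx Hxy. destruct (Rle_lt_or_eq_dec x y Hxy) as [H|<-]; [|lra].
  destruct (Rle_lt_or_eq_dec 0 x Hx) as [H0|<-].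
  2: { unfold sinh at 1. rewrite Ropp_0. lra. }
  assert (D : forall t, is_derive sinh t (cosh t)).
  { intros t. unfold sinh, cosh. auto_derive; [exact I|field]. }
  assert (C : forall t, continuity_pt sinh t).
  { intros t. apply continuity_pt_filterlim. apply (ex_derive_continuous sinh). eexists; apply D. }
  destruct (MVT_gen sinh 0 x cosh) as (s & Hs & Es); [intros; apply D|intros; apply C|].
  destruct (MVT_gen sinh x y cosh) as (t & Ht & Et); [intros; apply D|intros; apply C|].
  rewrite Rmin_left, Rmax_right in Hs, Ht by lra.
  replace (sinh 0) with 0 in Es by (unfold sinh; rewrite Ropp_0; field).
  assert (Hst : cosh s <= cosh t).
  { destruct (Rle_lt_or_eq_dec s t ltac:(lra)) as [Hlt| -> ]; [left; apply cosh_lt; lra|lra]. }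
  assert (E1 : sinh x = cosh s * x) by lra. assert (E2 : sinh y = cosh t * (y - x) + cosh s * x) by lra.
  rewrite E2, E1. assert (0 <= (cosh t - cosh s) * (x * (y - x))) by (apply Rmult_le_pos; [lra|apply Rmult_le_pos; lra]).
  lra.
Qed.

Lemma Theta_decr p q : 0 < p -> p < q -> Theta q < Theta p.
Proof.
  intros Hp Hq. assert (Hsp := sinh_pos p Hp). assert (Hsq := sinh_pos q ltac:(lra)).
  assert (Hcp := cosh_ge_1 p). assert (Hcq := cosh_ge_1 q).
  unfold Theta. apply Rplus_lt_le_compat.
  - apply Rmult_lt_compat_l; [lra|]. apply ln_increasing; [apply Rdiv_lt_0_compat; lra|].
    assert (S : 0 < sinh (q + - p)) by (apply sinh_pos; lra). rewrite sinh_plus in S.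
    assert (Ec : cosh (- p) = cosh p) by (unfold cosh; rewrite Ropp_involutive; field).
    assert (Es : sinh (- p) = - sinh p) by (unfold sinh; rewrite Ropp_involutive; field).
    rewrite Ec, Es in S.
    apply (Rmult_lt_reg_r (sinh q * sinh p)); [nra|].
    replace (cosh q / sinh q * (sinh q * sinh p)) with (cosh q * sinh p) by (field; lra).
    replace (cosh p / sinh p * (sinh q * sinh p)) with (sinh q * cosh p) by (field; lra). lra.
  (* The second summand of Theta is 4p / sinh(2p), and sinh x / x is nondecreasing. *)
  - generalize (sinh_convex (p + p) (q + q) ltac:(lra) ltac:(lra)). rewrite !sinh_plus. intros H.
    assert (0 < sinh p * cosh p) by (apply Rmult_lt_0_compat; lra).
    assert (0 < sinh q * cosh q) by (apply Rmult_lt_0_compat; lra).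
    apply (Rmult_le_reg_r ((sinh q * cosh q) * (sinh p * cosh p))); [now apply Rmult_lt_0_compat|].
    replace (2 * q / (sinh q * cosh q) * (sinh q * cosh q * (sinh p * cosh p))) with (2 * q * (sinh p * cosh p)) by (field; lra).
    replace (2 * p / (sinh p * cosh p) * (sinh q * cosh q * (sinh p * cosh p))) with (2 * p * (sinh q * cosh q)) by (field; lra).
    lra.
Qed.

(* gp, gm are the ends of the facet of the curve (m, k); the last clause recovers the length of the curve
   from the norm on their span. *)
Definition CornerData (f : Z -> Z -> R) (m k : Z) (gp gm : Z -> Z -> R) : Prop :=
  Tan f gp /\ Tan f gm /\ dhl f gp m k = hl f m k /\ dhl f gm m k = hl f m k /\
  Bnd f gp 1 /\ Bnd f gm 1 /\ ~ eqp gp gm /\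
  (forall g, Tan f g -> exists r s, eqp g (lc r s gp gm)) /\
  (forall r s, prim r s -> dhl f (lc (/ 2) (/ 2) gp gm) r s = hl f r s ->
     (r = m /\ s = k) \/ (r = - m /\ s = - k)%Z) /\
  (forall f' m' k' gp' gm', Markov f' -> prim m' k' -> Tan f' gp' -> Tan f' gm' ->
     dhl f' gp' m' k' = hl f' m' k' -> dhl f' gm' m' k' = hl f' m' k' ->
     (forall r s K, Bnd f' (lc r s gp' gm') K <-> Bnd f (lc r s gp gm) K) ->
     hl f' m' k' <= hl f m k).

Lemma corner_data_10 f : Markov f -> exists gp gm, CornerData f 1 0 gp gm.
Proof.
  intros Hf. destruct (strip_exists f Hf) as (a & b & HS).
  set (p := hl f 1 0) in *. assert (Hp := hl_pos f _ _ Hf prim_10). fold p in Hp.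
  assert (HTh := Theta_pos p Hp).
  assert (Hs := sinh_pos p Hp). assert (Hc := cosh_ge_1 p).
  destruct (stan_realize f p a b p (ln a) (- (2 * p / (sinh p * cosh p)) - ln a) Hf HS) as (gp & Tp & Sp); [field; lra|].
  destruct (stan_realize f p a b p (ln a - Theta p) (- (2 * p / (sinh p * cosh p)) - (ln a - Theta p)) Hf HS) as (gm & Tm & Sm); [field; lra|].
  exists gp, gm. split; [exact Tp|]. split; [exact Tm|].
  assert (Dp : dhl f gp 1 0 = hl f 1 0) by (apply (stan_dhl f gp p a b _ _ _ Hf eq_refl Sp)).
  assert (Dm : dhl f gm 1 0 = hl f 1 0) by (apply (stan_dhl f gm p a b _ _ _ Hf eq_refl Sm)).
  split; [exact Dp|]. split; [exact Dm|].
  split; [apply (facet_iff f gp a b _ _ Hf Tp HS Sp); fold p; lra|].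
  split; [apply (facet_iff f gm a b _ _ Hf Tm HS Sm); fold p; lra|].
  split.
  (* If the ends coincided, 2 gp - gm would equal gp, but its coordinate ln a + Theta is outside the
     facet. *)
  { intros Eq. pose proof (stan_lc _ _ _ _ _ _ _ _ _ _ _ 2 (-1) Sp Sm) as Sl.
    replace (2 * p + -1 * p) with p in Sl by ring.
    assert (B : Bnd f (lc 2 (-1) gp gm) 1).
    { apply (bnd_eqp f gp).
      - intros r s Hrs. unfold lc. rewrite <- (Eq r s Hrs). ring.
      - apply (facet_iff f gp a b _ _ Hf Tp HS Sp); fold p; lra. }
    apply (facet_iff f _ a b _ _ Hf (tan_lc _ _ _ _ _ Tp Tm) HS Sl) in B. fold p in B. lra. }
  split; [|split].
  - intros g Tg. destruct (stan_exists f p a b g HS Tg) as (dp & al & be & Sg).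
    (* Solution of (r + s) p = dp and r ln a + s (ln a - Theta) = al. *)
    pose (s := (dp / p * ln a - al) / Theta p). pose (r := dp / p - s).
    exists r, s. pose proof (stan_lc _ _ _ _ _ _ _ _ _ _ _ r s Sp Sm) as Sl.
    replace (r * p + s * p) with dp in Sl by (unfold r, s; field; lra).
    replace (r * ln a + s * (ln a - Theta p)) with al in Sl by (unfold r, s; field; lra).
    assert (Tl : Tan f (lc r s gp gm)) by now apply tan_lc.
    rewrite (stan_be p a b _ _ _ _ Hp Sl) in Sl. rewrite (stan_be p a b _ _ _ _ Hp Sg) in Sg.
    apply (stan_unique f p a b g _ _ _ _ Tg Tl Sg Sl).
  - intros r s Hrs E. destruct (Z.eq_dec s 0) as [->|Hs0].
    + destruct (prim_m_0 r Hrs) as [-> | ->]; [left|right]; lia.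
    + exfalso. pose proof (stan_lc _ _ _ _ _ _ _ _ _ _ _ (/2) (/2) Sp Sm) as Sl.
      replace (/2 * p + /2 * p) with p in Sl by field.
      assert (Tl : Tan f (lc (/2) (/2) gp gm)) by now apply tan_lc.
      pose proof (strip_be f p a b _ _ _ HS Sl) as Eb.
      pose proof (facet_strict f _ a b _ _ Hf Tl HS Sl ltac:(lra) ltac:(lra) r s Hrs Hs0). lra.
  - intros f' m' k' gp' gm' Hf' Hp' Tp' Tm' Dp' Dm' HB.
    destruct (unimod_to m' k' Hp') as (r & s & Hu).
    assert (E : forall h, dhl (cob m' r k' s f') (cob m' r k' s h) 1 0 = dhl f' h m' k') by (intros h; unfold dhl; now rewrite !cob_10).
    assert (E' : hl (cob m' r k' s f') 1 0 = hl f' m' k') by (unfold hl; now rewrite cob_10).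
    assert (Hf1 : Markov (cob m' r k' s f')) by now apply markov_cob.
    assert (HT : Theta p <= Theta (hl (cob m' r k' s f') 1 0)).
    { apply (corner_theta_le f (cob m' r k' s f') a b gp gm (cob m' r k' s gp') (cob m' r k' s gm') _ _ Hf Hf1 HS Tp Tm
        (tan_cob _ _ _ _ _ _ Hu Tp') (tan_cob _ _ _ _ _ _ Hu Tm') Sp Sm).
      - now rewrite E, E'.
      - now rewrite E, E'.
      - intros x y K. rewrite <- HB. apply iff_sym. exact (bnd_cob m' r k' s f' (lc x y gp' gm') K Hu). }
    rewrite E' in HT. apply Rnot_lt_le. intros Hlt. fold p in Hlt.
    generalize (Theta_decr p _ Hp Hlt). lra.
Qed.

Lemma corner_data f m k : Markov f -> prim m k -> exists gp gm, CornerData f m k gp gm.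
Proof.
  intros Hf Hp. destruct (unimod_to m k Hp) as (r & s & Hu).
  destruct (corner_data_10 (cob m r k s f) (markov_cob _ _ _ _ _ Hu Hf))
    as (gp1 & gm1 & Tp1 & Tm1 & Dp & Dm & Bp & Bm & Hne & Hspan & Hstr & Hcmp).
  destruct (tan_pull m r k s f gp1 Hu Tp1) as (gp & Tp & Ep).
  destruct (tan_pull m r k s f gm1 Hu Tm1) as (gm & Tm & Em).
  destruct (unimod_inv m r k s Hu) as (a' & b' & c' & d' & Hu' & HM).
  assert (E : forall h h1, (forall p q, cob m r k s h p q = h1 p q) -> dhl (cob m r k s f) h1 1 0 = dhl f h m k).
  { intros h h1 Eh. unfold dhl. now rewrite <- Eh, !cob_10. }
  assert (E' : hl (cob m r k s f) 1 0 = hl f m k) by (unfold hl; now rewrite cob_10).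
  assert (El : forall x y p q, cob m r k s (lc x y gp gm) p q = lc x y gp1 gm1 p q).
  { intros x y p q. unfold lc at 2. rewrite <- Ep, <- Em. reflexivity. }
  assert (EB : forall h h1 K, (forall p q, cob m r k s h p q = h1 p q) -> (Bnd f h K <-> Bnd (cob m r k s f) h1 K)).
  { intros h h1 K Eh. rewrite (bnd_cob m r k s f h K Hu). split; apply bnd_eqp; intros p q _; [|symmetry]; apply Eh. }
  exists gp, gm. split; [exact Tp|]. split; [exact Tm|].
  split; [rewrite <- (E _ _ Ep), <- E'; exact Dp|]. split; [rewrite <- (E _ _ Em), <- E'; exact Dm|].
  split; [now apply (EB _ _ 1 Ep)|]. split; [now apply (EB _ _ 1 Em)|].
  split.
  { intros Eq. apply Hne. intros p q Hpq. rewrite <- Ep, <- Em. unfold cob. apply Eq. now apply gcd_mat. }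
  split; [|split].
  - intros g Tg. destruct (Hspan (cob m r k s g) (tan_cob _ _ _ _ _ _ Hu Tg)) as (x & y & Exy).
    exists x, y. intros p q Hpq. destruct (HM p q) as (E1 & E2 & _).
    specialize (Exy (a' * p + b' * q) (c' * p + d' * q) (gcd_mat _ _ _ _ _ _ Hu' Hpq))%Z.
    rewrite <- El in Exy. unfold cob in Exy. rewrite E1, E2 in Exy. exact Exy.
  - intros p q Hpq Eq. destruct (HM p q) as (E1 & E2 & _).
    destruct (Hstr (a' * p + b' * q) (c' * p + d' * q) (gcd_mat _ _ _ _ _ _ Hu' Hpq))%Z as [[F1 F2]|[F1 F2]].
    + unfold dhl, hl in *. rewrite <- El. unfold cob. rewrite E1, E2. exact Eq.
    + left. rewrite F1, F2 in E1, E2. lia.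
    + right. rewrite F1, F2 in E1, E2. lia.
  - intros f' m' k' gp' gm' Hf' Hp' Tp' Tm' Dp' Dm' HB. rewrite <- E'.
    apply (Hcmp f' m' k' gp' gm'); try assumption.
    intros x y K. rewrite HB. apply EB. apply El.
Qed.

(** * Reduction to the three shortest curves *)

Lemma markov_eq_unimod f a b c d : Markov f -> unimod a b c d ->
  f a b * f a b + f c d * f c d + f (a + c)%Z (b + d)%Z * f (a + c)%Z (b + d)%Z =
  f a b * f c d * f (a + c)%Z (b + d)%Z.
Proof.
  intros (_ & _ & H) [Hu|Hu]; [now apply H|].
  generalize (H c d a b ltac:(lia)). rewrite (Z.add_comm c a), (Z.add_comm d b). lra.
Qed.

Lemma tan_eq_unimod f g a b c d : Tan f g -> unimod a b c d ->
  let x := f a b in let y := f c d in let z := f (a + c)%Z (b + d)%Z in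
  (2 * x - y * z) * g a b + (2 * y - x * z) * g c d + (2 * z - x * y) * g (a + c)%Z (b + d)%Z = 0.
Proof.
  intros (_ & H) [Hu|Hu]; [now apply H|].
  generalize (H c d a b ltac:(lia)). cbv zeta. rewrite (Z.add_comm c a), (Z.add_comm d b). lra.
Qed.

Lemma unimod_prim a b c d : unimod a b c d -> prim a b /\ prim c d /\ prim (a + c) (b + d).
Proof.
  unfold unimod. intros H. repeat split.
  - apply (gcd_det a b c d). lia.
  - apply (gcd_det c d a b). lia.
  - apply (gcd_det _ _ c d). lia.
Qed.

(* The edge {u, v} of the Farey tree points away from the shortest curves: u + v is longer than u - v. *)
Definition Out (f : Z -> Z -> R) (a b c d : Z) : Prop :=
  unimod a b c d /\ f a b * f c d <= 2 * f (a + c)%Z (b + d)%Z.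

Lemma out_sym f a b c d : Out f a b c d -> Out f c d a b.
Proof.
  intros [Hu H]. split; [unfold unimod in *; lia|].
  rewrite (Z.add_comm c), (Z.add_comm d). lra.
Qed.

(** In terms of the traces x, y, z of u, v, u + v, the new condition is 2y <= xz, which follows from
    xy <= 2z and x > 2. *)
Lemma out_l f a b c d : Markov f -> Out f a b c d -> Out f a b (a + c) (b + d).
Proof.
  intros Hf [Hu H]. assert (Hu' : unimod a b (a + c) (b + d)) by (unfold unimod in *; lia).
  split; [exact Hu'|]. destruct (unimod_prim _ _ _ _ Hu) as (P1 & P2 & P3).
  pose proof (trace_rec_unimod f _ _ _ _ (proj1 Hf) Hu') as E.
  replace (a - (a + c))%Z with (- c)%Z in E by lia. replace (b - (b + d))%Z with (- d)%Z in E by lia.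
  destruct Hf as ((He & _) & H2 & _). rewrite He in E by exact P2.
  apply H2 in P1, P2, P3. 
  set (x := f a b) in *. set (y := f c d) in *. set (z := f (a + c)%Z (b + d)%Z) in *.
  assert (x * (x * y) <= x * (2 * z)) by (apply Rmult_le_compat_l; lra).
  assert (4 * y <= (x * x) * y) by (apply Rmult_le_compat_r; nra). lra.
Qed.

Lemma out_r f a b c d : Markov f -> Out f a b c d -> Out f (a + c) (b + d) c d.
Proof.
  intros Hf H. apply out_sym in H. apply out_l in H; [|exact Hf]. apply out_sym in H.
  now rewrite (Z.add_comm a), (Z.add_comm b).
Qed.

Lemma out_growth f a b c d : Markov f -> Out f a b c d ->
  f a b <= f (a + c)%Z (b + d)%Z /\ f c d <= f (a + c)%Z (b + d)%Z /\
  f (a + c)%Z (b + d)%Z <= f a b * f c d.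
Proof.
  intros Hf [Hu H]. destruct (unimod_prim _ _ _ _ Hu) as (P1 & P2 & P3).
  pose proof (trace_rec_unimod f _ _ _ _ (proj1 Hf) Hu) as E.
  assert (P4 : prim (a - c) (b - d)) by (apply (gcd_det _ _ c d); unfold unimod in Hu; lia).
  destruct Hf as (_ & H2 & _). apply H2 in P1, P2, P3, P4. repeat split; nra.
Qed.

(** Outward edges only lead to outward edges, along which traces grow, so the smallest trace
    strictly inside the cone is at the mediant. *)
Lemma out_interior f a b c d i j : Markov f -> Out f a b c d -> (0 < i)%Z -> (0 < j)%Z -> Z.gcd i j = 1%Z ->
  f (a + c)%Z (b + d)%Z <= f (i * a + j * c)%Z (i * b + j * d)%Z.
Proof.
  intros Hf HO Hi Hj Hg. set (z := f (a + c)%Z (b + d)%Z).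
  destruct (cone_ind (fun a b c d => Out f a b c d /\ z <= f (a + c)%Z (b + d)%Z)) with (a := a) (b := b) (c := c) (d := d) (i := i) (j := j)
    as (a' & b' & c' & d' & (_ & H) & -> & ->); try assumption.
  - intros r s t u [H1 H2]. pose proof (out_l _ _ _ _ _ Hf H1) as H3. split; [exact H3|].
    generalize (out_growth _ _ _ _ _ Hf H3). lra.
  - intros r s t u [H1 H2]. pose proof (out_r _ _ _ _ _ Hf H1) as H3. split; [exact H3|].
    generalize (out_growth _ _ _ _ _ Hf H3). lra.
  - split; [exact HO|]. unfold z. lra.
Qed.

(** A reduced Markov triple: it is sorted, and the flip of its largest member does not make it
    smaller. By [root_min] it consists of the three smallest traces. *)
Definition Root (f : Z -> Z -> R) : Prop :=
  f 1%Z 0%Z <= f 0%Z 1%Z /\ f 0%Z 1%Z <= f 1%Z 1%Z /\ 2 * f 1%Z 1%Z <= f 1%Z 0%Z * f 0%Z 1%Z.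

Definition Reach (f g : Z -> Z -> R) : Prop :=
  exists a b c d, unimod a b c d /\ forall p q, g p q = cob a b c d f p q.

Lemma reach_trans f g h : Reach f g -> Reach g h -> Reach f h.
Proof.
  intros (a & b & c & d & Hu & E) (a' & b' & c' & d' & Hu' & E').
  exists (a * a' + b * c')%Z, (a * b' + b * d')%Z, (c * a' + d * c')%Z, (c * b' + d * d')%Z. split.
  - unfold unimod in *.
    replace ((a * a' + b * c') * (c * b' + d * d') - (a * b' + b * d') * (c * a' + d * c'))%Z
      with ((a * d - b * c) * (a' * d' - b' * c'))%Z by ring.
    destruct Hu as [-> | ->]; destruct Hu' as [-> | ->]; lia.
  - intros p q. rewrite E'. unfold cob at 1. rewrite E. unfold cob. f_equal; ring.
Qed.

Lemma reach_refl f : Reach f f.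
Proof.
  exists 1%Z, 0%Z, 0%Z, 1%Z. split; [now left|]. intros p q. unfold cob. f_equal; ring.
Qed.

Lemma markov_ext f g : (forall p q, f p q = g p q) -> Markov f -> Markov g.
Proof.
  intros E ((He & Hr) & H2 & HF). split; [split|split].
  - intros p q Hp. rewrite <- !E. now apply He.
  - intros a b c d H. rewrite <- !E. now apply Hr.
  - intros p q Hp. rewrite <- E. now apply H2.
  - intros a b c d H. rewrite <- !E. now apply HF.
Qed.

Lemma reach_markov f g : Markov f -> Reach f g -> Markov g.
Proof.
  intros Hf (a & b & c & d & Hu & E). apply (markov_ext (cob a b c d f)); [intros; symmetry; apply E|].
  now apply markov_cob.
Qed.

Lemma reach_swap12 f : exists g, Reach f g /\
  g 1%Z 0%Z = f 0%Z 1%Z /\ g 0%Z 1%Z = f 1%Z 0%Z /\ g 1%Z 1%Z = f 1%Z 1%Z.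
Proof.
  exists (cob 0 1 1 0 f). split; [|repeat split].
  exists 0%Z, 1%Z, 1%Z, 0%Z. split; [now right|reflexivity].
Qed.

Lemma reach_swap23 f : Markov f -> exists g, Reach f g /\
  g 1%Z 0%Z = f 1%Z 0%Z /\ g 0%Z 1%Z = f 1%Z 1%Z /\ g 1%Z 1%Z = f 0%Z 1%Z.
Proof.
  intros ((He & _) & _).
  exists (cob 1 (-1) 0 (-1) f). split; [|repeat split].
  - exists 1%Z, (-1)%Z, 0%Z, (-1)%Z. split; [now right|reflexivity].
  - exact (He _ _ prim_11).
  - exact (He _ _ prim_01).
Qed.

Lemma reach_flip f : Markov f -> exists g, Reach f g /\
  g 1%Z 0%Z = f 1%Z 0%Z /\ g 0%Z 1%Z = f 0%Z 1%Z /\ g 1%Z 1%Z = f 1%Z 0%Z * f 0%Z 1%Z - f 1%Z 1%Z.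
Proof.
  intros ((He & Hr) & _).
  exists (cob 1 0 0 (-1) f). split; [|repeat split].
  - exists 1%Z, 0%Z, 0%Z, (-1)%Z. split; [now right|reflexivity].
  - exact (He _ _ prim_01).
  - unfold cob; simpl. generalize (Hr 1 0 0 1 eq_refl)%Z. simpl. lra.
Qed.

Lemma sort_exists f : Markov f -> exists g, Reach f g /\
  g 1%Z 0%Z <= g 0%Z 1%Z /\ g 0%Z 1%Z <= g 1%Z 1%Z /\
  forall B, f 1%Z 0%Z <= B -> f 0%Z 1%Z <= B -> f 1%Z 1%Z <= B -> g 1%Z 1%Z <= B.
Proof.
  intros Hf.
  assert (S12 : forall h, Markov h -> exists g, Reach h g /\ g 1%Z 0%Z <= g 0%Z 1%Z /\ g 1%Z 1%Z = h 1%Z 1%Z /\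
     (forall B, h 1%Z 0%Z <= B -> h 0%Z 1%Z <= B -> g 0%Z 1%Z <= B)).
  { intros h Hh. destruct (Rle_dec (h 1%Z 0%Z) (h 0%Z 1%Z)) as [H|H].
    - exists h. split; [apply reach_refl|]. repeat split; try lra. tauto.
    - destruct (reach_swap12 h) as (g & R & E1 & E2 & E3). exists g. split; [exact R|].
      rewrite E1, E2, E3. repeat split; try lra. tauto. }
  assert (S23 : forall h, Markov h -> exists g, Reach h g /\ g 0%Z 1%Z <= g 1%Z 1%Z /\
     g 1%Z 0%Z = h 1%Z 0%Z /\ h 0%Z 1%Z <= g 1%Z 1%Z /\
     (forall B, h 0%Z 1%Z <= B -> h 1%Z 1%Z <= B -> g 1%Z 1%Z <= B)).
  { intros h Hh. destruct (Rle_dec (h 0%Z 1%Z) (h 1%Z 1%Z)) as [H|H].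
    - exists h. split; [apply reach_refl|]. repeat split; try lra. tauto.
    - destruct (reach_swap23 h Hh) as (g & R & E1 & E2 & E3). exists g. split; [exact R|].
      rewrite E1, E2, E3. repeat split; try lra. tauto. }
  destruct (S12 f Hf) as (f1 & R1 & A1 & A2 & A3). assert (M1 := reach_markov _ _ Hf R1).
  destruct (S23 f1 M1) as (f2 & R2 & B1 & B2 & B3 & B4). assert (M2 := reach_markov _ _ M1 R2).
  destruct (S12 f2 M2) as (f3 & R3 & C1 & C2 & C3).
  exists f3. split; [eapply reach_trans; [exact R1|eapply reach_trans; eassumption]|].
  split; [exact C1|]. rewrite C2. split.
  - apply C3; [|exact B1]. rewrite B2. lra.
  - intros B H1 H2 H3. apply B4; [now apply A3|]. now rewrite A2.
Qed.

(* Each flip of a non-reduced sorted triple decreases its maximum by at least 4/Z0. *)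
Lemma root_descent Z0 n : forall f, 0 < Z0 -> Markov f ->
  f 1%Z 0%Z <= f 0%Z 1%Z -> f 0%Z 1%Z <= f 1%Z 1%Z -> f 1%Z 1%Z <= Z0 ->
  f 1%Z 1%Z < 2 + INR n * (4 / Z0) -> exists g, Reach f g /\ Root g.
Proof.
  induction n as [|n IH]; intros f HZ0 Hf H1 H2 H3 H4.
  - pose proof Hf as (_ & G & _). specialize (G _ _ prim_11). simpl in H4. lra.
  - destruct (Rle_dec (2 * f 1%Z 1%Z) (f 1%Z 0%Z * f 0%Z 1%Z)) as [H|H].
    { exists f. split; [apply reach_refl|]. split; [exact H1|]. split; assumption. }
    destruct (reach_flip f Hf) as (f1 & R1 & E1 & E2 & E3).
    assert (M1 := reach_markov _ _ Hf R1).
    destruct (Rle_dec (f 0%Z 1%Z) (f1 1%Z 1%Z)) as [Hy|Hy].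
    { exists f1. split; [exact R1|]. unfold Root. rewrite E1, E2 in *. split; [exact H1|]. split; [exact Hy|]. lra. }
    destruct (sort_exists f1 M1) as (f2 & R2 & S1 & S2 & S3).
    assert (M2 := reach_markov _ _ M1 R2).
    assert (Hm : f2 1%Z 1%Z <= f 0%Z 1%Z) by (apply S3; lra).
    (* The flipped value z' is below y and satisfies z z' = x^2 + y^2, so z >= y + x^2 / y, where x
       > 2 and y <= Z0. *)
    assert (Hdec : f 0%Z 1%Z + 4 / Z0 <= f 1%Z 1%Z).
    { pose proof Hf as (_ & G & GF). specialize (GF 1 0 0 1 eq_refl)%Z. simpl in GF.
      pose proof (G _ _ prim_10) as Gx. pose proof (G _ _ prim_01) as Gy. pose proof (G _ _ prim_11) as Gz.
      set (x := f 1%Z 0%Z) in *. set (y := f 0%Z 1%Z) in *. set (z := f 1%Z 1%Z) in *.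
      set (z' := f1 1%Z 1%Z) in *. apply Rnot_le_lt in Hy.
      assert (Ezz : z * z' = x * x + y * y) by (rewrite E3; lra).
      assert (X1 : z * z' <= z * y) by (apply Rmult_le_compat_l; lra).
      apply (Rmult_le_reg_r (y * Z0)); [apply Rmult_lt_0_compat; lra|].
      replace ((y + 4 / Z0) * (y * Z0)) with (y * y * Z0 + 4 * y) by (field; lra).
      assert (X2 : (x * x + y * y) * Z0 <= z * y * Z0) by (apply Rmult_le_compat_r; lra).
      assert (X3 : 4 * y <= (x * x) * Z0) by (apply Rmult_le_compat; nra). lra. }
    rewrite S_INR in H4.
    destruct (IH f2 HZ0 M2 S1 S2) as (g & R3 & Hg); [generalize (Rdiv_lt_0_compat 4 Z0); lra|lra|].
    exists g. split; [eapply reach_trans; [exact R1|eapply reach_trans; eassumption]|exact Hg].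
Qed.

Lemma root_exists f : Markov f -> exists g, Reach f g /\ Root g.
Proof.
  intros Hf. destruct (sort_exists f Hf) as (f1 & R1 & S1 & S2 & _).
  assert (M1 := reach_markov _ _ Hf R1). pose proof M1 as (_ & G & _). specialize (G _ _ prim_11).
  set (z := f1 1%Z 1%Z) in *.
  assert (Hd : 0 < 4 / z) by (apply Rdiv_lt_0_compat; lra).
  destruct (nfloor_ex (z / (4 / z))) as (n & _ & Hn).
  { left. apply Rdiv_lt_0_compat; lra. }
  assert (Hz : f1 1%Z 1%Z < 2 + INR (S n) * (4 / z)).
  { rewrite S_INR. apply (Rmult_lt_compat_r (4 / z)) in Hn; [|exact Hd].
    replace (z / (4 / z) * (4 / z)) with z in Hn by (field; lra). fold z. lra. }
  destruct (root_descent z (S n) f1 ltac:(lra) M1 S1 S2 (Rle_refl _) Hz) as (g & R2 & Hg).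
  exists g. split; [eapply reach_trans; eassumption|exact Hg].
Qed.

Lemma root_out f : Markov f -> Root f -> Out f 1 0 1 1 /\ Out f 1 1 0 1 /\ Out f 1 0 0 (-1).
Proof.
  intros Hf (H1 & H2 & H3). pose proof Hf as ((He & Hr) & G & _).
  pose proof (G _ _ prim_10) as Gx. pose proof (G _ _ prim_01) as Gy. pose proof (G _ _ prim_11) as Gz.
  repeat split.
  - now left.
  - generalize (Hr 1 0 1 1 eq_refl)%Z. simpl. change (f 0%Z (-1)%Z) with (f (- 0)%Z (- (1))%Z).
    rewrite He by reflexivity. nra.
  - now left.
  - generalize (Hr 1 1 0 1 eq_refl)%Z. simpl. nra.
  - now right.
  - change (f 0%Z (-1)%Z) with (f (- 0)%Z (- (1))%Z). rewrite He by reflexivity.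
    generalize (Hr 1 0 0 1 eq_refl)%Z. simpl. lra.
Qed.

(** The cones on the three edges of the root triangle, between (1, 0) and (1, 1), between (1, 1) and
    (0, 1), and between (1, 0) and (0, -1), contain up to sign every primitive class except its
    vertices. *)
Lemma root_cases (Q : Z -> Z -> Prop) :
  (forall p q, prim p q -> Q p q -> Q (- p) (- q))%Z ->
  Q 1%Z 0%Z -> Q 0%Z 1%Z -> Q 1%Z 1%Z ->
  (forall i j, (0 < i)%Z -> (0 < j)%Z -> Z.gcd i j = 1%Z -> Q (i * 1 + j * 1)%Z (i * 0 + j * 1)%Z) ->
  (forall i j, (0 < i)%Z -> (0 < j)%Z -> Z.gcd i j = 1%Z -> Q (i * 1 + j * 0)%Z (i * 1 + j * 1)%Z) ->
  (forall i j, (0 < i)%Z -> (0 < j)%Z -> Z.gcd i j = 1%Z -> Q (i * 1 + j * 0)%Z (i * 0 + j * -1)%Z) ->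
  forall p q, prim p q -> Q p q.
Proof.
  intros Qe Q10 Q01 Q11 C1 C2 C3.
  assert (H : forall p q, prim p q -> (0 <= p)%Z -> Q p q).
  { intros p q Hp H0. destruct (Z.eq_dec p 0) as [->|Hp0].
    - unfold prim in Hp. simpl in Hp. assert (H : (q = 1 \/ q = -1)%Z) by lia.
      destruct H as [-> | ->]; [exact Q01|]. apply (Qe 0%Z 1%Z); [reflexivity|exact Q01].
    - destruct (Z.lt_total q 0) as [Hq|[->|Hq]].
      + replace p with (p * 1 + (- q) * 0)%Z by ring. replace q with (p * 0 + (- q) * -1)%Z at 2 by ring.
        apply C3; try lia. now rewrite Z.gcd_opp_r.
      + destruct (prim_m_0 p Hp) as [-> | ->]; [exact Q10|lia].
      + destruct (Z.lt_total p q) as [H|[->|H]].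
        * replace p with (p * 1 + (q - p) * 0)%Z at 1 by ring. replace q with (p * 1 + (q - p) * 1)%Z at 2 by ring.
          apply C2; try lia. now rewrite Z.gcd_sub_diag_r.
        * unfold prim in Hp. rewrite Z.gcd_diag in Hp. replace q with 1%Z by lia. exact Q11.
        * replace p with ((p - q) * 1 + q * 1)%Z at 1 by ring. replace q with ((p - q) * 0 + q * 1)%Z at 3 by ring.
          apply C1; try lia. now rewrite Z.gcd_comm, Z.gcd_sub_diag_r, Z.gcd_comm. }
  intros p q Hp. destruct (Z_le_gt_dec 0 p) as [H0|H0]; [now apply H|].
  rewrite <- (Z.opp_involutive p), <- (Z.opp_involutive q). apply Qe; [now apply gcd_opp|].
  apply H; [now apply gcd_opp|lia].
Qed.

Lemma root_min f : Markov f -> Root f -> forall p q, prim p q ->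
  (q = 0 /\ (p = 1 \/ p = -1))%Z \/ (p = 0 /\ (q = 1 \/ q = -1))%Z \/ f 1%Z 1%Z <= f p q.
Proof.
  intros Hf HR. destruct (root_out f Hf HR) as (O1 & O2 & O3).
  destruct HR as (H1 & H2 & H3). pose proof Hf as ((He & Hr) & G & _).
  apply root_cases.
  - intros p q Hp [H|[H|H]]; [left; lia|right; left; lia|right; right]. now rewrite He.
  - left; lia.
  - right; left; lia.
  - right; right; lra.
  - intros i j Hi Hj Hg. right; right.
    generalize (out_interior f _ _ _ _ i j Hf O1 Hi Hj Hg) (out_growth _ _ _ _ _ Hf O1). simpl. lra.
  - intros i j Hi Hj Hg. right; right.
    generalize (out_interior f _ _ _ _ i j Hf O2 Hi Hj Hg) (out_growth _ _ _ _ _ Hf O2). simpl. lra.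
  - intros i j Hi Hj Hg. right; right.
    generalize (out_interior f _ _ _ _ i j Hf O3 Hi Hj Hg). 
    generalize (Hr 1 0 0 1 eq_refl)%Z. simpl. lra.
Qed.

(** * Almost superadditivity along outward edges *)

Lemma cosh_tangent r h : 0 <= r -> 0 <= h -> sinh r * h <= cosh (r + h) - cosh r.
Proof.
  intros Hr Hh. rewrite cosh_plus.
  assert (A := cosh_ge_1 h). assert (B := cosh_ge_1 r). assert (C := sinh_ge_id h Hh).
  assert (0 <= sinh r) by (generalize (sinh_ge_id r Hr); lra).
  assert (cosh r * 1 <= cosh r * cosh h) by (apply Rmult_le_compat_l; lra).
  assert (sinh r * h <= sinh r * sinh h) by (apply Rmult_le_compat_l; lra). lra.
Qed.

(** As a function of cosh, sinh is concave with slope coth. *)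
Lemma sinh_concave r h : sinh r * (sinh (r + h) - sinh r) <= cosh r * (cosh (r + h) - cosh r).
Proof.
  rewrite cosh_plus, sinh_plus.
  assert (A := cosh_ge_1 h). assert (B := cosh_sinh_sq r).
  assert (E : cosh r * (cosh r * cosh h + sinh r * sinh h - cosh r) - sinh r * (sinh r * cosh h + cosh r * sinh h - sinh r)
    = (cosh r * cosh r - sinh r * sinh r) * (cosh h - 1)) by ring.
  rewrite B in E. lra.
Qed.

Lemma cosh_ge_id p : 0 <= p -> p <= cosh p.
Proof. 
  intros Hp. generalize (sinh_ge_id p Hp) (exp_pos (- p)). rewrite exp_neg_cosh_sinh. lra.
Qed.

(** The equation for R is the Markov equation in half lengths, and the one for dr its derivative.
    Since S - R <= 1 / S for S = sinh p sinh q, r is close to p + q. As r is almost homogeneous of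
    degree one in (p, q), with both partial derivatives at least 1, the defects p - dp and q - dq
    pass to r - dr up to an error of order 1 / (cosh p cosh q). *)
Lemma superadditive_estimate p q r R gam dp dq dr : 0 < p -> 0 < q -> 0 < r -> 0 < R ->
  cosh r = cosh p * cosh q + R -> R * R = (sinh p * sinh q) * (sinh p * sinh q) - 1 ->
  0 < gam -> gam < 1 -> gam * cosh p <= sinh p -> gam * cosh q <= sinh q -> 2 <= sinh p * sinh q ->
  sinh r * dr * R = (cosh p * (sinh q * sinh q) + cosh q * R) * sinh p * dp +
                    (cosh q * (sinh p * sinh p) + cosh p * R) * sinh q * dq ->
  dp <= p -> dq <= q ->
  r <= p + q /\
  (p - dp) + (q - dq) - 42 / (gam * gam * (gam * gam) * (cosh p * cosh q)) <= r - dr.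
Proof.
  intros Hp Hq Hr HR Er ER Hg0 Hg1 Gp Gq HS Ed Hdp Hdq.
  assert (Sp := sinh_pos p Hp). assert (Sq := sinh_pos q Hq). assert (Sr := sinh_pos r Hr).
  assert (Cp := cosh_ge_1 p). assert (Cq := cosh_ge_1 q).
  assert (Ip := cosh_ge_id p ltac:(lra)). assert (Iq := cosh_ge_id q ltac:(lra)).
  set (S := sinh p * sinh q) in *. 
  assert (HRS : R < S) by nra.
  assert (HR2 : S <= 2 * R) by nra.
  set (D := S - R). assert (HD0 : 0 < D) by (unfold D; lra).
  assert (HDS : D * S <= 1).
  { assert (D * (S + R) = 1) by (unfold D; lra). assert (0 < D * R) by (now apply Rmult_lt_0_compat). lra. }
  assert (Em : cosh (p + q) - cosh r = D) by (rewrite cosh_plus, Er; unfold D, S; ring).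
  assert (Hrm : r <= p + q) by (apply cosh_le_inv; lra).
  split; [exact Hrm|].
  set (m := p + q) in *. set (CC := cosh p * cosh q) in *.
  assert (HCC : 1 <= CC) by (unfold CC; nra).
  assert (HSC : S <= CC).
  { unfold S, CC. generalize (exp_pos (- p)) (exp_pos (- q)). rewrite !exp_neg_cosh_sinh. intros. apply Rmult_le_compat; lra. }
  assert (HCr : CC <= cosh r) by lra.
  assert (Hr2 : cosh r <= 2 * sinh r) by (generalize (cosh_sinh_sq r); nra).
  assert (HgS : gam * gam * CC <= S).
  { unfold S, CC. replace (gam * gam * (cosh p * cosh q)) with ((gam * cosh p) * (gam * cosh q)) by ring.
    apply Rmult_le_compat; try assumption; nra. }
  assert (T1 : sinh r * (m - r) <= D).
  { rewrite <- Em. replace m with (r + (m - r)) at 2 by ring. apply cosh_tangent; lra. }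
  assert (T2 : sinh r * (sinh m - sinh r) <= cosh r * D).
  { rewrite <- Em. replace m with (r + (m - r)) by ring. apply sinh_concave. }
  assert (T2' : sinh m - sinh r <= 2 * D).
  { apply (Rmult_le_reg_l (sinh r)); [exact Sr|]. assert (cosh r * D <= 2 * sinh r * D) by (apply Rmult_le_compat_r; lra). lra. }
  assert (Esm : sinh m = sinh p * cosh q + cosh p * sinh q) by (unfold m; apply sinh_plus).
  assert (Hsm2 : sinh m <= 2 * CC).
  { rewrite Esm. unfold CC. generalize (exp_pos (- p)) (exp_pos (- q)). rewrite !exp_neg_cosh_sinh. intros.
    assert (sinh p * cosh q <= cosh p * cosh q) by (apply Rmult_le_compat_r; lra).
    assert (cosh p * sinh q <= cosh p * cosh q) by (apply Rmult_le_compat_l; lra). lra. }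
  assert (Hsrm : sinh r <= sinh m).
  { assert (cosh r * cosh r <= cosh m * cosh m) by (apply Rmult_le_compat; lra).
    generalize (cosh_sinh_sq r) (cosh_sinh_sq m). intros. assert (0 < sinh m) by (apply sinh_pos; unfold m; lra). nra. }
  (* g1, g2 are the partial derivatives of r, times sinh r *)
  set (xi := D / R). assert (Exi : xi * R = D) by (unfold xi; field; lra).
  assert (Hxi : 0 < xi) by (unfold xi; now apply Rdiv_lt_0_compat).
  set (g1 := sinh m + xi * (cosh p * sinh q)). set (g2 := sinh m + xi * (cosh q * sinh p)).
  assert (Eg : sinh r * dr = g1 * dp + g2 * dq).
  { apply (Rmult_eq_reg_r R); [|lra]. rewrite Ed.
    replace ((g1 * dp + g2 * dq) * R) with
      ((sinh m * R + (xi * R) * (cosh p * sinh q)) * dp + (sinh m * R + (xi * R) * (cosh q * sinh p)) * dq)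
      by (unfold g1, g2; ring).
    rewrite Exi, Esm. unfold D, S. ring. }
  assert (P1 : 0 <= cosh p * sinh q) by (apply Rmult_le_pos; lra).
  assert (P2 : 0 <= cosh q * sinh p) by (apply Rmult_le_pos; lra).
  assert (Hg1' : sinh r <= g1) by (unfold g1; assert (0 <= xi * (cosh p * sinh q)) by (apply Rmult_le_pos; lra); lra).
  assert (Hg2' : sinh r <= g2) by (unfold g2; assert (0 <= xi * (cosh q * sinh p)) by (apply Rmult_le_pos; lra); lra).
  assert (L1 : sinh r * (p - dp) <= g1 * (p - dp)) by (apply Rmult_le_compat_r; lra).
  assert (L2 : sinh r * (q - dq) <= g2 * (q - dq)) by (apply Rmult_le_compat_r; lra).
  (* By Euler's relation this would vanish if r were homogeneous of degree one; it is the whole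
     error of the estimate. *)
  set (G := g1 * p + g2 * q - r * sinh r).
  assert (HG : G <= m * (sinh m - sinh r) + sinh r * (m - r) + xi * (m * sinh m)).
  { assert (X1 : cosh p * sinh q * p + cosh q * sinh p * q <= m * sinh m).
    { rewrite Esm. unfold m. 
      assert (0 <= cosh p * sinh q * q) by (apply Rmult_le_pos; lra).
      assert (0 <= cosh q * sinh p * p) by (apply Rmult_le_pos; lra). lra. }
    assert (X2 : xi * (cosh p * sinh q * p + cosh q * sinh p * q) <= xi * (m * sinh m)) by (apply Rmult_le_compat_l; lra).
    unfold G, g1, g2. unfold m in *. lra. }
  assert (Hm0 : 0 < m) by (unfold m; lra).
  assert (Y1 : m * (sinh m - sinh r) <= m * (2 * D)) by (apply Rmult_le_compat_l; lra).
  assert (gg : 0 < gam * gam) by (now apply Rmult_lt_0_compat).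
  assert (gg1 : gam * gam <= 1) by nra.
  assert (Y2 : gam * gam * (xi * (m * sinh m)) <= 4 * m * D).
  { apply (Rle_trans _ (gam * gam * (xi * (m * (2 * CC))))).
    - apply Rmult_le_compat_l; [lra|]. apply Rmult_le_compat_l; [lra|]. apply Rmult_le_compat_l; lra.
    - assert (Z1 : xi * m * 2 * (gam * gam * CC) <= xi * m * 2 * (2 * R)).
      { apply Rmult_le_compat_l; [|lra]. apply Rmult_le_pos; [apply Rmult_le_pos; lra|lra]. }
      replace (xi * m * 2 * (2 * R)) with (4 * m * (xi * R)) in Z1 by ring. rewrite Exi in Z1. lra. }
  assert (Y3 : gam * gam * G <= 7 * (1 + m) * D).
  { assert (0 < m * D) by (now apply Rmult_lt_0_compat).
    assert (W1 : gam * gam * G <= gam * gam * (2 * (m * D) + D) + 4 * m * D).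
    { assert (gam * gam * G <= gam * gam * (2 * (m * D) + D + xi * (m * sinh m))) by (apply Rmult_le_compat_l; lra). lra. }
    assert (W2 : gam * gam * (2 * (m * D) + D) <= 1 * (2 * (m * D) + D)) by (apply Rmult_le_compat_r; lra). lra. }
  assert (Hm3 : 1 + m <= 3 * CC).
  { unfold m, CC. assert (cosh p * 1 <= cosh p * cosh q) by (apply Rmult_le_compat_l; lra).
    assert (1 * cosh q <= cosh p * cosh q) by (apply Rmult_le_compat_r; lra). lra. }
  assert (Y4 : gam * gam * (gam * gam) * G <= 21).
  { assert (V1 : gam * gam * (gam * gam * G) <= gam * gam * (7 * (3 * CC) * D)).
    { apply Rmult_le_compat_l; [lra|]. eapply Rle_trans; [exact Y3|]. apply Rmult_le_compat_r; lra. }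
    assert (V2 : gam * gam * CC * D <= S * D) by (apply Rmult_le_compat_r; lra). lra. }
  set (g4 := gam * gam * (gam * gam)) in *. assert (Hg4 : 0 < g4) by (unfold g4; now apply Rmult_lt_0_compat).
  (* The constant is 7 * 3 * 2: 7 from [Y3], 3 from 1 + m <= 3 CC, and 2 from cosh r <= 2 sinh r. *)
  assert (Y5 : G <= sinh r * (42 / (g4 * CC))).
  { apply (Rmult_le_reg_l (g4 * CC)); [apply Rmult_lt_0_compat; lra|].
    replace (g4 * CC * (sinh r * (42 / (g4 * CC)))) with (42 * sinh r) by (field; lra).
    assert (g4 * G * CC <= 21 * CC) by (apply Rmult_le_compat_r; lra). lra. }
  apply (Rmult_le_reg_l (sinh r)); [exact Sr|].
  unfold G in Y5. lra.
Qed.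

(** Outwardness selects the larger root of the Markov equation, that is R >= 0. The threshold 8 /
    gam^2 ensures sinh p sinh q >= 2, and 168 = 4 * 42 because the product of the traces is 4 cosh p
    cosh q. *)
Lemma out_superadditive f g gam a b c d : Markov f -> Tan f g -> Out f a b c d ->
  0 < gam -> gam < 1 -> (forall p q, prim p q -> gam * cosh (hl f p q) <= sinh (hl f p q)) ->
  8 / (gam * gam) <= f a b * f c d -> dhl f g a b <= hl f a b -> dhl f g c d <= hl f c d ->
  hl f (a + c) (b + d) <= hl f a b + hl f c d /\
  (hl f a b - dhl f g a b) + (hl f c d - dhl f g c d)
    - 168 / (gam * gam * (gam * gam)) / (f a b * f c d) <=
  hl f (a + c) (b + d) - dhl f g (a + c) (b + d).
Proof.
  intros Hf Hg [Hu HO] Hg0 Hg1 Hgam HN Ha Hc.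
  destruct (unimod_prim _ _ _ _ Hu) as (P1 & P2 & P3).
  assert (Hp := hl_pos f _ _ Hf P1). assert (Hq := hl_pos f _ _ Hf P2). assert (Hr := hl_pos f _ _ Hf P3).
  pose proof (markov_eq_unimod f _ _ _ _ Hf Hu) as EF. pose proof (tan_eq_unimod f g _ _ _ _ Hg Hu) as ET.
  cbv zeta in ET.
  rewrite (dhl_sinh f g a b), (dhl_sinh f g c d), (dhl_sinh f g (a + c) (b + d)) in ET by assumption.
  assert (G1 := Hgam _ _ P1). assert (G2 := Hgam _ _ P2).
  rewrite (hl_cosh f a b), (hl_cosh f c d), (hl_cosh f (a + c) (b + d)) in EF, ET, HO by assumption.
  rewrite (hl_cosh f a b), (hl_cosh f c d) in HN by assumption.
  rewrite (hl_cosh f a b Hf P1), (hl_cosh f c d Hf P2).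
  set (p := hl f a b) in *. set (q := hl f c d) in *. set (r := hl f (a + c)%Z (b + d)%Z) in *.
  set (dp := dhl f g a b) in *. set (dq := dhl f g c d) in *. set (dr := dhl f g (a + c)%Z (b + d)%Z) in *.
  assert (Cp := cosh_ge_1 p). assert (Cq := cosh_ge_1 q).
  assert (Sp := sinh_pos p Hp). assert (Sq := sinh_pos q Hq).
  assert (Hcs1 := cosh_sinh_sq p). assert (Hcs2 := cosh_sinh_sq q).
  pose (R := cosh r - cosh p * cosh q).
  assert (Er : cosh r = cosh p * cosh q + R) by (unfold R; ring).
  assert (gg : 0 < gam * gam) by (now apply Rmult_lt_0_compat).
  assert (HS : 2 <= sinh p * sinh q).
  { assert (X : 8 <= gam * gam * (2 * cosh p * (2 * cosh q))).
    { apply (Rmult_le_compat_l (gam * gam)) in HN; [|lra].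
      replace (gam * gam * (8 / (gam * gam))) with 8 in HN by (field; lra). exact HN. }
    assert ((gam * cosh p) * (gam * cosh q) <= sinh p * sinh q) by (apply Rmult_le_compat; try assumption; nra). lra. }
  assert (ER : R * R = (sinh p * sinh q) * (sinh p * sinh q) - 1).
  { replace ((sinh p * sinh q) * (sinh p * sinh q)) with ((sinh p * sinh p) * (sinh q * sinh q)) by ring.
    replace (sinh p * sinh p) with (cosh p * cosh p - 1) by lra. replace (sinh q * sinh q) with (cosh q * cosh q - 1) by lra.
    unfold R. lra. }
  assert (HR : 0 < R).
  { assert (0 <= R) by (unfold R; lra). 
    assert (R <> 0); [|lra]. intros E0. rewrite E0 in ER.
    assert (2 * 2 <= sinh p * sinh q * (sinh p * sinh q)) by (apply Rmult_le_compat; lra). lra. }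
  assert (Ed : sinh r * dr * R = (cosh p * (sinh q * sinh q) + cosh q * R) * sinh p * dp +
                    (cosh q * (sinh p * sinh p) + cosh p * R) * sinh q * dq).
  { replace (sinh q * sinh q) with (cosh q * cosh q - 1) by lra. replace (sinh p * sinh p) with (cosh p * cosh p - 1) by lra.
    rewrite Er in ET. lra. }
  destruct (superadditive_estimate p q r R gam dp dq dr Hp Hq Hr HR Er ER Hg0 Hg1 G1 G2 HS Ed Ha Hc) as [L1 L2].
  split; [exact L1|]. eapply Rle_trans; [|exact L2]. right.
  assert (E : 168 / (gam * gam * (gam * gam)) / (2 * cosh p * (2 * cosh q)) =
              42 / (gam * gam * (gam * gam) * (cosh p * cosh q))) by (field; lra).
  rewrite E. reflexivity.
Qed.

(** * The invariant area form *)

Definition wedge (g1 g2 : Z -> Z -> R) (a b c d : Z) : R := g1 a b * g2 c d - g1 c d * g2 a b.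

(** The cross product of two tangent vectors is a multiple of the gradient of x^2 + y^2 + z^2 - xyz.
    The factor k is the same for all bases because flips preserve the relation; all three components
    are carried through the induction. *)
Lemma wedge_area f g1 g2 : Markov f -> Tan f g1 -> Tan f g2 ->
  exists k, forall a b c d, (a * d - b * c = 1)%Z ->
    wedge g1 g2 a b c d = k * (2 * f (a + c)%Z (b + d)%Z - f a b * f c d).
Proof.
  intros Hf Ht1 Ht2.
  pose proof Hf as ((He & Hr) & G & _). pose proof Ht1 as ((He1 & Hr1) & T1). pose proof Ht2 as ((He2 & Hr2) & T2).
  (* Obtained by pairing cross product and gradient with (x, y, z); for the gradient this gives -xyz
     on the surface. *)
  set (k := - (wedge g1 g2 0 1 1 1 * f 1%Z 0%Z + wedge g1 g2 1 1 1 0 * f 0%Z 1%Z + wedge g1 g2 1 0 0 1 * f 1%Z 1%Z)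
      / (f 1%Z 0%Z * f 0%Z 1%Z * f 1%Z 1%Z)).
  exists k.
  enough (H : forall a b c d, (a * d - b * c = 1)%Z ->
    wedge g1 g2 a b c d = k * (2 * f (a + c)%Z (b + d)%Z - f a b * f c d) /\
    wedge g1 g2 c d (a + c)%Z (b + d)%Z = k * (2 * f a b - f c d * f (a + c)%Z (b + d)%Z) /\
    wedge g1 g2 (a + c)%Z (b + d)%Z a b = k * (2 * f c d - f a b * f (a + c)%Z (b + d)%Z)).
  { intros a b c d Hd. now destruct (H a b c d Hd). }
  apply basis_ind.
  - specialize (T1 1 0 0 1 eq_refl)%Z. specialize (T2 1 0 0 1 eq_refl)%Z. cbv zeta in T1, T2. simpl Z.add in *.
    pose proof (proj2 (proj2 Hf) 1 0 0 1 eq_refl)%Z as EF. simpl Z.add in EF.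
    pose proof (G _ _ prim_10) as Gx. pose proof (G _ _ prim_01) as Gy. pose proof (G _ _ prim_11) as Gz.
    set (x := f 1%Z 0%Z) in *. set (y := f 0%Z 1%Z) in *. set (z := f 1%Z 1%Z) in *.
    assert (Hxyz : 0 < x * y * z) by (repeat apply Rmult_lt_0_compat; lra).
    assert (EN : (2 * x - y * z) * x + (2 * y - x * z) * y + (2 * z - x * y) * z = - (x * y * z)) by lra.
    assert (Ek : - (x * y * z) * k = wedge g1 g2 0 1 1 1 * x + wedge g1 g2 1 1 1 0 * y + wedge g1 g2 1 0 0 1 * z).
    { unfold k. field. lra. }
    unfold wedge in *.
    set (a1 := g1 1%Z 0%Z) in *. set (a2 := g1 0%Z 1%Z) in *. set (a3 := g1 1%Z 1%Z) in *.
    set (b1 := g2 1%Z 0%Z) in *. set (b2 := g2 0%Z 1%Z) in *. set (b3 := g2 1%Z 1%Z) in *.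
    set (n1 := 2 * x - y * z) in *. set (n2 := 2 * y - x * z) in *. set (n3 := 2 * z - x * y) in *.
    (* C (N . X) - N (C . X) = X x (C x N) and C x N = (A x B) x N = B (A . N) - A (B . N) = 0 *)
    assert (V : forall c n r, c * (- (x * y * z)) = n * (- (x * y * z) * k) + r -> r = 0 -> c = k * n).
    { intros c n r H1 ->. apply (Rmult_eq_reg_r (- (x * y * z))); [lra|lra]. }
    split; [|split].
    + apply (V _ _ (x * (b2 * (n1 * a1 + n2 * a2 + n3 * a3) - a2 * (n1 * b1 + n2 * b2 + n3 * b3)) -
                    y * (b1 * (n1 * a1 + n2 * a2 + n3 * a3) - a1 * (n1 * b1 + n2 * b2 + n3 * b3)))).
      * rewrite Ek, <- EN. ring.
      * rewrite T1, T2. ring.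
    + apply (V _ _ (y * (b3 * (n1 * a1 + n2 * a2 + n3 * a3) - a3 * (n1 * b1 + n2 * b2 + n3 * b3)) -
                    z * (b2 * (n1 * a1 + n2 * a2 + n3 * a3) - a2 * (n1 * b1 + n2 * b2 + n3 * b3)))).
      * rewrite Ek, <- EN. ring.
      * rewrite T1, T2. ring.
    + apply (V _ _ (z * (b1 * (n1 * a1 + n2 * a2 + n3 * a3) - a1 * (n1 * b1 + n2 * b2 + n3 * b3)) -
                    x * (b3 * (n1 * a1 + n2 * a2 + n3 * a3) - a3 * (n1 * b1 + n2 * b2 + n3 * b3)))).
      * rewrite Ek, <- EN. ring.
      * rewrite T1, T2. ring.
  - intros a b c d Hd (W1 & W2 & W3). unfold wedge in *.
    change (c + - a)%Z with (c - a)%Z. change (d + - b)%Z with (d - b)%Z.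
    rewrite !(even_swap _ a b c d) by assumption.
    pose proof (prim_l _ _ _ _ Hd) as Pl. rewrite (He a b Pl), (He1 a b Pl), (He2 a b Pl).
    replace (f (a - c)%Z (b - d)%Z) with (f a b * f c d - f (a + c)%Z (b + d)%Z) by (rewrite <- Hr by exact Hd; ring).
    replace (g1 (a - c)%Z (b - d)%Z) with (g1 a b * f c d + f a b * g1 c d - g1 (a + c)%Z (b + d)%Z)
      by (rewrite <- Hr1 by exact Hd; ring).
    replace (g2 (a - c)%Z (b - d)%Z) with (g2 a b * f c d + f a b * g2 c d - g2 (a + c)%Z (b + d)%Z)
      by (rewrite <- Hr2 by exact Hd; ring).
    set (x := f a b) in *. set (y := f c d) in *. set (z := f (a + c)%Z (b + d)%Z) in *.
    repeat split.
    + lra.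
    + match type of W1 with ?w1 = ?v1 => match type of W3 with ?w3 = ?v3 =>
        transitivity (x * w1 + w3); [ring|rewrite W1, W3; ring] end end.
    + match type of W1 with ?w1 = ?v1 => match type of W2 with ?w2 = ?v2 =>
        transitivity (y * w1 + w2); [ring|rewrite W1, W2; ring] end end.
  - intros a b c d Hd (W1 & W2 & W3). unfold wedge in *.
    rewrite (Z.add_comm c a), (Z.add_comm d b).
    generalize (Hr a b (a + c) (b + d) ltac:(lia))%Z (Hr1 a b (a + c) (b + d) ltac:(lia))%Z (Hr2 a b (a + c) (b + d) ltac:(lia))%Z.
    replace (a - (a + c))%Z with (- c)%Z by lia. replace (b - (b + d))%Z with (- d)%Z by lia.
    pose proof (prim_r _ _ _ _ Hd) as Pr. rewrite (He c d Pr), (He1 c d Pr), (He2 c d Pr). intros E E1 E2.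
    replace (f (a + (a + c))%Z (b + (b + d))%Z) with (f a b * f (a + c)%Z (b + d)%Z - f c d) by lra.
    replace (g1 (a + (a + c))%Z (b + (b + d))%Z) with (g1 a b * f (a + c)%Z (b + d)%Z + f a b * g1 (a + c)%Z (b + d)%Z - g1 c d) by lra.
    replace (g2 (a + (a + c))%Z (b + (b + d))%Z) with (g2 a b * f (a + c)%Z (b + d)%Z + f a b * g2 (a + c)%Z (b + d)%Z - g2 c d) by lra.
    set (x := f a b) in *. set (y := f c d) in *. set (z := f (a + c)%Z (b + d)%Z) in *.
    repeat split.
    + lra.
    + match type of W2 with ?w2 = ?v2 => match type of W3 with ?w3 = ?v3 =>
        transitivity (z * w3 + w2); [ring|rewrite W3, W2; ring] end end.
    + match type of W1 with ?w1 = ?v1 => match type of W3 with ?w3 = ?v3 =>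
        transitivity (x * w3 + w1); [ring|rewrite W3, W1; ring] end end.
  - intros a b c d Hd (W1 & W2 & W3). unfold wedge in *.
    replace (a + (c - a))%Z with c by lia. replace (b + (d - b))%Z with d by lia.
    rewrite !(even_swap _ a b c d) by assumption.
    replace (f (a - c)%Z (b - d)%Z) with (f a b * f c d - f (a + c)%Z (b + d)%Z) by (rewrite <- Hr by exact Hd; ring).
    replace (g1 (a - c)%Z (b - d)%Z) with (g1 a b * f c d + f a b * g1 c d - g1 (a + c)%Z (b + d)%Z)
      by (rewrite <- Hr1 by exact Hd; ring).
    replace (g2 (a - c)%Z (b - d)%Z) with (g2 a b * f c d + f a b * g2 c d - g2 (a + c)%Z (b + d)%Z)
      by (rewrite <- Hr2 by exact Hd; ring).
    set (x := f a b) in *. set (y := f c d) in *. set (z := f (a + c)%Z (b + d)%Z) in *.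
    repeat split.
    + match type of W1 with ?w1 = ?v1 => match type of W3 with ?w3 = ?v3 =>
        transitivity (x * w1 + w3); [ring|rewrite W3, W1; ring] end end.
    + match type of W1 with ?w1 = ?v1 => match type of W2 with ?w2 = ?v2 =>
        transitivity (y * w1 + w2); [ring|rewrite W2, W1; ring] end end.
    + match type of W1 with ?w1 = ?v1 => transitivity (- w1); [ring|rewrite W1; ring] end.
Qed.

(** * Flat arcs of the unit sphere *)

Section Attained.

(** [y0] is the midpoint of a nondegenerate segment with ends y0 + dl and y0 - dl in the unit ball,
    and its norm is not below 1. [Hnone] is the negation of what is to be proved; the marking is
    chosen at the root so that the outward cones cover all other curves. *)
Variables f y0 dl : Z -> Z -> R.
Hypothesis Hf : Markov f.
Hypothesis HR : Root f.
Hypothesis Hy : Tan f y0.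
Hypothesis Hd : Tan f dl.
Hypothesis Bp : Bnd f (lc 1 1 y0 dl) 1.
Hypothesis Bm : Bnd f (lc 1 (-1) y0 dl) 1.
Hypothesis Bnot : forall K, K < 1 -> ~ Bnd f y0 K.
Hypothesis Indep : forall r s, eqp (lc r s y0 dl) (fun _ _ => 0) -> r = 0 /\ s = 0.
Hypothesis Hnone : forall p q, prim p q -> dhl f y0 p q <> hl f p q.

Let E p q := hl f p q - dhl f y0 p q.

(** The bounds at both ends of the segment show that a curve almost extremal for [y0] hardly changes
    length along [dl]. *)
Lemma E_bound p q : prim p q -> 0 < E p q /\ Rabs (dhl f dl p q) <= E p q.
Proof.
  intros Hp. specialize (Bp p q Hp). specialize (Bm p q Hp). rewrite dhl_lc in Bp, Bm.
  specialize (Hnone p q Hp). unfold E. split; [lra|]. apply Rabs_le. lra.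
Qed.

Lemma E_even p q : prim p q -> E (- p)%Z (- q)%Z = E p q.
Proof.
  intros Hp. unfold E. 
  now rewrite (hl_even f p q (proj1 (proj1 Hf)) Hp), (dhl_even f y0 p q (proj1 (proj1 Hf)) (proj1 (proj1 Hy)) Hp).
Qed.

Let x0 := f 1%Z 0%Z.

Lemma f_ge_x0 p q : prim p q -> x0 <= f p q.
Proof.
  intros Hp. destruct HR as (H1 & H2 & _). pose proof Hf as ((He & _) & _).
  unfold x0. destruct (root_min f Hf HR p q Hp) as [[Eq Ep]|[[Ep Eq]|H]]; [subst q|subst p|lra].
  - destruct Ep as [Ep|Ep]; subst p; [lra|].
    change (f 1%Z 0%Z <= f (- (1))%Z (- 0)%Z). rewrite He by reflexivity. lra.
  - destruct Eq as [Eq|Eq]; subst q; [exact H1|].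
    change (f 1%Z 0%Z <= f (- 0)%Z (- (1))%Z). rewrite He by reflexivity. exact H1.
Qed.

Lemma x0_gt_2 : 2 < x0.
Proof. apply Hf. reflexivity. Qed.

Let p0 := hl f 1 0.
(** The tanh of the shortest half length, hence a lower bound for the tanh of every half length. *)
Let gam := sinh p0 / cosh p0.

Lemma gam_bounds : 0 < gam /\ gam < 1.
Proof.
  assert (Hp0 : 0 < p0) by (apply hl_pos; [exact Hf|reflexivity]).
  assert (Hs := sinh_pos p0 Hp0). assert (Hc := cosh_ge_1 p0). unfold gam. split.
  - apply Rdiv_lt_0_compat; lra.
  - apply (Rmult_lt_reg_r (cosh p0)); [lra|]. unfold Rdiv. rewrite Rmult_assoc, Rinv_l by lra.
    generalize (exp_pos (- p0)). rewrite exp_neg_cosh_sinh. lra.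
Qed.

Lemma gam_sinh p q : prim p q -> gam * cosh (hl f p q) <= sinh (hl f p q).
Proof.
  intros Hp. assert (Hp0 : 0 < p0) by (apply hl_pos; [exact Hf|reflexivity]).
  assert (Hs := sinh_pos p0 Hp0). assert (Hc := cosh_ge_1 p0).
  assert (Hq := hl_pos f p q Hf Hp). assert (Hsq := sinh_pos _ Hq). assert (Hcq := cosh_ge_1 (hl f p q)).
  assert (Hle : cosh p0 <= cosh (hl f p q)).
  { generalize (f_ge_x0 p q Hp). unfold x0. rewrite (hl_cosh f 1 0 Hf prim_10), (hl_cosh f p q Hf Hp). fold p0. lra. }
  generalize (cosh_sinh_sq p0) (cosh_sinh_sq (hl f p q)). intros E1 E2.
  unfold gam. set (s := sinh p0) in *. set (c := cosh p0) in *.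
  set (s' := sinh (hl f p q)) in *. set (c' := cosh (hl f p q)) in *.
  apply (Rmult_le_reg_r c); [lra|]. replace (s / c * c' * c) with (s * c') by (field; lra).
  apply Rnot_lt_le. intros Hlt.
  assert (X0 : 0 <= s' * c) by (apply Rmult_le_pos; lra).
  assert (X1 : (s' * c) * (s' * c) < (s * c') * (s * c')) by (apply Rmult_le_0_lt_compat; lra).
  replace ((s' * c) * (s' * c)) with ((s' * s') * (c * c)) in X1 by ring.
  replace ((s * c') * (s * c')) with ((s * s) * (c' * c')) in X1 by ring.
  replace (s' * s') with (c' * c' - 1) in X1 by lra. replace (s * s) with (c * c - 1) in X1 by lra.
  assert (c * c <= c' * c') by (apply Rmult_le_compat; lra). lra.
Qed.

Let k1 := 168 / (gam * gam * (gam * gam)).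
Let N0 := 8 / (gam * gam).

Lemma k1_pos : 0 < k1.
Proof. destruct gam_bounds. unfold k1. apply Rdiv_lt_0_compat; [lra|].
  assert (0 < gam * gam) by (apply Rmult_lt_0_compat; lra). apply Rmult_lt_0_compat; lra.
Qed.

Lemma E_superadditive a b c d : Out f a b c d -> N0 <= f a b * f c d ->
  hl f (a + c) (b + d) <= hl f a b + hl f c d /\
  E a b + E c d - k1 / (f a b * f c d) <= E (a + c)%Z (b + d)%Z.
Proof.
  intros HO HN. destruct gam_bounds. destruct (unimod_prim _ _ _ _ (proj1 HO)) as (P1 & P2 & P3).
  destruct (E_bound _ _ P1). destruct (E_bound _ _ P2).
  apply (out_superadditive f y0 gam); try assumption; [exact gam_sinh|unfold E in *; lra|unfold E in *; lra].
Qed.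

(* The infimum of E / hl over the curves strictly inside the cone is zero. *)
Definition Bad (a b c d : Z) : Prop := forall eps, 0 < eps -> exists i j,
  (0 < i)%Z /\ (0 < j)%Z /\ Z.gcd i j = 1%Z /\
  E (i * a + j * c)%Z (i * b + j * d)%Z < eps * hl f (i * a + j * c) (i * b + j * d).

Lemma bad_sym a b c d : Bad a b c d -> Bad c d a b.
Proof.
  intros H eps He. destruct (H eps He) as (i & j & Hi & Hj & Hg & HE).
  exists j, i. rewrite Z.gcd_comm, (Z.add_comm (j * c)), (Z.add_comm (j * d)). tauto.
Qed.

Lemma cone_prim a b c d i j : unimod a b c d -> Z.gcd i j = 1%Z ->
  prim (i * a + j * c) (i * b + j * d).
Proof.
  intros Hu Hg. rewrite (Z.mul_comm i a), (Z.mul_comm j c), (Z.mul_comm i b), (Z.mul_comm j d).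
  apply (gcd_mat a c b d i j); [unfold unimod in Hu; lia|exact Hg].
Qed.

Lemma not_bad a b c d : ~ Bad a b c d -> exists eps, 0 < eps /\ forall i j,
  (0 < i)%Z -> (0 < j)%Z -> Z.gcd i j = 1%Z ->
  eps * hl f (i * a + j * c) (i * b + j * d) <= E (i * a + j * c)%Z (i * b + j * d)%Z.
Proof.
  intros H. apply not_all_ex_not in H. destruct H as (eps & H). apply imply_to_and in H.
  destruct H as [He H]. exists eps. split; [exact He|]. intros i j Hi Hj Hg.
  apply Rnot_lt_le. intros Hlt. apply H. exists i, j. tauto.
Qed.

(** The inside of a cone consists of two subcones and the mediant, and at the mediant E is
    positive. *)
Lemma bad_split a b c d : unimod a b c d -> Bad a b c d ->
  Bad a b (a + c) (b + d) \/ Bad (a + c) (b + d) c d.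
Proof.
  intros Hu HB. destruct (classic (Bad a b (a + c) (b + d))) as [H|H1]; [now left|right].
  apply NNPP. intros H2. destruct (not_bad _ _ _ _ H1) as (e1 & He1 & K1). destruct (not_bad _ _ _ _ H2) as (e2 & He2 & K2).
  destruct (unimod_prim _ _ _ _ Hu) as (_ & _ & P3).
  destruct (E_bound _ _ P3) as [EP _]. assert (HP := hl_pos f _ _ Hf P3).
  set (e3 := E (a + c)%Z (b + d)%Z / hl f (a + c) (b + d)).
  assert (He3 : 0 < e3) by (now apply Rdiv_lt_0_compat).
  set (e := Rmin e1 (Rmin e2 e3)). assert (He : 0 < e) by (unfold e; repeat apply Rmin_glb_lt; assumption).
  assert (L1 : e <= e1) by apply Rmin_l.
  assert (L2 : e <= e2) by (eapply Rle_trans; [apply Rmin_r|apply Rmin_l]).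
  assert (L3 : e <= e3) by (eapply Rle_trans; [apply Rmin_r|apply Rmin_r]).
  destruct (HB e He) as (i & j & Hi & Hj & Hg & HE). revert HE. apply Rle_not_lt.
  pose proof (hl_pos f _ _ Hf (cone_prim _ _ _ _ _ _ Hu Hg)) as Hh.
  destruct (Z.lt_total i j) as [H|[H|H]].
  - replace (i * a + j * c)%Z with (i * (a + c) + (j - i) * c)%Z in * by ring.
    replace (i * b + j * d)%Z with (i * (b + d) + (j - i) * d)%Z in * by ring.
    eapply Rle_trans; [|apply K2; try lia; now rewrite Z.gcd_sub_diag_r].
    apply Rmult_le_compat_r; lra.
  - subst j. rewrite Z.gcd_diag in Hg. assert (i = 1)%Z as -> by lia.
    rewrite !Z.mul_1_l in *. apply (Rle_trans _ (e3 * hl f (a + c) (b + d))).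
    + apply Rmult_le_compat_r; lra.
    + right. unfold e3. field. lra.
  - replace (i * a + j * c)%Z with ((i - j) * a + j * (a + c))%Z in * by ring.
    replace (i * b + j * d)%Z with ((i - j) * b + j * (b + d))%Z in * by ring.
    eapply Rle_trans; [|apply K1; try lia; now rewrite Z.gcd_comm, Z.gcd_sub_diag_r, Z.gcd_comm].
    apply Rmult_le_compat_r; lra.
Qed.

(** If both ends have E >= e = 2 k1 / Pi, then E - e / 2 is superadditive throughout the cone,
    because the error k1 / (product of traces) never exceeds e / 2. Lengths being subadditive, E /
    hl stays bounded below, so the cone is not bad. *)
Lemma bad_min a b c d : Out f a b c d -> Bad a b c d -> N0 <= f a b * f c d ->
  E a b < 2 * k1 / (f a b * f c d) \/ E c d < 2 * k1 / (f a b * f c d).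
Proof.
  intros HO HB HN. destruct (Rlt_dec (E a b) (2 * k1 / (f a b * f c d))) as [H|H1]; [now left|right].
  apply Rnot_le_lt. intros H2. apply Rnot_lt_le in H1.
  set (Pi := f a b * f c d) in *. assert (Hk := k1_pos).
  destruct (unimod_prim _ _ _ _ (proj1 HO)) as (P1 & P2 & _).
  assert (G1 := f_ge_x0 _ _ P1). assert (G2 := f_ge_x0 _ _ P2). assert (Hx := x0_gt_2).
  assert (HPi : 0 < Pi) by (unfold Pi; apply Rmult_lt_0_compat; lra).
  set (e := 2 * k1 / Pi) in *. assert (He : 0 < e) by (unfold e; apply Rdiv_lt_0_compat; lra).
  assert (Eke : k1 / Pi = e / 2) by (unfold e; field; lra).
  set (H := Rmax (hl f a b) (hl f c d)).
  assert (HH : 0 < H) by (eapply Rlt_le_trans; [apply (hl_pos f _ _ Hf P1)|apply Rmax_l]).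
  set (eps := e / (2 * H)). assert (Heps : 0 < eps) by (unfold eps; apply Rdiv_lt_0_compat; lra).
  assert (EH : eps * H = e / 2) by (unfold eps; field; lra).
  (* E - e/2 is superadditive on the cone *)
  pose (Q := fun r s t u => Out f r s t u /\ Pi <= f r s * f t u /\
     eps * hl f r s + e / 2 <= E r s /\ eps * hl f t u + e / 2 <= E t u).
  assert (Hmid : forall r s t u, Q r s t u -> eps * hl f (r + t) (s + u) + e / 2 <= E (r + t)%Z (s + u)%Z).
  { intros r s t u (O1 & O2 & O3 & O4). destruct (E_superadditive _ _ _ _ O1 ltac:(lra)) as [S1 S2].
    assert (k1 / (f r s * f t u) <= e / 2).
    { rewrite <- Eke. apply Rmult_le_compat_l; [lra|]. apply Rinv_le_contravar; lra. }
    assert (eps * hl f (r + t) (s + u) <= eps * (hl f r s + hl f t u)) by (apply Rmult_le_compat_l; lra). lra. }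
  assert (Hpos : forall r s t u, Out f r s t u -> 2 < f r s /\ 2 < f t u).
  { intros r s t u O. destruct (unimod_prim _ _ _ _ (proj1 O)) as (R1 & R2 & _).
    generalize (f_ge_x0 _ _ R1) (f_ge_x0 _ _ R2). lra. }
  assert (QL : forall r s t u, Q r s t u -> Q r s (r + t)%Z (s + u)%Z).
  { intros r s t u HQ. pose proof (Hmid _ _ _ _ HQ) as Hm. destruct HQ as (O1 & O2 & O3 & O4).
    destruct (out_growth f _ _ _ _ Hf O1) as (W1 & W2 & _). destruct (Hpos _ _ _ _ O1).
    split; [now apply out_l|]. split; [|tauto]. eapply Rle_trans; [exact O2|]. apply Rmult_le_compat_l; lra. }
  assert (QR : forall r s t u, Q r s t u -> Q (r + t)%Z (s + u)%Z t u).
  { intros r s t u HQ. pose proof (Hmid _ _ _ _ HQ) as Hm. destruct HQ as (O1 & O2 & O3 & O4).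
    destruct (out_growth f _ _ _ _ Hf O1) as (W1 & W2 & _). destruct (Hpos _ _ _ _ O1).
    split; [now apply out_r|]. split; [|tauto]. eapply Rle_trans; [exact O2|]. apply Rmult_le_compat_r; lra. }
  assert (Q0 : Q a b c d).
  { split; [exact HO|]. split; [unfold Pi; lra|]. split.
    - assert (eps * hl f a b <= eps * H) by (apply Rmult_le_compat_l; [lra|apply Rmax_l]). lra.
    - assert (eps * hl f c d <= eps * H) by (apply Rmult_le_compat_l; [lra|apply Rmax_r]). lra. }
  destruct (HB eps Heps) as (i & j & Hi & Hj & Hg & HE).
  destruct (cone_ind Q QL QR _ _ _ _ i j Q0 Hi Hj Hg) as (r & s & t & u & HQ & E1 & E2).
  rewrite E1, E2 in HE. generalize (Hmid _ _ _ _ HQ). lra.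
Qed.

(** Otherwise E / hl would be bounded below on the three cones and at the three vertices of the
    root, and the norm of [y0] would be less than 1. *)
Lemma bad_exists : exists a b c d, Out f a b c d /\ Bad a b c d.
Proof.
  destruct (root_out f Hf HR) as (O1 & O2 & O3).
  apply NNPP. intros HN.
  assert (NB : forall a b c d, Out f a b c d -> ~ Bad a b c d).
  { intros a b c d HO HB. apply HN. exists a, b, c, d. tauto. }
  destruct (not_bad _ _ _ _ (NB _ _ _ _ O1)) as (e1 & He1 & K1).
  destruct (not_bad _ _ _ _ (NB _ _ _ _ O2)) as (e2 & He2 & K2).
  destruct (not_bad _ _ _ _ (NB _ _ _ _ O3)) as (e3 & He3 & K3).
  assert (Hsm : forall p q, prim p q -> 0 < E p q / hl f p q /\ E p q / hl f p q * hl f p q <= E p q).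
  { intros p q Hp. assert (Hh := hl_pos f p q Hf Hp). destruct (E_bound p q Hp). split.
    - now apply Rdiv_lt_0_compat.
    - right. field. lra. }
  destruct (Hsm _ _ prim_10) as [H4 K4]. destruct (Hsm _ _ prim_01) as [H5 K5]. destruct (Hsm _ _ prim_11) as [H6 K6].
  set (e4 := E 1%Z 0%Z / hl f 1 0) in *. set (e5 := E 0%Z 1%Z / hl f 0 1) in *. set (e6 := E 1%Z 1%Z / hl f 1 1) in *.
  set (e := Rmin e1 (Rmin e2 (Rmin e3 (Rmin e4 (Rmin e5 e6))))).
  assert (He : 0 < e) by (unfold e; repeat apply Rmin_glb_lt; assumption).
  assert (L : e <= e1 /\ e <= e2 /\ e <= e3 /\ e <= e4 /\ e <= e5 /\ e <= e6).
  { unfold e. generalize (Rmin_l e1 (Rmin e2 (Rmin e3 (Rmin e4 (Rmin e5 e6))))) (Rmin_r e1 (Rmin e2 (Rmin e3 (Rmin e4 (Rmin e5 e6)))))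
      (Rmin_l e2 (Rmin e3 (Rmin e4 (Rmin e5 e6)))) (Rmin_r e2 (Rmin e3 (Rmin e4 (Rmin e5 e6))))
      (Rmin_l e3 (Rmin e4 (Rmin e5 e6))) (Rmin_r e3 (Rmin e4 (Rmin e5 e6)))
      (Rmin_l e4 (Rmin e5 e6)) (Rmin_r e4 (Rmin e5 e6)) (Rmin_l e5 e6) (Rmin_r e5 e6). lra. }
  destruct L as (L1 & L2 & L3 & L4 & L5 & L6).
  apply (Bnot (1 - e)); [lra|].
  enough (H : forall p q, prim p q -> e * hl f p q <= E p q).
  { intros p q Hp. specialize (H p q Hp). unfold E in H. lra. }
  assert (Up : forall p q e', prim p q -> e <= e' -> e' * hl f p q <= E p q -> e * hl f p q <= E p q).
  { intros p q e' Hp Hle H. assert (Hh := hl_pos f p q Hf Hp). eapply Rle_trans; [|exact H]. apply Rmult_le_compat_r; lra. }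
  apply root_cases.
  - intros p q Hp H. rewrite E_even, hl_even; try assumption. apply Hf.
  - apply (Up _ _ e4); [reflexivity|assumption|assumption].
  - apply (Up _ _ e5); [reflexivity|assumption|assumption].
  - apply (Up _ _ e6); [reflexivity|assumption|assumption].
  - intros i j Hi Hj Hg. apply (Up _ _ e1); [apply (cone_prim 1 0 1 1); [apply O1|exact Hg]|exact L1|now apply K1].
  - intros i j Hi Hj Hg. apply (Up _ _ e2); [apply (cone_prim 1 1 0 1); [apply O2|exact Hg]|exact L2|now apply K2].
  - intros i j Hi Hj Hg. apply (Up _ _ e3); [apply (cone_prim 1 0 0 (-1)); [apply O3|exact Hg]|exact L3|now apply K3].
Qed.

Let rho := x0 / 2.

Lemma out_product_growth a b c d : Out f a b c d ->
  rho * f c d <= f (a + c)%Z (b + d)%Z /\ rho * f a b <= f (a + c)%Z (b + d)%Z.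
Proof.
  intros [Hu HO]. destruct (unimod_prim _ _ _ _ Hu) as (P1 & P2 & _).
  assert (G1 := f_ge_x0 _ _ P1). assert (G2 := f_ge_x0 _ _ P2). assert (Hx := x0_gt_2).
  assert (x0 * f c d <= f a b * f c d) by (apply Rmult_le_compat_r; lra).
  assert (f a b * x0 <= f a b * f c d) by (apply Rmult_le_compat_l; lra).
  unfold rho. lra.
Qed.

Lemma rho_gt_1 : 1 < rho.
Proof. unfold rho. generalize x0_gt_2. lra. Qed.

Lemma rho_large N : exists n, N <= rho ^ n.
Proof.
  destruct (Pow_x_infinity rho) with (b := N) as (n & Hn).
  - rewrite Rabs_right; generalize rho_gt_1; lra.
  - exists n. specialize (Hn n (le_n _)). rewrite Rabs_right in Hn; [lra|].
    apply Rle_ge, pow_le. generalize rho_gt_1. lra.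
Qed.

Lemma bad_large N : exists a b c d, Out f a b c d /\ Bad a b c d /\ N <= f a b * f c d.
Proof.
  destruct (rho_large N) as (n & Hn).
  enough (H : exists a b c d, Out f a b c d /\ Bad a b c d /\ rho ^ n <= f a b * f c d).
  { destruct H as (a & b & c & d & H1 & H2 & H3). exists a, b, c, d. repeat (split; [assumption|]). lra. }
  clear Hn N. assert (Hx := x0_gt_2). assert (Hrho := rho_gt_1).
  induction n as [|n (a & b & c & d & HO & HB & Hn)].
  - destruct bad_exists as (a & b & c & d & HO & HB). exists a, b, c, d. repeat (split; [assumption|]).
    destruct (unimod_prim _ _ _ _ (proj1 HO)) as (P1 & P2 & _).
    generalize (f_ge_x0 _ _ P1) (f_ge_x0 _ _ P2). simpl. nra.
  - destruct (unimod_prim _ _ _ _ (proj1 HO)) as (P1 & P2 & _).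
    pose proof (f_ge_x0 _ _ P1) as G1. pose proof (f_ge_x0 _ _ P2) as G2.
    destruct (out_product_growth _ _ _ _ HO) as [W1 W2]. simpl.
    assert (rho * rho ^ n <= rho * (f a b * f c d)) by (apply Rmult_le_compat_l; lra).
    destruct (bad_split _ _ _ _ (proj1 HO) HB) as [HB'|HB'].
    + exists a, b, (a + c)%Z, (b + d)%Z. split; [now apply out_l|]. split; [exact HB'|].
      assert (f a b * (rho * f c d) <= f a b * f (a + c)%Z (b + d)%Z) by (apply Rmult_le_compat_l; lra). lra.
    + exists (a + c)%Z, (b + d)%Z, c, d. split; [now apply out_r|]. split; [exact HB'|].
      assert (rho * f a b * f c d <= f (a + c)%Z (b + d)%Z * f c d) by (apply Rmult_le_compat_r; lra). lra.
Qed.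

Lemma hl_le_ln p q : prim p q -> hl f p q <= ln (f p q).
Proof.
  intros Hp. rewrite (hl_cosh f p q Hf Hp). rewrite <- (ln_exp (hl f p q)) at 1.
  apply ln_le; [apply exp_pos|]. unfold cosh. generalize (exp_pos (- hl f p q)). lra.
Qed.

(** By [wedge_area] the wedge of [y0] and [dl] has size 4 |k| R, comparable to S = sinh p sinh q,
    while in half lengths it is 4 S times (p - e1) d2 - (q - e2) d1, with |d1| <= e1 and |d2| <= e2.
    Cancelling S leaves a positive lower bound; k is nonzero by independence. *)
Lemma wedge_bound : exists k0, 0 < k0 /\ forall a b c d, Out f a b c d -> N0 <= f a b * f c d ->
  k0 <= hl f a b * E c d + hl f c d * E a b + 2 * (E a b * E c d).
Proof.
  destruct (wedge_area f y0 dl Hf Hy Hd) as (k & Hk).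
  assert (Hk0 : k <> 0).
  { intros ->. 
    assert (Z0 : forall r s, (r * y0 1%Z 0%Z + s * dl 1%Z 0%Z = 0) -> (r * y0 0%Z 1%Z + s * dl 0%Z 1%Z = 0) ->
       (r * y0 1%Z 1%Z + s * dl 1%Z 1%Z = 0) -> r = 0 /\ s = 0).
    { intros r s E1 E2 E3. apply Indep. intros p q. apply (dtrace_unique f (lc r s y0 dl) (fun _ _ => 0)).
      - apply dtrace_lc; [apply Hy|apply Hd].
      - split; [intros ? ? _; reflexivity|intros; ring].
      - exact E1.
      - exact E2.
      - exact E3. }
    pose proof (Hk 1 0 0 1 eq_refl)%Z as W1. pose proof (Hk 1 0 1 1 eq_refl)%Z as W3.
    pose proof (Hk 1 1 0 1 eq_refl)%Z as W4.
    rewrite Rmult_0_l in W1, W3, W4. unfold wedge in *.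
    destruct (Z0 (dl 1%Z 0%Z) (- y0 1%Z 0%Z)) as [_ A1]; [ring|lra|lra|].
    destruct (Z0 (dl 0%Z 1%Z) (- y0 0%Z 1%Z)) as [_ A2]; [lra|ring|lra|].
    destruct (Z0 (dl 1%Z 1%Z) (- y0 1%Z 1%Z)) as [_ A3]; [lra|lra|ring|].
    destruct (Z0 1 0) as [A4 _]; lra. }
  exists (Rabs k / 2). split; [generalize (Rabs_pos_lt k Hk0); lra|].
  intros a b c d [Hu HO] HN. destruct (unimod_prim _ _ _ _ Hu) as (P1 & P2 & P3).
  assert (HW : Rabs (wedge y0 dl a b c d) = Rabs k * (2 * f (a + c)%Z (b + d)%Z - f a b * f c d)).
  { destruct Hu as [Hu|Hu].
    - rewrite (Hk a b c d Hu), Rabs_mult. f_equal. apply Rabs_right. lra.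
    - replace (wedge y0 dl a b c d) with (- wedge y0 dl c d a b) by (unfold wedge; ring).
      rewrite Rabs_Ropp, (Hk c d a b) by lia. rewrite (Z.add_comm c a), (Z.add_comm d b), (Rmult_comm (f c d)), Rabs_mult.
      f_equal. apply Rabs_right. lra. }
  pose proof (markov_eq_unimod f _ _ _ _ Hf Hu) as EF.
  destruct (E_bound _ _ P1) as [E1 D1]. destruct (E_bound _ _ P2) as [E2 D2].
  unfold wedge in HW. rewrite (dhl_sinh f y0 a b), (dhl_sinh f y0 c d), (dhl_sinh f dl a b), (dhl_sinh f dl c d) in HW by assumption.
  assert (G1 := gam_sinh _ _ P1). assert (G2 := gam_sinh _ _ P2).
  unfold N0 in HN. destruct gam_bounds as [Hg0 Hg1].
  rewrite (hl_cosh f a b), (hl_cosh f c d), (hl_cosh f (a + c) (b + d)) in EF, HW, HO by assumption.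
  rewrite (hl_cosh f a b), (hl_cosh f c d) in HN by assumption.
  assert (Hp := hl_pos f _ _ Hf P1). assert (Hq := hl_pos f _ _ Hf P2).
  assert (Ey1 : dhl f y0 a b = hl f a b - E a b) by (unfold E; ring).
  assert (Ey2 : dhl f y0 c d = hl f c d - E c d) by (unfold E; ring).
  rewrite Ey1, Ey2 in HW.
  set (p := hl f a b) in *. set (q := hl f c d) in *. set (r := hl f (a + c)%Z (b + d)%Z) in *.
  set (d1 := dhl f dl a b) in *. set (d2 := dhl f dl c d) in *. set (e1 := E a b) in *. set (e2 := E c d) in *.
  assert (Cp := cosh_ge_1 p). assert (Cq := cosh_ge_1 q).
  assert (Sp := sinh_pos p Hp). assert (Sq := sinh_pos q Hq).
  assert (Hcs1 := cosh_sinh_sq p). assert (Hcs2 := cosh_sinh_sq q).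
  assert (gg : 0 < gam * gam) by (now apply Rmult_lt_0_compat).
  assert (HS : 2 <= sinh p * sinh q).
  { assert (X : 8 <= gam * gam * (2 * cosh p * (2 * cosh q))).
    { apply (Rmult_le_compat_l (gam * gam)) in HN; [|lra].
      replace (gam * gam * (8 / (gam * gam))) with 8 in HN by (field; lra). exact HN. }
    assert ((gam * cosh p) * (gam * cosh q) <= sinh p * sinh q) by (apply Rmult_le_compat; try assumption; nra). lra. }
  set (R := cosh r - cosh p * cosh q).
  assert (ER : R * R = (sinh p * sinh q) * (sinh p * sinh q) - 1).
  { replace ((sinh p * sinh q) * (sinh p * sinh q)) with ((sinh p * sinh p) * (sinh q * sinh q)) by ring.
    replace (sinh p * sinh p) with (cosh p * cosh p - 1) by lra. replace (sinh q * sinh q) with (cosh q * cosh q - 1) by lra.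
    unfold R. lra. }
  assert (HR0 : 0 <= R) by (unfold R; lra).
  set (S := sinh p * sinh q) in *.
  assert (HRS : S <= 2 * R) by nra.
  replace (2 * sinh p * (p - e1) * (2 * sinh q * d2) - 2 * sinh q * (q - e2) * (2 * sinh p * d1))
    with (4 * S * ((p - e1) * d2 - (q - e2) * d1)) in HW by (unfold S; ring).
  replace (2 * (2 * cosh r) - 2 * cosh p * (2 * cosh q)) with (4 * R) in HW by (unfold R; ring).
  rewrite Rabs_mult, (Rabs_right (4 * S)) in HW by lra.
  assert (HB : Rabs ((p - e1) * d2 - (q - e2) * d1) <= (p + e1) * e2 + (q + e2) * e1).
  { eapply Rle_trans; [apply Rabs_triang|]. rewrite Rabs_Ropp, !Rabs_mult.
    apply Rplus_le_compat; apply Rmult_le_compat; try apply Rabs_pos; try assumption; apply Rabs_le; lra. }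
  assert (HK : Rabs k * S <= Rabs k * (2 * R)) by (apply Rmult_le_compat_l; [apply Rabs_pos|exact HRS]).
  assert (HL : S * (Rabs k / 2) <= S * Rabs ((p - e1) * d2 - (q - e2) * d1)) by lra.
  apply Rmult_le_reg_l in HL; [|lra]. lra.
Qed.

(** In a bad cone far out, one end u has a tiny defect. By [wedge_bound] its neighbours do not, so
    the bad subcone always keeps u as an end: the Farey path turns around u forever. Then E u is
    bounded by quantities tending to 0, although it is positive. *)
Lemma bad_contradiction : False.
Proof.
  destruct wedge_bound as (k0 & Hk0 & HW). assert (Hk := k1_pos). assert (Hx := x0_gt_2).
  assert (Hrho := rho_gt_1).
  (* The square comes from ln Pi <= 2 sqrt Pi, used to get 4 k1 (ln Pi + 2) <= k0 Pi. *)
  set (Pi0 := Rmax (Rmax 1 N0) (Rmax (2 * k1) (16 * k1 / k0 * (16 * k1 / k0)))).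
  assert (HPi0 : forall Pi, Pi0 <= Pi -> 1 <= Pi /\ N0 <= Pi /\ 2 * k1 <= Pi /\ 4 * k1 * (ln Pi + 2) <= k0 * Pi).
  { intros Pi H.
    assert (H1 : 1 <= Pi) by (eapply Rle_trans; [|exact H]; unfold Pi0; rewrite !Rmax_Rle; lra).
    assert (H2 : N0 <= Pi) by (eapply Rle_trans; [|exact H]; unfold Pi0; rewrite !Rmax_Rle; lra).
    assert (H3 : 2 * k1 <= Pi) by (eapply Rle_trans; [|exact H]; unfold Pi0; rewrite !Rmax_Rle; lra).
    assert (H4 : 16 * k1 / k0 * (16 * k1 / k0) <= Pi) by (eapply Rle_trans; [|exact H]; unfold Pi0; rewrite !Rmax_Rle; lra).
    repeat (split; [assumption|]).
    assert (Hl := ln_le_sqrt Pi ltac:(lra)). assert (Hss := sqrt_sqrt Pi ltac:(lra)). assert (Hs := sqrt_pos Pi).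
    set (s := sqrt Pi) in *.
    assert (Hs1 : 1 <= s) by nra.
    assert (H5 : 16 * k1 / k0 <= s).
    { apply Rnot_lt_le. intros Hlt. assert (s * s < 16 * k1 / k0 * (16 * k1 / k0)) by (apply Rmult_le_0_lt_compat; lra). lra. }
    apply (Rmult_le_compat_l k0) in H5; [|lra]. replace (k0 * (16 * k1 / k0)) with (16 * k1) in H5 by (field; lra).
    assert (H6 : 4 * k1 * (ln Pi + 2) <= 4 * k1 * (4 * s)) by (apply Rmult_le_compat_l; lra).
    assert (H7 : 16 * k1 * s <= k0 * s * s) by (apply Rmult_le_compat_r; lra).
    replace (k0 * s * s) with (k0 * (s * s)) in H7 by ring. rewrite Hss in H7. lra. }
  (* Since the wedge is bounded below, a curve of the pair with tiny E forces E of its neighbours to be bounded below *)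
  assert (Big : forall a b c d Pi, Out f a b c d -> Pi0 <= Pi -> Pi <= f a b * f c d -> f a b <= Pi -> f c d <= Pi ->
     E a b < 2 * k1 / Pi -> k0 / (2 * (ln Pi + 2)) <= E c d).
  { intros a b c d Pi HO H0 HP Ha Hc He. destruct (HPi0 Pi H0) as (A1 & A2 & A3 & A4).
    destruct (unimod_prim _ _ _ _ (proj1 HO)) as (P1 & P2 & _).
    specialize (HW a b c d HO ltac:(lra)).
    assert (G1 := f_ge_x0 _ _ P1). assert (G2 := f_ge_x0 _ _ P2).
    assert (L1 : hl f a b <= ln Pi) by (eapply Rle_trans; [now apply hl_le_ln|apply ln_le; lra]).
    assert (L2 : hl f c d <= ln Pi) by (eapply Rle_trans; [now apply hl_le_ln|apply ln_le; lra]).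
    assert (Hh1 := hl_pos f _ _ Hf P1). assert (Hh2 := hl_pos f _ _ Hf P2).
    destruct (E_bound _ _ P1) as [E1 _]. destruct (E_bound _ _ P2) as [E2 _].
    assert (B1 : E a b <= 1).
    { left. eapply Rlt_le_trans; [exact He|]. apply (Rmult_le_reg_r Pi); [lra|]. 
      replace (2 * k1 / Pi * Pi) with (2 * k1) by (field; lra). lra. }
    assert (B2 : hl f c d * E a b <= k0 / 2).
    { apply (Rle_trans _ (ln Pi * (2 * k1 / Pi))); [apply Rmult_le_compat; lra|].
      apply (Rmult_le_reg_r Pi); [lra|]. replace (ln Pi * (2 * k1 / Pi) * Pi) with (2 * k1 * ln Pi) by (field; lra). lra. }
    assert (B3 : hl f a b * E c d <= ln Pi * E c d) by (apply Rmult_le_compat_r; lra).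
    assert (B4 : E a b * E c d <= 1 * E c d) by (apply Rmult_le_compat_r; lra).
    apply (Rmult_le_reg_r (2 * (ln Pi + 2))); [lra|].
    replace (k0 / (2 * (ln Pi + 2)) * (2 * (ln Pi + 2))) with k0 by (field; lra). lra. }
  (* Both v and u + v have too large a defect to satisfy [bad_min], so their cone is not bad, and in
     the cone of u and u + v the small end is u again. *)
  assert (Step : forall a b c d, Out f a b c d -> Bad a b c d -> Pi0 <= f a b * f c d ->
     E a b < 2 * k1 / (f a b * f c d) ->
     Bad a b (a + c) (b + d) /\ E a b < 2 * k1 / (f a b * f (a + c)%Z (b + d)%Z)).
  { intros a b c d HO HB H0 He. set (Pi := f a b * f c d) in *. destruct (HPi0 Pi H0) as (A1 & A2 & A3 & A4).
    destruct (unimod_prim _ _ _ _ (proj1 HO)) as (P1 & P2 & P3).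
    assert (G1 := f_ge_x0 _ _ P1). assert (G2 := f_ge_x0 _ _ P2). assert (G3 := f_ge_x0 _ _ P3).
    destruct (out_growth f _ _ _ _ Hf HO) as (W1 & W2 & W3). fold Pi in W3.
    assert (F1 : f a b <= Pi) by lra. assert (F2 : f c d <= Pi) by lra.
    assert (Q1 : Pi <= f a b * f (a + c)%Z (b + d)%Z) by (apply Rmult_le_compat_l; lra).
    assert (Q2 : Pi <= f (a + c)%Z (b + d)%Z * f c d) by (apply Rmult_le_compat_r; lra).
    assert (HlnPi : 0 <= ln Pi) by (rewrite <- ln_1; apply ln_le; lra).
    assert (Ec := Big a b c d Pi HO H0 (Rle_refl _) F1 F2 He).
    assert (Em := Big a b (a + c)%Z (b + d)%Z Pi (out_l f _ _ _ _ Hf HO) H0 Q1 F1 W3 He).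
    assert (Cut : forall Pi', Pi <= Pi' -> 2 * k1 / Pi' <= k0 / (2 * (ln Pi + 2))).
    { intros Pi' HP. apply (Rle_trans _ (2 * k1 / Pi)).
      - apply Rmult_le_compat_l; [lra|]. apply Rinv_le_contravar; lra.
      - apply (Rmult_le_reg_r (Pi * (2 * (ln Pi + 2)))); [apply Rmult_lt_0_compat; lra|].
        replace (2 * k1 / Pi * (Pi * (2 * (ln Pi + 2)))) with (4 * k1 * (ln Pi + 2)) by (field; lra).
        replace (k0 / (2 * (ln Pi + 2)) * (Pi * (2 * (ln Pi + 2)))) with (k0 * Pi) by (field; lra). exact A4. }
    assert (HB' : Bad a b (a + c) (b + d)).
    { destruct (bad_split _ _ _ _ (proj1 HO) HB) as [|HB2]; [assumption|exfalso].
      specialize (Cut _ Q2).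
      destruct (bad_min _ _ _ _ (out_r f _ _ _ _ Hf HO) HB2 ltac:(lra)); lra. }
    split; [exact HB'|]. specialize (Cut _ Q1).
    destruct (bad_min _ _ _ _ (out_l f _ _ _ _ Hf HO) HB' ltac:(lra)); lra. }
  assert (Iter : forall a b c d, Out f a b c d -> Bad a b c d -> Pi0 <= f a b * f c d ->
     E a b < 2 * k1 / (f a b * f c d) -> False).
  { intros a b c d HO HB H0 He.
    destruct (unimod_prim _ _ _ _ (proj1 HO)) as (P1 & _ & _).
    destruct (E_bound _ _ P1) as [E1 _]. assert (G1 := f_ge_x0 _ _ P1).
    assert (All : forall n, exists c d, Out f a b c d /\ Bad a b c d /\ Pi0 <= f a b * f c d /\ rho ^ n <= f c d /\
       E a b < 2 * k1 / (f a b * f c d)).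
    { induction n as [|n (c' & d' & O & B & H1 & H2 & H3)].
      - exists c, d. repeat (split; [assumption|]). split; [|exact He].
        destruct (unimod_prim _ _ _ _ (proj1 HO)) as (_ & P2 & _). generalize (f_ge_x0 _ _ P2). simpl. lra.
      - destruct (Step _ _ _ _ O B H1 H3) as [B' E']. destruct (out_product_growth _ _ _ _ O) as [W _].
        destruct (out_growth f _ _ _ _ Hf O) as (_ & W2 & _).
        exists (a + c')%Z, (b + d')%Z. split; [now apply out_l|]. split; [exact B'|]. split; [|split; [|exact E']].
        + eapply Rle_trans; [exact H1|]. apply Rmult_le_compat_l; lra.
        + simpl. assert (rho * rho ^ n <= rho * f c' d') by (apply Rmult_le_compat_l; lra). lra. }
    destruct (rho_large (2 * k1 / E a b)) as (n & Hn).
    destruct (All n) as (c' & d' & O & _ & _ & H2 & H3).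
    destruct (unimod_prim _ _ _ _ (proj1 O)) as (_ & P2 & _). assert (G2 := f_ge_x0 _ _ P2).
    assert (X : 2 * k1 <= E a b * f c' d').
    { apply (Rmult_le_compat_l (E a b)) in Hn; [|lra]. replace (E a b * (2 * k1 / E a b)) with (2 * k1) in Hn by (field; lra).
      assert (E a b * rho ^ n <= E a b * f c' d') by (apply Rmult_le_compat_l; lra). lra. }
    apply (Rmult_lt_compat_r (f a b * f c' d')) in H3; [|apply Rmult_lt_0_compat; lra].
    replace (2 * k1 / (f a b * f c' d') * (f a b * f c' d')) with (2 * k1) in H3 by (field; lra).
    assert (1 * (E a b * f c' d') <= f a b * (E a b * f c' d')) by (apply Rmult_le_compat_r; lra). lra. }
  destruct (bad_large Pi0) as (a & b & c & d & HO & HB & H0).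
  destruct (HPi0 _ H0) as (_ & A2 & _).
  destruct (bad_min _ _ _ _ HO HB A2) as [H|H].
  - exact (Iter a b c d HO HB H0 H).
  - rewrite (Rmult_comm (f a b)) in H, H0. exact (Iter c d a b (out_sym _ _ _ _ _ HO) (bad_sym _ _ _ _ HB) H0 H).
Qed.

End Attained.

Lemma attained f y0 dl : Markov f -> Tan f y0 -> Tan f dl ->
  Bnd f (lc 1 1 y0 dl) 1 -> Bnd f (lc 1 (-1) y0 dl) 1 -> (forall K, K < 1 -> ~ Bnd f y0 K) ->
  (forall r s, eqp (lc r s y0 dl) (fun _ _ => 0) -> r = 0 /\ s = 0) ->
  exists p q, prim p q /\ dhl f y0 p q = hl f p q.
Proof.
  intros Hf Hy Hd B1 B2 Bn Hi. apply NNPP. intros HN.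
  destruct (root_exists f Hf) as (g & R & HR). pose proof (reach_markov _ _ Hf R) as Hg.
  destruct R as (a & b & c & d & Hu & E).
  assert (HE : eqp (cob a b c d f) g) by (intros p q _; symmetry; apply E).
  destruct (unimod_inv a b c d Hu) as (a' & b' & c' & d' & Hu' & HM).
  assert (TB : forall h K, Bnd f h K <-> Bnd g (cob a b c d h) K).
  { intros h K. rewrite (bnd_cob a b c d f h K Hu). unfold Bnd, dhl, hl. 
    split; intros H p q Hp; specialize (H p q Hp); [rewrite !E|rewrite !E in H]; exact H. }
  apply (bad_contradiction g (cob a b c d y0) (cob a b c d dl)); try assumption.
  - apply (tan_eqp (cob a b c d f) _ (cob a b c d y0)); [exact HE|intros p q _; reflexivity|now apply tan_cob].
  - apply (tan_eqp (cob a b c d f) _ (cob a b c d dl)); [exact HE|intros p q _; reflexivity|now apply tan_cob].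
  - apply (TB (lc 1 1 y0 dl) 1). exact B1.
  - apply (TB (lc 1 (-1) y0 dl) 1). exact B2.
  - intros K HK H. apply (Bn K HK). now apply TB.
  - intros r s H. apply Hi. intros p q Hp. destruct (HM p q) as (E1 & E2 & _).
    specialize (H (a' * p + b' * q) (c' * p + d' * q) (gcd_mat _ _ _ _ _ _ Hu' Hp))%Z.
    unfold lc, cob in *. rewrite E1, E2 in H. exact H.
  - intros p q Hp H. apply HN. exists (a * p + b * q)%Z, (c * p + d * q)%Z.
    split; [now apply gcd_mat|]. unfold dhl, hl, cob in *. rewrite E in H. exact H.
Qed.

(** * Matching of curves under an isometry *)

Definition samepm (p q r s : Z) : Prop := (p = r /\ q = s)%Z \/ (p = - r /\ q = - s)%Z.

(** The isometry carries the facet of (m, k) into the facet of (m', k'). *)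
Definition Match (f f' : Z -> Z -> R) Rl (m k m' k' : Z) : Prop :=
  prim m k /\ prim m' k' /\ exists gp gm gp' gm', CornerData f m k gp gm /\ Rl gp gp' /\ Rl gm gm' /\
    dhl f' gp' m' k' = hl f' m' k' /\ dhl f' gm' m' k' = hl f' m' k'.

(** The image of a facet is a flat arc of norm one, so by [attained] some curve attains the norm at
    its midpoint. That curve attains it at both ends too, since the average of two numbers at most
    [hl] equals [hl]. *)
Lemma match_exists f f' Rl m k : Markov f -> Markov f' -> IsoRel f f' Rl -> prim m k ->
  exists m' k', Match f f' Rl m k m' k'.
Proof.
  intros Hf Hf' (I1 & I2 & I3 & I4 & I5) Hp.
  destruct (corner_data f m k Hf Hp) as (gp & gm & HC). pose proof HC as (Tp & Tm & Dp & Dm & Bp & Bm & Hne & _).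
  destruct (I2 gp Tp) as (gp' & Rp). destruct (I2 gm Tm) as (gm' & Rm).
  destruct (I1 _ _ Rp) as [_ Tp']. destruct (I1 _ _ Rm) as [_ Tm'].
  set (y0 := lc (/ 2) (/ 2) gp gm). set (dl := lc (/ 2) (- / 2) gp gm).
  set (y0' := lc (/ 2) (/ 2) gp' gm'). set (dl' := lc (/ 2) (- / 2) gp' gm').
  assert (Ry : Rl y0 y0') by now apply I3. assert (Rd : Rl dl dl') by now apply I3.
  assert (Hh := hl_pos f m k Hf Hp).
  assert (Bp' : Bnd f' gp' 1) by now apply (I5 gp gp' 1 Rp). assert (Bm' : Bnd f' gm' 1) by now apply (I5 gm gm' 1 Rm).
  destruct (attained f' y0' dl') as (m' & k' & Hp' & E).
  - exact Hf'.
  - now apply tan_lc.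
  - now apply tan_lc.
  - apply (bnd_eqp _ gp'); [|exact Bp']. intros p q _. unfold lc, y0', dl', lc. field.
  - apply (bnd_eqp _ gm'); [|exact Bm']. intros p q _. unfold lc, y0', dl', lc. field.
  - intros K HK HB. apply (I5 y0 y0' K Ry) in HB. specialize (HB m k Hp).
    unfold y0 in HB. rewrite dhl_lc, Dp, Dm in HB. nra.
  - intros r s H0.
    assert (H1 : eqp (lc r s y0 dl) (lc 0 0 gp gm)).
    { apply (I4 _ (lc r s y0' dl') _ (lc 0 0 gp' gm')); [now apply I3|now apply I3|].
      intros p q Hpq. rewrite H0 by exact Hpq. unfold lc. ring. }
    assert (Hr : r = 0).
    { assert (E := dhl_eqp f _ _ m k H1 Hp). unfold y0, dl in E. rewrite !dhl_lc, Dp, Dm in E. nra. }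
    split; [exact Hr|]. destruct (Req_dec s 0) as [|Hs]; [assumption|exfalso]. apply Hne.
    intros p q Hpq. specialize (H1 p q Hpq). rewrite Hr in H1. unfold y0, dl, lc in H1.
    apply (Rmult_eq_reg_l (s * / 2)); [lra|]. intros E. apply Hs. lra.
  - exists m', k'. split; [exact Hp|]. split; [exact Hp'|]. exists gp, gm, gp', gm'.
    split; [exact HC|]. split; [exact Rp|]. split; [exact Rm|].
    unfold y0' in E. rewrite dhl_lc in E. specialize (Bp' m' k' Hp'). specialize (Bm' m' k' Hp'). lra.
Qed.

Lemma match_hl_le f f' Rl m k m' k' : Markov f' -> IsoRel f f' Rl ->
  Match f f' Rl m k m' k' -> hl f' m' k' <= hl f m k.
Proof.
  intros Hf' (I1 & _ & I3 & _ & I5) (_ & Hp' & gp & gm & gp' & gm' & HC & Rp & Rm & Dp & Dm).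
  destruct HC as (_ & _ & _ & _ & _ & _ & _ & _ & _ & Hcmp).
  apply (Hcmp f' m' k' gp' gm' Hf' Hp'); try assumption.
  - apply (I1 _ _ Rp).
  - apply (I1 _ _ Rm).
  - intros r s K. apply iff_sym, I5. now apply I3.
Qed.

(** If the images agree, both facets are carried into the line where that curve is stretched by its
    full length, so the midpoint of the second facet lies on the line through the first. There the
    first curve attains the norm, but only the second curve attains it inside its own facet. *)
Lemma match_inj f f' Rl m1 k1 m2 k2 m1' k1' m2' k2' : Markov f -> Markov f' -> IsoRel f f' Rl ->
  Match f f' Rl m1 k1 m1' k1' -> Match f f' Rl m2 k2 m2' k2' ->
  samepm m2' k2' m1' k1' -> samepm m1 k1 m2 k2.
Proof.
  intros Hf Hf' (I1 & _ & I3 & I4 & _) (Hp1 & Hp1' & gp1 & gm1 & gp1' & gm1' & C1 & Rp1 & Rm1 & Dp1' & Dm1')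
    (Hp2 & Hp2' & gp2 & gm2 & gp2' & gm2' & C2 & Rp2 & Rm2 & Dp2' & Dm2') Hs.
  destruct C1 as (_ & _ & Dp1 & Dm1 & _ & _ & _ & Span & _ & _).
  destruct C2 as (Tp2 & Tm2 & _ & _ & _ & _ & _ & _ & Strict & _).
  apply Strict; [exact Hp1|].
  set (z := lc (/ 2) (/ 2) gp2 gm2). set (z' := lc (/ 2) (/ 2) gp2' gm2').
  assert (Rz : Rl z z') by now apply I3.
  destruct (Span z (tan_lc _ _ _ _ _ Tp2 Tm2)) as (r & s & E).
  assert (E' : eqp z' (lc r s gp1' gm1')).
  { apply (I4 z z' (lc r s gp1 gm1)); [exact Rz|now apply I3|exact E]. }
  assert (Hh' := hl_pos f' _ _ Hf' Hp1').
  assert (Dz : dhl f' z' m1' k1' = hl f' m1' k1').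
  { assert (X : dhl f' z' m2' k2' = hl f' m2' k2') by (unfold z'; rewrite dhl_lc, Dp2', Dm2'; field).
    destruct Hs as [[-> ->]|[-> ->]]; [exact X|].
    destruct (I1 _ _ Rz) as [_ Tz'].
    rewrite (hl_even f' _ _ (proj1 (proj1 Hf')) Hp1') in X.
    rewrite (dhl_even f' z' _ _ (proj1 (proj1 Hf')) (proj1 (proj1 Tz')) Hp1') in X. exact X. }
  rewrite (dhl_eqp f' _ _ _ _ E' Hp1'), dhl_lc, Dp1', Dm1' in Dz.
  assert (Hrs : r + s = 1) by (apply (Rmult_eq_reg_r (hl f' m1' k1')); lra).
  rewrite (dhl_eqp f _ _ _ _ E Hp1), dhl_lc, Dp1, Dm1, <- Rmult_plus_distr_r, Hrs. ring.
Qed.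

(** * Comparison of the three smallest traces *)

Lemma hl_le_f f f' p q r s : Markov f -> Markov f' -> prim p q -> prim r s ->
  hl f p q <= hl f' r s -> f p q <= f' r s.
Proof.
  intros Hf Hf' Hp Hr H. rewrite (hl_cosh f), (hl_cosh f') by assumption.
  destruct (Rle_lt_or_eq_dec _ _ H) as [H1| ->]; [|lra].
  generalize (cosh_lt (hl f p q) (hl f' r s)) (hl_pos f p q Hf Hp). lra.
Qed.

(** Counting: among three distinct curves at most one is (1, 0) and at most one is (0, 1), and every
    other curve has trace at least that of (1, 1). *)
Lemma root_count g x y z p1 q1 p2 q2 p3 q3 : Markov g -> Root g -> x <= y -> y <= z ->
  prim p1 q1 -> prim p2 q2 -> prim p3 q3 ->
  ~ samepm p1 q1 p2 q2 -> ~ samepm p1 q1 p3 q3 -> ~ samepm p2 q2 p3 q3 ->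
  g p1 q1 <= x -> g p2 q2 <= y -> g p3 q3 <= z ->
  g 1%Z 0%Z <= x /\ g 0%Z 1%Z <= y /\ g 1%Z 1%Z <= z.
Proof.
  intros Hg HR Hxy Hyz P1 P2 P3 N12 N13 N23 G1 G2 G3.
  pose proof HR as (R1 & R2 & _). pose proof Hg as ((He & _) & _).
  assert (E10 : forall p, (p = 1 \/ p = -1)%Z -> g p 0%Z = g 1%Z 0%Z).
  { intros p [-> | ->]; [reflexivity|]. exact (He 1%Z 0%Z prim_10). }
  assert (E01 : forall q, (q = 1 \/ q = -1)%Z -> g 0%Z q = g 0%Z 1%Z).
  { intros q [-> | ->]; [reflexivity|]. exact (He 0%Z 1%Z prim_01). }
  set (J1 := fun p q => (q = 0 /\ (p = 1 \/ p = -1))%Z). set (J2 := fun p q => (p = 0 /\ (q = 1 \/ q = -1))%Z).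
  assert (Cases : forall p q, prim p q ->
     J1 p q /\ g p q = g 1%Z 0%Z \/ J2 p q /\ g p q = g 0%Z 1%Z \/ g 1%Z 1%Z <= g p q).
  { intros p q Hp. destruct (root_min g Hg HR p q Hp) as [[H1 H2]|[[H1 H2]|H]].
    - left. split; [split; assumption|]. subst q. now apply E10.
    - right; left. split; [split; assumption|]. subst p. now apply E01.
    - right; right. exact H. }
  assert (S1 : forall p q r s, J1 p q -> J1 r s -> samepm p q r s) by (unfold J1, samepm; intros; lia).
  assert (S2 : forall p q r s, J2 p q -> J2 r s -> samepm p q r s) by (unfold J2, samepm; intros; lia).
  clearbody J1 J2.
  destruct (Cases p1 q1 P1) as [[A1 B1]|[[A1 B1]|B1]];
  destruct (Cases p2 q2 P2) as [[A2 B2]|[[A2 B2]|B2]];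
  destruct (Cases p3 q3 P3) as [[A3 B3]|[[A3 B3]|B3]];
  try (exfalso; (apply N12; (now apply S1) || now apply S2) || (apply N13; (now apply S1) || now apply S2) ||
    (apply N23; (now apply S1) || now apply S2));
  repeat split; lra.
Qed.

(** The three shortest curves of f are matched with three distinct curves of f' that are not longer,
    and the root of f' is minimal among such triples. *)
Lemma root_le f f' Rl g g' : Markov f -> Markov f' -> IsoRel f f' Rl ->
  Reach f g -> Root g -> Reach f' g' -> Root g' ->
  g' 1%Z 0%Z <= g 1%Z 0%Z /\ g' 0%Z 1%Z <= g 0%Z 1%Z /\ g' 1%Z 1%Z <= g 1%Z 1%Z.
Proof.
  intros Hf Hf' HI Rg HR Rg' HR'.
  pose proof (reach_markov _ _ Hf Rg) as Hg. pose proof (reach_markov _ _ Hf' Rg') as Hg'.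
  destruct Rg as (a & b & c & d & Hu & E). destruct Rg' as (a' & b' & c' & d' & Hu' & E').
  destruct (unimod_inv a b c d Hu) as (i1 & i2 & i3 & i4 & Hv & HM).
  destruct (unimod_inv a' b' c' d' Hu') as (j1 & j2 & j3 & j4 & Hv' & HM').
  assert (Ex : forall p q, prim p q -> exists r s, prim r s /\ g' r s <= g p q /\
     exists m k, Match f f' Rl (a * p + b * q) (c * p + d * q) m k /\ (r = j1 * m + j2 * k /\ s = j3 * m + j4 * k)%Z).
  { intros p q Hp. pose proof (gcd_mat _ _ _ _ _ _ Hu Hp) as Hp2.
    destruct (match_exists f f' Rl _ _ Hf Hf' HI Hp2) as (m & k & Mt).
    exists (j1 * m + j2 * k)%Z, (j3 * m + j4 * k)%Z. pose proof Mt as (_ & Hmk & _).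
    split; [now apply gcd_mat|]. split.
    - rewrite E, E'. unfold cob. destruct (HM' m k) as (F1 & F2 & _). rewrite F1, F2.
      apply hl_le_f; try assumption. now apply (match_hl_le f f' Rl).
    - exists m, k. tauto. }
  destruct (Ex _ _ prim_10) as (r1 & s1 & P1 & G1 & m1 & k1 & M1 & F1).
  destruct (Ex _ _ prim_01) as (r2 & s2 & P2 & G2 & m2 & k2 & M2 & F2).
  destruct (Ex _ _ prim_11) as (r3 & s3 & P3 & G3 & m3 & k3 & M3 & F3).
  assert (Inj : forall p q p' q' m k m' k' r s r' s', 
     Match f f' Rl (a * p + b * q) (c * p + d * q) m k -> Match f f' Rl (a * p' + b * q') (c * p' + d * q') m' k' ->
     (r = j1 * m + j2 * k /\ s = j3 * m + j4 * k)%Z -> (r' = j1 * m' + j2 * k' /\ s' = j3 * m' + j4 * k')%Z ->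
     samepm r s r' s' -> samepm p q p' q').
  { intros p q p' q' m k m' k' r s r' s' Mt Mt' (-> & ->) (-> & ->) Hs.
    assert (Hs' : samepm m k m' k').
    { destruct (HM' m k) as (A1 & A2 & _). destruct (HM' m' k') as (B1 & B2 & _).
      destruct Hs as [[S1 S2]|[S1 S2]]; rewrite S1, S2 in A1, A2; [left|right]; lia. }
    pose proof (match_inj f f' Rl _ _ _ _ _ _ _ _ Hf Hf' HI Mt' Mt Hs') as Hs2.
    destruct (HM p q) as (_ & _ & A1 & A2). destruct (HM p' q') as (_ & _ & B1 & B2).
    destruct Hs2 as [[S1 S2]|[S1 S2]]; rewrite S1, S2 in B1, B2; [left|right]; lia. }
  pose proof HR as (R1 & R2 & _).
  apply (root_count g' _ _ _ r1 s1 r2 s2 r3 s3); try assumption.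
  - intros Hs. pose proof (Inj _ _ _ _ _ _ _ _ _ _ _ _ M1 M2 F1 F2 Hs) as H. unfold samepm in H. lia.
  - intros Hs. pose proof (Inj _ _ _ _ _ _ _ _ _ _ _ _ M1 M3 F1 F3 Hs) as H. unfold samepm in H. lia.
  - intros Hs. pose proof (Inj _ _ _ _ _ _ _ _ _ _ _ _ M2 M3 F2 F3 Hs) as H. unfold samepm in H. lia.
Qed.

Lemma reach_sym f g : Reach f g -> Reach g f.
Proof.
  intros (a & b & c & d & Hu & E). destruct (unimod_inv a b c d Hu) as (a' & b' & c' & d' & Hv & HM).
  exists a', b', c', d'. split; [exact Hv|]. intros p q. unfold cob. rewrite E. unfold cob.
  destruct (HM p q) as (F1 & F2 & _). now rewrite F1, F2.
Qed.

Lemma orbit_of_isometry X Y L : Teich X -> Teich Y -> ThIsometricIso X Y L -> same_emcg_orbit X Y.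
Proof.
  intros HX HY HL. apply orbit_iff; [exact HX|exact HY|].
  pose proof (T_markov X HX) as MX. pose proof (T_markov Y HY) as MY.
  destruct (isorel_of_isometry X Y L HX HY HL) as (Rl & I1 & I2).
  destruct (root_exists (T X) MX) as (g & Rg & HR). destruct (root_exists (T Y) MY) as (g' & Rg' & HR').
  destruct (root_le _ _ _ _ _ MX MY I1 Rg HR Rg' HR') as (A1 & A2 & A3).
  destruct (root_le _ _ _ _ _ MY MX I2 Rg' HR' Rg HR) as (B1 & B2 & B3).
  assert (E : eqp g' g).
  { intros p q. apply trace_unique; [apply (reach_markov _ _ MY Rg')|apply (reach_markov _ _ MX Rg)| | |]; lra. }
  destruct (reach_sym _ _ Rg') as (r & s & t & u & Hu & Er).
  destruct (reach_trans _ _ (cob r s t u g) Rg) as (a & b & c & d & Hu2 & E2).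
  { exists r, s, t, u. split; [exact Hu|reflexivity]. }
  exists a, b, c, d. split; [exact Hu2|]. intros p q Hp. rewrite Er, <- E2.
  unfold cob. apply E. now apply gcd_mat.
Qed.

Theorem theorem1p4 (X Y : point) (hX : Teich X) (hY : Teich Y) :
  (exists L : point -> point, ThIsometricIso X Y L) <-> same_emcg_orbit X Y.
Proof.
  split.
  - intros [L HL]. now apply (orbit_of_isometry X Y L).
  - now apply isometry_of_orbit.
Qed.
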